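(* Let $G$ be a locally compact group with $\kappa(G)>\aleph_0$ (i.e. $G$ is not $\sigma$-compact). Then $\mathrm{TLIM}_0(G)=\mathrm{TLIM}(G)$.
   Context: For $S\subset G$, $\kappa(S)$ is the smallest cardinality of a collection of compact subsets of $G$ whose union contains $S$. $|E|$ denotes the left Haar measure of $E\subset G$. $\mathcal L_\infty(G)$ is the usual space with respect to Haar measure, identified with the dual of $\mathcal L_1(G)$. The set of means is $\mathcal M(G)=\{\mu\in\mathcal L_\infty^*(G): \|\mu\|=1,\ \mu\ge 0\}$. Each $f\in\mathcal L_1(G)$ is regarded as an element of $\mathcal L_\infty^*(G)$ via $\phi\mapsto\int_G f\phi$; $\mathcal M_1(G)=\{f\in\mathcal L_1(G):\|f\|_1=1,\ f\ge0\}$. Write $l_x\phi(y)=\phi(x^{-1}y)$ and, for $f\in\mathcal M_1(G)$, $\phi\in\mathcal L_\infty(G)$, $f*\phi=\int_G f(x)\,l_x\phi\,dx$. The topological left-invariant means are $\mathrm{TLIM}(G)=\{\mu\in\mathcal M(G): \mu(\phi)=\mu(f*\phi)\ \text{for all } f\in\mathcal M_1(G),\ \phi\in\mathcal L_\infty(G)\}$. For a compact set $A\subset G$ of positive measure, $\mu_A=\chi_A/|A|$. For $K\subset G$ and $\epsilon>0$, $\mathscr C^+(K,\epsilon)$ is the set of compact $A\subset G$ with $|A|>0$ and $|xA\triangle A|/|A|<\epsilon$ for all $x\in K$. For a mean $\mu$ write $\mu(E)=\mu(\chi_E)$. For a finite measurable partition $\mathcal P$ of $G$ and $\epsilon\in(0,1)$,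 $\mathcal N(\mu,\mathcal P,\epsilon)=\{\nu\in\mathcal M(G): |\mu(E)-\nu(E)|<\epsilon\ \text{for all } E\in\mathcal P\}$. Then $\mathrm{TLIM}_0(G)$ is the set of $\mu\in\mathrm{TLIM}(G)$ such that for every finite measurable partition $\mathcal P$ of $G$, every compact $K\subset G$ and every $\epsilon\in(0,1)$ there is $A\in\mathscr C^+(K,\epsilon)$ with $\mu_A\in\mathcal N(\mu,\mathcal P,\epsilon)$. *)

(* Defs.v *)
From HB Require Import structures.
From mathcomp Require Import all_boot all_order all_algebra.
From mathcomp Require Import all_classical all_reals all_analysis.
From mathcomp Require Import measurable_realfun.

Set Implicit Arguments.
Unset Strict Implicit.
Unset Printing Implicit Defensive.

Import Order.TTheory GRing.Theory Num.Theory.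
Import numFieldNormedType.Exports.

Local Open Scope classical_set_scope.
Local Open Scope ring_scope.

(* Possibly non-commutative topological groups, written multiplicatively.     *)
(* The distinguished point is only there because measurableType needs one.    *)
HB.mixin Record isTopologicalGroup G & Group G & PointedTopological G := {
  mulg_continuous : continuous (fun p : G * G => (p.1 * p.2)%g) ;
  invg_continuous : continuous (fun x : G => x^-1%g)
}.

#[short(type="topologicalGroupType")]
HB.structure Definition TopologicalGroup :=
  {G of isTopologicalGroup G & Group G & PointedTopological G}.

Notation borel G := (g_sigma_algebraType (@open G)).

Definition translate (G : topologicalGroupType) (x : G) (A : set G) : set G :=
  [set (x * y)%g | y in A].

Definition symdiff (T : Type) (A B : set T) : set T := (A `\` B) `|` (B `\` A).

Definition compact_cover (G : topologicalGroupType) (S : set G)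
    (C : set (set G)) : Prop :=
  (forall K, C K -> compact K) /\ S `<=` \bigcup_(K in C) K.

(* kappa S > #|D|, where kappa S is the least cardinal of a compact cover of  *)
(* S: no compact cover of S has cardinal at most that of D.                   *)
Definition kappa_gt (G : topologicalGroupType) (S : set G)
    (T : Type) (D : set T) : Prop :=
  forall C, compact_cover S C -> ~ (C #<= D)%card.

(* The regularity convention (outer regular on Borel sets, inner regular on   *)
(* open sets) matters here since G need not be sigma-compact.                 *)
Record left_haar_measure (R : realType) (G : topologicalGroupType)
    (haar : {measure set (borel G) -> \bar R}) : Prop := LeftHaarMeasure {
  haar_nonzero : haar [set: borel G] != 0%E ;
  haar_compact : forall K : set G, compact K -> (haar K < +oo)%E ;
  haar_outer : forall E : set (borel G), measurable E ->
    haar E = ereal_inf [set haar U | U in [set U : set G | open U /\ E `<=` U]] ;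
  haar_inner : forall U : set G, open U ->
    haar U =
      ereal_sup [set haar K | K in [set K : set G | compact K /\ K `<=` U]] ;
  haar_left_invariant : forall (x : G) (E : set (borel G)), measurable E ->
    haar (translate x E) = haar E
}.

Section Linf.
Context {R : realType} {G : topologicalGroupType}.
Variable haar : {measure set (borel G) -> \bar R}.

(* As haar need not be sigma-finite, the dual of L_1 consists of locally      *)
(* measurable functions, identified when they agree off a locally null set.   *)
Definition locally_measurable (E : set (borel G)) : Prop :=
  forall F : set (borel G), measurable F -> (haar F < +oo)%E ->
    measurable (E `&` F).

Definition locally_ae (P : set (borel G)) : Prop :=
  forall F : set (borel G), measurable F -> (haar F < +oo)%E ->
    haar.-negligible (F `&` ~` P).

Definition locally_measurable_fun (f : borel G -> R) : Prop :=
  forall F : set (borel G), measurable F -> (haar F < +oo)%E ->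
    measurable_fun F f.

Definition locally_ess_bounded (f : borel G -> R) : Prop :=
  exists M : R, locally_ae [set x | `|f x| <= M].

Definition Linf_pred : {pred (borel G -> R)} :=
  mem [set f | locally_measurable_fun f /\ locally_ess_bounded f].

Lemma locally_aeI (P Q S : set (borel G)) : P `&` Q `<=` S ->
  locally_ae P -> locally_ae Q -> locally_ae S.
Proof.
move=> PQS aeP aeQ F mF Foo.
apply: (negligibleS _ (negligibleU (aeP F mF Foo) (aeQ F mF Foo))) => x [Fx nSx].
by have [Px|nPx] := pselect (P x); [right; split => // Qx; exact/nSx/PQS|left].
Qed.

Lemma locally_aeT (P : set (borel G)) : (forall x, P x) -> locally_ae P.
Proof.
move=> PT F mF Foo.
by apply: (negligibleS _ (negligible_set0 haar)) => x [_ /(_ (PT x))].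
Qed.

Lemma Linf_submod_closed : submod_closed Linf_pred.
Proof.
split.
  rewrite inE/=; split; first by move=> F mF _; exact: measurable_cst.
  by exists 0; apply: locally_aeT => x /=; rewrite normr0.
move=> a f g; rewrite !inE/= => -[mf [M fM]] [mg [N gN]]; split.
  move=> F mF Foo; apply: measurable_funD; last exact: mg.
  by apply: measurable_funM; [exact: measurable_cst|exact: mf].
exists (`|a| * M + N); apply: (locally_aeI _ fM gN) => x /= [fxM gxN].
rewrite (le_trans (ler_normD _ _))// lerD// normrM ler_wpM2l//.
Qed.

HB.instance Definition _ :=
  GRing.isSubmodClosed.Build R (borel G -> R) Linf_pred Linf_submod_closed.

(* Representatives, with the seminorm Linf_norm: its null space is the space  *)
(* of locally null functions, and a functional of finite norm vanishes there, *)
(* so these functionals are exactly the dual of the quotient.                 *)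
Record Linf : Type := MkLinf {
  Linf_fun :> borel G -> R ;
  Linf_funP : Linf_fun \in Linf_pred
}.

HB.instance Definition _ := [isSub for Linf_fun].
HB.instance Definition _ := [Choice of Linf by <:].
HB.instance Definition _ := [SubChoice_isSubLmodule of Linf by <:].

Definition Linf_norm (phi : Linf) : R :=
  inf [set M | 0 <= M /\ locally_ae [set x | `|phi x| <= M]].

(* f itself when f represents an element of L_oo(G), and 0 otherwise.         *)
Definition to_Linf (f : borel G -> R) : Linf := insubd (0 : Linf) f.

Lemma to_LinfE (f : borel G -> R) : f \in Linf_pred -> to_Linf f = f :> (_ -> _).
Proof. by move=> fL; rewrite /to_Linf -[LHS]/(val _) insubdK. Qed.

Definition chi (E : set (borel G)) : Linf := to_Linf \1_E.

Lemma chiE (E : set (borel G)) : locally_measurable E ->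
  chi E = \1_E :> (borel G -> R).
Proof.
move=> mE; apply: to_LinfE; rewrite inE/=; split; last first.
  exists 1; apply: locally_aeT => x /=.
  by rewrite indicE; case: (x \in E); rewrite ?normr1 ?normr0.
move=> F mF Foo; apply: (@eq_measurable_fun _ _ _ _ F (\1_(E `&` F) : borel G -> R)).
  by move=> x /set_mem Fx; rewrite !indicE in_setI (mem_set Fx) andbT.
by apply: measurable_indic; exact: mE.
Qed.

Definition mean : set (Linf -> R) := [set mu |
  [/\ scalar mu,
      ereal_sup [set `|mu phi|%:E | phi in [set phi | Linf_norm phi <= 1]] = 1%E
    & forall phi : Linf, locally_ae [set x | 0 <= phi x] -> 0 <= mu phi]].

Definition M1 : set (borel G -> R) := [set f |
  [/\ f \in Lfun haar 1,
      'N[haar]_1[EFin \o f]%E = 1%E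
    & {ae haar, forall x, 0 <= f x}]].

(* L_1(G) regarded inside the dual of L_oo(G).                                *)
Definition L1_functional (f : borel G -> R) : Linf -> R :=
  fun phi => Rintegral haar setT (fun x => f x * phi x).

Definition ltranslate (x : G) (phi : borel G -> R) : borel G -> R :=
  fun y => phi (x^-1 * y)%g.

(* For f in L_1(G) the integral exists for every y and is a bounded           *)
(* continuous function of y, hence is in L_oo(G).                             *)
Definition convolution (f : borel G -> R) (phi : Linf) : Linf :=
  to_Linf (fun y => Rintegral haar setT (fun x => f x * ltranslate x phi y)).

Definition TLIM : set (Linf -> R) := [set mu | mean mu /\
  forall f phi, M1 f -> mu phi = mu (convolution f phi)].

Definition mu_ (A : set (borel G)) : borel G -> R :=
  fun x => \1_A x / fine (haar A).

Definition Cplus (K : set G) (eps : R) : set (set G) := [set A |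
  [/\ compact A, (0 < haar A)%E
    & forall x, K x ->
        fine (haar (symdiff (translate x A) A)) / fine (haar A) < eps]].

Definition finite_measurable_partition (P : set (set (borel G))) : Prop :=
  [/\ finite_set P, partition P id [set: borel G]
    & forall E, P E -> locally_measurable E].

Definition mean_nbhs (mu : Linf -> R) (P : set (set (borel G))) (eps : R) :
    set (Linf -> R) := [set nu | mean nu /\
  forall E, P E -> `|mu (chi E) - nu (chi E)| < eps].

Definition TLIM0 : set (Linf -> R) := [set mu | TLIM mu /\
  forall P K (eps : R), finite_measurable_partition P ->
    compact K -> 0 < eps < 1 ->
    exists2 A, Cplus K eps A & mean_nbhs mu P eps (L1_functional (mu_ A))].

End Linf.

Arguments mean {R G} haar _ : assert.
Arguments M1 {R G} haar _ : assert.
Arguments TLIM {R G} haar _ : assert.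
Arguments TLIM0 {R G} haar _ : assert.

(* Main.v *)
Require Import Defs.
From mathcomp Require Import all_boot all_order all_algebra.
From mathcomp Require Import all_classical all_reals all_analysis.
From mathcomp Require Import measurable_realfun.
From mathcomp Require Import ring lra.

(** Let [mu] be a topologically left-invariant mean and [s] a finite list of sets
on which it must be approximated.

A compact set [A] of positive measure has right translates [A y], and the
proportion [translate_avg haar A E y] of [A y] inside [E] is a continuous function
of [y] whose mean is [mu E] ([mval_translate_avg]). So the vector of the [mu E] is
almost a convex combination of the vectors attached to single translates: cut the
group into finitely many Borel cells on which all the averages are nearly constant
([small_oscillation]) and weight each cell with its mean. To realize this
combination by the normalized indicator of one set, take the union of many
disjoint translates [A y], with numbers of translates in the various cells
chosen according to the weights. If [A] is almost invariant under left translation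
by [K], so is the union, because right translation preserves the ratio of the
displaced measure to the whole measure ([union_displacement]).

The measure of [A y] is [modular y] times that of [A], so the number of
translates controls the weights only if [modular] is almost constant on the
points chosen in a cell; and there must be room for arbitrarily many disjoint
translates. This is where the group must not be sigma-compact: a sigma-compact set
has arbitrarily many disjoint left translates, hence mean zero
([sigma_compact_null]); so among the countably many slices of a cell of positive
mean on which [modular] varies little, one is contained in no compact set
([unbounded_slice]), and disjoint translates can be picked from it one after the
other ([disjoint_selection]).

The almost invariant set [A] comes from [mu] by the theorems of Reiter and Folner.
Suppose no convex combination of right translates of a small density [mu_ U] is almost
the same as its analogues for finitely many [U a]. By the Hahn-Banach theorem a
linear functional on n-tuples of integrable functions detects this, and evaluated
on right translates it becomes a tuple of bounded continuous functions that
contradict the left invariance of [mu] ([right_reiter]). Since the density of a compact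
set is almost a combination of densities of such [U a] ([right_approx]), left translation
by a compact set of elements hardly moves some density ([reiter]), then, through its
level sets, some compact set ([folner]).

All this needs some uniqueness of Haar measure: the modular function, and the
fact that inversion almost preserves measure near the identity. Both follow from
one inequality between the measures of compact sets, [double_count], which is
proved by finite sums and outer regularity because Fubini's theorem does not apply
to Borel sets of the square of a group that is not second countable. *)

Set Implicit Arguments.
Unset Strict Implicit.
Unset Printing Implicit Defensive.

Import Order.TTheory GRing.Theory Num.Theory.
Import numFieldNormedType.Exports.

Local Open Scope classical_set_scope.
Local Open Scope ring_scope.

(** * Topological groups *)

Section GroupTopology.
Context {G : topologicalGroupType}.
Implicit Types (x y z : G) (A B C N U V W : set G).

(** Right translates and inverses are preimages rather than images, so that
    membership in them computes. *)
Definition rtranslate A y : set G := [set z | A (z * y^-1)%g].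
Definition invset A : set G := [set z | A z^-1%g].
Definition mulset A B : set G := [set (p.1 * p.2)%g | p in A `*` B].

Lemma translateE x A : translate x A = [set z | A (x^-1 * z)%g].
Proof.
apply/seteqP; split => [z [y Ay <-]|z /= Az]; first by rewrite /= mulKg.
by exists (x^-1 * z)%g => //; rewrite mulVKg.
Qed.

Lemma rtranslateE y A : rtranslate A y = [set (z * y)%g | z in A].
Proof.
apply/seteqP; split => [z /= Az|_ [z Az <-]]; last by rewrite /rtranslate /= mulgK.
by exists (z * y^-1)%g => //; rewrite mulgVK.
Qed.

Lemma invsetE A : invset A = [set z^-1%g | z in A].
Proof.
apply/seteqP; split => [z /= Az|_ [z Az <-]]; last by rewrite /invset /= invgK.
by exists z^-1%g => //; rewrite invgK.
Qed.

Lemma invsetK A : invset (invset A) = A.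
Proof. by apply/seteqP; split => z; rewrite /invset/= invgK. Qed.

Lemma rtranslateK A y : rtranslate (rtranslate A y) y^-1%g = A.
Proof. by apply/seteqP; split => z; rewrite /rtranslate/= invgK mulgK. Qed.

Lemma rtranslateVK A y : rtranslate (rtranslate A y^-1%g) y = A.
Proof. by apply/seteqP; split => z; rewrite /rtranslate/= invgK mulgVK. Qed.

Lemma rtranslateM A y z : rtranslate A (y * z)%g = rtranslate (rtranslate A y) z.
Proof. by apply/seteqP; split => w; rewrite /rtranslate/= invgM mulgA. Qed.

Lemma translate1 A : translate 1%g A = A.
Proof. by rewrite translateE; apply/seteqP; split => z /=; rewrite invg1 mul1g. Qed.

Lemma translateM x y A : translate (x * y)%g A = translate x (translate y A).
Proof.
by rewrite !translateE; apply/seteqP; split => z /=; rewrite invgM mulgA.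
Qed.

Lemma rtranslateS A B y : A `<=` B -> rtranslate A y `<=` rtranslate B y.
Proof. by move=> AB z; exact: AB. Qed.

Lemma invsetS A B : A `<=` B -> invset A `<=` invset B.
Proof. by move=> AB z; exact: AB. Qed.

Lemma mulset_in A B x y : A x -> B y -> mulset A B (x * y)%g.
Proof. by move=> Ax By; exists (x, y). Qed.

Lemma continuous_mul2 (T : topologicalType) (f g : T -> G) :
  continuous f -> continuous g -> continuous (fun t => (f t * g t)%g).
Proof.
move=> cf cg t; apply: (@continuous2_cvg _ _ _ _ (nbhs t) _ f g).
- exact: (mulg_continuous (f t, g t)).
- exact: cf.
- exact: cg.
Qed.

Lemma continuous_lmul x : continuous (fun z => (x * z)%g).
Proof. by apply: continuous_mul2 => [?|?]; [exact: cvg_cst|exact: cvg_id]. Qed.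

Lemma continuous_rmul y : continuous (fun z => (z * y)%g).
Proof. by apply: continuous_mul2 => [?|?]; [exact: cvg_id|exact: cvg_cst]. Qed.

Lemma open_translate x A : open A -> open (translate x A).
Proof.
by rewrite translateE; move/continuousP: (@continuous_lmul x^-1%g); exact.
Qed.

Lemma open_rtranslate A y : open A -> open (rtranslate A y).
Proof. by move/continuousP: (@continuous_rmul y^-1%g); exact. Qed.

Lemma open_invset A : open A -> open (invset A).
Proof. by move/continuousP: (@invg_continuous G); exact. Qed.

Lemma compact_image (T : topologicalType) (f : T -> G) (A : set T) :
  continuous f -> compact A -> compact (f @` A).
Proof.
by move=> cf; apply: continuous_compact; apply: continuous_subspaceT.
Qed.

Lemma compact_translate x A : compact A -> compact (translate x A).
Proof. exact/compact_image/continuous_lmul. Qed.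

Lemma compact_rtranslate A y : compact A -> compact (rtranslate A y).
Proof. by rewrite rtranslateE; apply/compact_image/continuous_rmul. Qed.

Lemma compact_invset A : compact A -> compact (invset A).
Proof. by rewrite invsetE; apply/compact_image/invg_continuous. Qed.

Lemma compact_mulset A B : compact A -> compact B -> compact (mulset A B).
Proof.
by move=> cA cB; apply: (compact_image mulg_continuous); exact: compact_setX.
Qed.

Lemma nbhs_rtranslate y A : nbhs 1%g A -> nbhs y (rtranslate A y).
Proof.
move=> A1; have := @continuous_rmul y^-1%g y; apply => /=; by rewrite mulgV.
Qed.

Lemma nbhs_invset A : nbhs 1%g A -> nbhs 1%g (invset A).
Proof. by move=> A1; have := @invg_continuous G 1%g; apply => /=; rewrite invg1. Qed.

(** Continuity at the points [(1, a)], made uniform in [a] by compactness. *)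
Lemma compact_nbhs1 A V (f : G -> G -> G) :
  continuous (fun p : G * G => f p.1 p.2) -> (forall a, f 1%g a = a) ->
  compact A -> open V -> A `<=` V ->
  \forall w \near nbhs 1%g, forall a, A a -> V (f w a).
Proof.
move=> cf f1 /compact_near_coveringP cA oV AV.
have := cA G (nbhs 1%g) (fun w a => V (f w a)) _; apply => a Aa.
have VN : nbhs (f 1%g a) V by rewrite f1; apply: open_nbhs_nbhs; split => //; exact: AV.
have := cf (1%g, a) V VN => -[[P Q] /= [P1 Qa] PQ].
by exists (Q, P) => //= -[b w] [/= Qb Pw]; exact: (PQ (w, b)).
Qed.

Lemma compact_nbhs_mul A V : compact A -> open V -> A `<=` V ->
  \forall w \near nbhs 1%g, forall a, A a -> V (w * a)%g /\ V (a * w)%g.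
Proof.
move=> cA oV AV.
have H1 := @compact_nbhs1 A V (fun w a => w * a)%g mulg_continuous (@mul1g G) cA oV AV.
have c2 : continuous (fun p : G * G => p.2 * p.1)%g.
  by apply: continuous_mul2 => -[x y]; [exact: cvg_snd|exact: cvg_fst].
have H2 := @compact_nbhs1 A V (fun w a => a * w)%g c2 (@mulg1 G) cA oV AV.
by near=> w => a Aa; split; [move: a Aa|move: a Aa]; near: w.
Unshelve. all: by end_near. Qed.

Lemma nbhs1_sym N : nbhs 1%g N ->
  exists2 W, open W & [/\ W 1%g, invset W = W & W `<=` N].
Proof.
move=> N1; pose W := N° `&` invset N°.
exists W; first by apply: openI; [exact: open_interior|exact/open_invset/open_interior].
split.
- by split; [exact: N1|rewrite /invset/= invg1; exact: N1].
- by apply/seteqP; split => z; rewrite /W /invset/= invgK => -[].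
- by move=> z [/interior_subset].
Qed.

Lemma open_nbhs1 W : open W -> W 1%g -> nbhs 1%g W.
Proof. by move=> oW W1; exact: open_nbhs_nbhs. Qed.

End GroupTopology.

Section LocallyCompactGroup.
Context {G : topologicalGroupType}.
Hypothesis hG : hausdorff_space G.
Hypothesis lcG : locally_compact [set: G].
Implicit Types (x y z : G) (A B C N U V W : set G).

(** A compact Hausdorff neighbourhood is regular, so it contains a closed
    neighbourhood inside [N], which can then be symmetrized. *)
Lemma compact_nbhs N : nbhs (1%g : G) N ->
  exists2 U, compact U & [/\ nbhs 1%g U, invset U = U & U `<=` N].
Proof.
move=> N1; have [D wD [cD clD]] := @lcG (1%g : G) Logic.I.
have D1 : nbhs (1%g : G) D by apply: filterS (wD : nbhs (1%g : G) (fun z => setT z -> D z)) => z; exact.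
have [M M1 MN] := compact_regular hG cD D1 N1.
pose K := D `&` closure M.
have cK : compact K by apply: compact_closedI => //; exact: closed_closure.
have K1 : nbhs 1%g K.
  by apply: filterI => //; apply: filterS M1; exact: subset_closure.
exists (K `&` invset K).
  by apply: compact_closedI => //; apply: (compact_closed hG); exact: compact_invset.
split.
- by apply: filterI => //; exact: nbhs_invset.
- by apply/seteqP; split => z; rewrite /invset/= invgK => -[].
- by move=> z [[_ /MN]].
Qed.

Lemma compact_meas A : compact A -> measurable (A : set (borel G)).
Proof.
move=> cA; rewrite -(setCK A); apply: measurableC; apply: sub_sigma_algebra.
by rewrite openC; exact: compact_closed.
Qed.

Lemma open_meas A : open A -> measurable (A : set (borel G)).
Proof. by move=> oA; exact: sub_sigma_algebra. Qed.

Lemma continuous_borel (f : G -> G) : continuous f ->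
  measurable_fun setT (f : borel G -> borel G).
Proof.
move=> /continuousP cf; apply: (@measurability _ _ (borel G) (borel G) setT f (@open G)) => //.
by move=> _ [V oV <-]; rewrite setTI; apply: open_meas; exact: cf.
Qed.

Lemma meas_translate x A : measurable (A : set (borel G)) ->
  measurable (translate x A : set (borel G)).
Proof.
move=> mA; rewrite translateE -[X in measurable X]setTI.
exact: (continuous_borel (@continuous_lmul G x^-1%g) measurableT mA).
Qed.

Lemma meas_rtranslate A y : measurable (A : set (borel G)) ->
  measurable (rtranslate A y : set (borel G)).
Proof.
move=> mA; rewrite -[X in measurable X]setTI.
exact: (continuous_borel (@continuous_rmul G y^-1%g) measurableT mA).
Qed.

Lemma meas_invset A : measurable (A : set (borel G)) ->
  measurable (invset A : set (borel G)).
Proof.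
move=> mA; rewrite -[X in measurable X]setTI.
exact: (continuous_borel (@invg_continuous G) measurableT mA).
Qed.

End LocallyCompactGroup.

(** * Real-valued integrals *)

Section L1.
Context d {T : measurableType d} {R : realType}.
Variable mu : {measure set T -> \bar R}.
Implicit Types (f g h : T -> R) (A B : set T) (c : R).

(** Only functions of finite integral occur, so that integrals, norms and
    measures can be handled as real numbers. *)
Definition integ f : Prop := mu.-integrable setT (EFin \o f).
Definition rint f : R := \int[mu]_x f x.
Definition norm1 f : R := rint (fun x => `|f x|).
Definition fmeas A : R := fine (mu A).

Lemma integ_measurable f : integ f -> measurable_fun setT f.
Proof. by move=> /measurable_int /measurable_EFinP. Qed.

Lemma integ_le f g : measurable_fun setT f -> integ g ->
  (forall x, `|f x| <= g x) -> integ f.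
Proof.
move=> mf ig fg; apply: (le_integrable measurableT _ _ ig).
  exact/measurable_EFinP.
by move=> x _ /=; rewrite lee_fin (le_trans (fg x))// ler_norm.
Qed.

Lemma integ_ext f g : f =1 g -> integ f -> integ g.
Proof. by move=> /funext ->. Qed.

Lemma integD f g : integ f -> integ g -> integ (fun x => f x + g x).
Proof. by move=> If Ig; exact: integrableD If Ig. Qed.

Lemma integZ c f : integ f -> integ (fun x => c * f x).
Proof. by move=> If; apply: (integrableZl _ c If). Qed.

Lemma integN f : integ f -> integ (fun x => - f x).
Proof. by move=> If; exact: (integrableN If). Qed.

Lemma integB f g : integ f -> integ g -> integ (fun x => f x - g x).
Proof. by move=> If Ig; exact/integD/integN. Qed.

Lemma integ0 : integ (fun=> 0).
Proof. exact: integrable0. Qed.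

Lemma integ_sum (I : Type) (s : seq I) (P : pred I) (F : I -> T -> R) :
  (forall i, P i -> integ (F i)) -> integ (fun x => \sum_(i <- s | P i) F i x).
Proof.
move=> iF; elim: s => [|i s ih].
  by apply: integ_ext integ0 => x; rewrite big_nil.
case: (boolP (P i)) => Pi.
  by apply: integ_ext (integD (iF i Pi) ih) => x; rewrite big_cons Pi.
by apply: integ_ext ih => x; rewrite big_cons (negPf Pi).
Qed.

Lemma integ_abs f : integ f -> integ (fun x => `|f x|).
Proof.
move=> If; apply: (integrable_norm If) => //.
Qed.

Lemma integ_indic A : measurable A -> (mu A < +oo)%E -> integ \1_A.
Proof.
move=> mA Aoo; apply/integrableP; split; first exact/measurable_EFinP.
rewrite (eq_integral (fun x => (\1_A x)%:E)); last first.
  by move=> t _; rewrite gee0_abs// lee_fin.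
by rewrite integral_indic// setIT.
Qed.

Lemma integM f h M : measurable_fun setT h -> (forall x, `|h x| <= M) ->
  integ f -> integ (fun x => f x * h x).
Proof.
move=> mh hM If; apply: (@integ_le _ (fun x => M * `|f x|)).
- by apply: measurable_funM => //; exact: integ_measurable.
- exact/integZ/integ_abs.
- by move=> x; rewrite normrM mulrC ler_wpM2r.
Qed.

Lemma rint_indic A : measurable A -> rint \1_A = fmeas A.
Proof. by move=> mA; rewrite /rint /Rintegral integral_indic// setIT. Qed.

Lemma rintZ c f : integ f -> rint (fun x => c * f x) = c * rint f.
Proof. by move=> If; exact: RintegralZl. Qed.

Lemma rintD f g : integ f -> integ g ->
  rint (fun x => f x + g x) = rint f + rint g.
Proof. by move=> If Ig; exact: RintegralD. Qed.

Lemma rintB f g : integ f -> integ g ->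
  rint (fun x => f x - g x) = rint f - rint g.
Proof. by move=> If Ig; exact: RintegralB. Qed.

Lemma rint0 : rint (fun=> 0) = 0.
Proof. by rewrite /rint /Rintegral integral0. Qed.

Lemma rint_ext f g : f =1 g -> rint f = rint g.
Proof. by move=> /funext ->. Qed.

Lemma rint_sum (I : Type) (s : seq I) (P : pred I) (F : I -> T -> R) :
  (forall i, P i -> integ (F i)) ->
  rint (fun x => \sum_(i <- s | P i) F i x) = \sum_(i <- s | P i) rint (F i).
Proof.
move=> iF; elim: s => [|i s ih].
  by rewrite big_nil (@rint_ext _ (fun=> 0)) ?rint0// => x; rewrite big_nil.
rewrite big_cons (rint_ext (fun x => big_cons _ _ i s P (F ^~ x))).
case: ifPn => Pi; last exact: ih.
by rewrite rintD ?ih//; [exact: iF|exact: integ_sum].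
Qed.

Lemma rint_le f g : integ f -> integ g -> (forall x, f x <= g x) ->
  rint f <= rint g.
Proof. by move=> If Ig fg; exact: le_Rintegral. Qed.

Lemma rint_ge0 f : (forall x, 0 <= f x) -> 0 <= rint f.
Proof. by move=> f0; exact: Rintegral_ge0. Qed.

Lemma norm1_ge0 f : 0 <= norm1 f.
Proof. by apply: rint_ge0 => x. Qed.

Lemma le_norm1 f : integ f -> `|rint f| <= norm1 f.
Proof. by move=> If; exact: le_normr_Rintegral. Qed.

Lemma norm1_mono f g : integ f -> integ g -> (forall x, `|f x| <= g x) ->
  norm1 f <= rint g.
Proof. by move=> If Ig fg; apply: rint_le => //; exact: integ_abs. Qed.

Lemma norm1D f g : integ f -> integ g ->
  norm1 (fun x => f x + g x) <= norm1 f + norm1 g.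
Proof.
move=> If Ig; rewrite /norm1 -rintD; [|exact: integ_abs|exact: integ_abs].
apply: rint_le; [exact/integ_abs/integD|by apply: integD; exact: integ_abs|].
by move=> x; exact: ler_normD.
Qed.

Lemma norm1Z c f : integ f -> norm1 (fun x => c * f x) = `|c| * norm1 f.
Proof.
move=> If; rewrite -rintZ; last exact: integ_abs.
by apply: rint_ext => x; rewrite normrM.
Qed.

Lemma norm1N f : norm1 (fun x => - f x) = norm1 f.
Proof. by apply: rint_ext => x; rewrite normrN. Qed.

Lemma norm1C f g : norm1 (fun x => f x - g x) = norm1 (fun x => g x - f x).
Proof. by apply: rint_ext => x; rewrite distrC. Qed.

Lemma norm1_tri g f h : integ f -> integ g -> integ h ->
  norm1 (fun x => f x - h x) <=
  norm1 (fun x => f x - g x) + norm1 (fun x => g x - h x).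
Proof.
move=> If Ig Ih; apply: le_trans (norm1D (integB If Ig) (integB Ig Ih)).
by rewrite le_eqVlt; apply/orP; left; apply/eqP/rint_ext => x; rewrite subrKA.
Qed.

Lemma norm1_sum (I : Type) (s : seq I) (P : pred I) (F : I -> T -> R) :
  (forall i, P i -> integ (F i)) ->
  norm1 (fun x => \sum_(i <- s | P i) F i x) <= \sum_(i <- s | P i) norm1 (F i).
Proof.
move=> iF; rewrite /norm1 -rint_sum; last by move=> i Pi; exact/integ_abs/iF.
apply: rint_le; first exact/integ_abs/integ_sum.
  by apply: integ_sum => i Pi; exact/integ_abs/iF.
by move=> x; exact: ler_norm_sum.
Qed.

(** The integral of [f - g] vanishes, so that its positive and negative parts
    have the same integral, and [h] dominates the positive part. *)
Lemma norm1_close f g h : integ f -> integ g -> integ h -> rint f = rint g ->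
  (forall x, 0 <= h x) -> (forall x, f x - g x <= h x) ->
  norm1 (fun x => f x - g x) <= 2 * rint h.
Proof.
move=> If Ig Ih fg h0 fgh.
have -> : 2 * rint h = rint (fun x => 2 * h x - (f x - g x)).
  by rewrite rintB; [|exact: integZ|exact: integB]; rewrite rintZ// rintB// fg subrr subr0.
apply: norm1_mono; [exact: integB|by apply: integB; [exact: integZ|exact: integB]|].
move=> x; rewrite ler_norml; have := fgh x; have := h0 x => ? ?; apply/andP; split; lra.
Qed.

Lemma fmeas_ge0 A : 0 <= fmeas A.
Proof. by rewrite fine_ge0. Qed.

Lemma fmeasE A : (mu A < +oo)%E -> (fmeas A)%:E = mu A.
Proof. by move=> Aoo; rewrite fineK// ge0_fin_numE. Qed.

Lemma fmeas_le A B : measurable A -> measurable B -> (mu B < +oo)%E ->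
  A `<=` B -> fmeas A <= fmeas B.
Proof.
move=> mA mB Boo AB; have AmB : (mu A <= mu B)%E by apply: le_measure => //; rewrite inE.
by rewrite -lee_fin !fmeasE// (le_lt_trans AmB).
Qed.

Lemma fmeas_gt0 A : (mu A < +oo)%E -> (0 < fmeas A) = (0 < mu A)%E.
Proof. by move=> Aoo; rewrite -lte_fin fmeasE. Qed.

End L1.

(** * Haar measure of compact and open sets *)

Section Haar.
Context {R : realType} {G : topologicalGroupType}.
Hypothesis hG : hausdorff_space G.
Hypothesis lcG : locally_compact [set: G].
Variable haar : {measure set (borel G) -> \bar R}.
Hypothesis haarP : left_haar_measure haar.
Implicit Types (x y z : G) (A B C K N U V W : set G).

Local Notation m := (fmeas haar).

Lemma compact_fin K : compact K -> (haar K < +oo)%E.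
Proof. exact: haar_compact haarP K. Qed.

Lemma sub_fin A B : measurable (A : set (borel G)) -> measurable (B : set (borel G)) ->
  A `<=` B -> (haar B < +oo)%E -> (haar A < +oo)%E.
Proof. by move=> mA mB AB; apply: le_lt_trans; apply: le_measure; rewrite ?inE. Qed.

Lemma fmeas_translate x (E : set (borel G)) : measurable E -> m (translate x E) = m E.
Proof. by move=> mE; rewrite /fmeas (haar_left_invariant haarP). Qed.

Lemma outer_approx (E : set (borel G)) (e : R) : measurable E -> (haar E < +oo)%E ->
  0 < e -> exists V, [/\ open V, E `<=` V, (haar V < +oo)%E & m V <= m E + e].
Proof.
move=> mE Eoo e0; have := haar_outer haarP mE; set S := (X in ereal_inf X) => ES.
have finS : ereal_inf S \is a fin_num by rewrite -ES ge0_fin_numE.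
have [_ [V [oV EV] <-]] := lb_ereal_inf_adherent e0 finS.
rewrite -ES => VE; have Voo : (haar V < +oo)%E.
  by apply: lt_trans VE _; rewrite -(fmeasE Eoo) -EFinD ltry.
by exists V; split => //; rewrite -lee_fin EFinD !fmeasE// ltW.
Qed.

(** The pieces play the role of a Riemann subdivision of [A], with sample
    points [x i]; being disjoint they make finite sums of measures exact. *)
Lemma compact_pieces A (B : G -> set G) : compact A ->
  (forall x, A x -> open (B x) /\ B x x) ->
  exists n (x : 'I_n -> G) (P : 'I_n -> set G),
    [/\ forall i, A (x i), forall i, measurable (P i : set (borel G)),
        forall i, P i `<=` A `&` B (x i), trivIset setT P &
        A = \big[setU/set0]_(i < n) P i].
Proof.
move=> cA BA; have := cA; rewrite compact.compact_cover => /(_ _ A B) [].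
- by move=> i /BA[].
- by move=> x Ax; exists x => //; case: (BA x Ax).
move=> D DA AD; pose s := finmap.enum_fset D.
pose F i := A `&` (if (i < size s)%N then B (nth 1%g s i) else set0).
have sA i : (i < size s)%N -> A (nth 1%g s i).
  by move=> si; rewrite -inE; apply: DA; exact: mem_nth.
have mF i : measurable (F i : set (borel G)).
  apply: measurableI; first exact: compact_meas.
  by case: ifP => // /sA /BA[oB _]; exact: open_meas.
exists (size s), (fun i : 'I__ => nth 1%g s i), (fun i : 'I__ => seqDU F i); split.
- by move=> i; exact: sA.
- by move=> i; exact: (seqDU_measurable mF).
- by move=> i z Pz; have := subset_seqDU Pz; rewrite /F ltn_ord.
- by move=> i j _ _ ij; apply: ord_inj; exact: (@trivIset_seqDU _ F i j Logic.I Logic.I ij).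
- rewrite -(bigsetU_seqDU F) -bigcup_mkord; apply/seteqP; split.
    move=> z Az; have [y yD Bz] := AD z Az.
    have ys : (index y s < size s)%N by rewrite index_mem.
    by exists (index y s) => //; rewrite /F ys nth_index.
  by move=> z [i _ []].
Qed.

Lemma sum_pieces n (P : 'I_n -> set G) (D : pred 'I_n) V :
  (forall i, measurable (P i : set (borel G))) -> trivIset setT P ->
  measurable (V : set (borel G)) -> (haar V < +oo)%E ->
  (forall i, D i -> P i `<=` V) -> \sum_(i < n | D i) m (P i) <= m V.
Proof.
move=> mP tP mV Voo PV; rewrite -lee_fin -sumEFin fmeasE//.
have -> : (\sum_(i < n | D i) (m (P i))%:E = haar (\big[setU/set0]_(i < n | D i) P i))%E.
  rewrite measure_bigsetU_ord//; apply: eq_bigr => i Di.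
  by rewrite fmeasE//; exact: sub_fin (PV i Di) Voo.
apply: le_measure; rewrite ?inE//; first exact: bigsetU_measurable.
by elim/big_ind : _ => // X Y XV YV; rewrite subUset.
Qed.

Lemma sum_all_pieces n (P : 'I_n -> set G) A : (haar A < +oo)%E ->
  measurable (A : set (borel G)) ->
  (forall i, measurable (P i : set (borel G))) -> trivIset setT P ->
  A = \big[setU/set0]_(i < n) P i -> m A = \sum_(i < n) m (P i).
Proof.
move=> Aoo mA mP tP AE; apply: EFin_inj; rewrite fmeasE// -sumEFin {1}AE.
rewrite measure_bigsetU_ord//; apply: eq_bigr => i _; rewrite fmeasE//.
by apply: sub_fin Aoo => //; rewrite AE (bigD1 i)//=; exact: subsetUl.
Qed.

(** Otherwise covering by translates of [U] would make every compact set null, and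
    inner regularity would make the whole group null. *)
Lemma open_pos U x : open U -> U x -> (0 < haar U)%E.
Proof.
move=> oU Ux; rewrite lt_neqAle measure_ge0 andbT; apply/eqP => /esym U0.
have K0 K : compact K -> haar K = 0%E.
  move=> cK.
  have [|n [y [P [_ mP PB tP KE]]]] := @compact_pieces K (fun y => translate (y * x^-1)%g U) cK.
    move=> y Ky; split; first exact: open_translate.
    by rewrite translateE /= invgM invgK mulgVK.
  rewrite KE measure_bigsetU_ord// big1// => i _; apply/eqP.
  rewrite eq_le measure_ge0 andbT -U0 -(haar_left_invariant haarP (y i * x^-1)%g); last exact: open_meas.
  apply: le_measure; rewrite ?inE; [exact: mP| |by move=> z /PB[]].
  by apply: open_meas; exact: open_translate.
have := haar_nonzero haarP; rewrite (haar_inner haarP openT); apply/negP; rewrite negbK.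
apply/eqP; rewrite (_ : [set _ | _ in _] = [set 0%E]) ?ereal_sup1//.
apply/seteqP; split => [_ [K [cK _] <-]|_ ->]; first exact: K0.
by exists set0; [split => //; exact: compact0|rewrite measure0].
Qed.

Lemma nbhs_pos K x : compact K -> nbhs x K -> 0 < m K.
Proof.
move=> cK; rewrite nbhsE => -[U [oU Ux] UK]; rewrite fmeas_gt0; last exact: compact_fin.
apply: lt_le_trans (open_pos oU Ux) _; apply: le_measure; rewrite ?inE//.
  exact: open_meas.
exact: compact_meas.
Qed.

End Haar.

(** * The modular function *)

Lemma ler_mul_addgt0 (R : realType) (a b c : R) : 0 <= b -> 0 <= c ->
  (forall e, 0 < e -> a <= (b + e) * (c + e)) -> a <= b * c.
Proof.
move=> b0 c0 H; apply/ler_addgt0Pr => e e0.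
have s0 : 0 < b + c + 1 by lra.
pose t := Num.min 1 (e / (b + c + 1)).
have t0 : 0 < t by rewrite lt_min ltr01 divr_gt0.
have t1 : t <= 1 by rewrite ge_min lexx.
have te : t * (b + c + 1) <= e by rewrite -ler_pdivlMr// ge_min lexx orbT.
apply: le_trans (H t t0) _; nra.
Qed.

Section Modular.
Context {R : realType} {G : topologicalGroupType}.
Hypothesis hG : hausdorff_space G.
Hypothesis lcG : locally_compact [set: G].
Variable haar : {measure set (borel G) -> \bar R}.
Hypothesis haarP : left_haar_measure haar.
Implicit Types (x y z : G) (A B C K N U V W : set G).

Local Notation m := (fmeas haar).

(** Count the pairs [(x, v)] with [x] in [C] and [v] in [x N]: for fixed [x] the
    [v] fill a set of measure [m N], and for fixed [v] the [x] belong to [v N^-1]. The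
    first variable only runs through the sample points of a subdivision of [C],
    which replaces [N^-1] by a slightly larger set, and outer regularity absorbs the
    difference. *)
Lemma double_count C N : compact C -> compact N ->
  m C * m N <= m (mulset C N) * m (invset N).
Proof.
move=> cC cN; have cCN := compact_mulset cC cN; have cN' := compact_invset cN.
apply/ler_addgt0Pr => e e0.
have d0 : 0 < m (mulset C N) + 1 by rewrite ltr_wpDl// fmeas_ge0.
have [V [oV NV Voo mV]] := outer_approx haarP (compact_meas hG cN')
  (compact_fin haarP cN') (divr_gt0 e0 d0).
have NVW : nbhs 1%g [set w | forall a, invset N a -> V (w * a)%g /\ V (a * w)%g].
  exact: compact_nbhs_mul.
have [W oW [W1 WI WNV]] := nbhs1_sym NVW.
have [|n [x [P [xC mP PC tP CE]]]] := @compact_pieces _ hG C (fun x => translate x W) cC.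
  move=> x Cx; split; first exact: open_translate.
  by rewrite translateE /= mulVg.
have mN := compact_meas hG cN.
have mxN i : measurable (translate (x i) N : set (borel G)) by exact: meas_translate.
have ixN i : integ haar (\1_(translate (x i) N) : borel G -> R).
  by apply: integ_indic => //; apply: compact_fin => //; exact: compact_translate.
have -> : m C * m N =
    rint haar (fun v => \sum_(i < n) m (P i) * \1_(translate (x i) N) v).
  rewrite rint_sum; last by move=> i _; exact: integZ.
  rewrite (sum_all_pieces _ _ _ _ CE)//; [|exact: compact_fin|exact: compact_meas].
  rewrite mulr_suml; apply: eq_bigr => i _.
  by rewrite rintZ// rint_indic// fmeas_translate.
have iCN : integ haar (\1_(mulset C N) : borel G -> R).
  by apply: integ_indic; [exact: compact_meas|exact: compact_fin].
have : m V * m (mulset C N) <= m (mulset C N) * m (invset N) + e.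
  move: mV; rewrite -(ler_pM2r d0) mulrDl divfK ?gt_eqF// => mV.
  have := fmeas_ge0 haar (mulset C N); move: mV.
  move: (m V) (m (mulset C N)) (m (invset N)) => v a b mV a0.
  have [vb|bv] := leP v b; last lra.
  by rewrite mulrC (le_trans (ler_wpM2l a0 vb))// lerDl ltW.
apply: le_trans; rewrite -(rint_indic _ (compact_meas hG cCN)) -rintZ//.
apply: rint_le; [by apply: integ_sum => i _; exact: integZ|exact: integZ|].
move=> v /=.
under eq_bigr do rewrite indicE mulr_natr mulrb.
rewrite -big_mkcond/=.
have [vCN|vCN] := boolP (v \in mulset C N); last first.
  rewrite indicE (negPf vCN) mulr0 big1// => i; rewrite inE => -[a Na xav].
  by move: vCN; rewrite notin_setE => nCN; exfalso; apply: nCN; rewrite -xav; apply: mulset_in.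
rewrite indicE vCN mulr1 -(fmeas_translate haarP v (open_meas oV)).
apply: sum_pieces => //.
- by apply: meas_translate; apply: open_meas; exact: oV.
- by rewrite (haar_left_invariant haarP)//; exact: open_meas.
move=> i; rewrite inE => -[a Na xav] z /PC [_] [w Ww <-]; rewrite translateE/= -xav.
rewrite invgM -mulgA mulKg; have [] := WNV w Ww (a^-1%g) => //.
by rewrite /invset/= invgK.
Qed.

(** For a small symmetric [M], count twice with the sets [C z] and [z^-1 M], then
    with [C'] and [M z]. As [z^-1 M] and [M z] are inverse to each other, their
    measures cancel from the product of the two inequalities. *)
Lemma rtranslate_cross_le C C' z : compact C -> compact C' ->
  m (rtranslate C z) * m C' <= m C * m (rtranslate C' z).
Proof.
move=> cC cC'; apply: ler_mul_addgt0; rewrite ?fmeas_ge0// => e e0.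
have cCz' : compact (rtranslate C' z) by exact: compact_rtranslate.
have cCz : compact (rtranslate C z) by exact: compact_rtranslate.
have [V [oV CV Voo mV]] := outer_approx haarP (compact_meas hG cC) (compact_fin haarP cC) e0.
have [V' [oV' CV' Voo' mV']] := outer_approx haarP (compact_meas hG cCz') (compact_fin haarP cCz') e0.
have N1 := compact_nbhs_mul cC oV CV.
have CV'' : C' `<=` rtranslate V' z^-1%g by rewrite -(rtranslateK C' z); exact: rtranslateS.
have N2 := compact_nbhs_mul cC' (@open_rtranslate _ _ z^-1%g oV') CV''.
have [M cM [M1 MI MN]] := compact_nbhs hG lcG (filterI N1 N2).
have cN : compact (translate z^-1%g M) by exact: compact_translate.
have NI : invset (translate z^-1%g M) = rtranslate M z.
  rewrite translateE -[in RHS]MI; apply/seteqP; split => w.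
    by rewrite /invset/rtranslate/= invgM !invgK.
  by rewrite /invset/rtranslate/= invgM !invgK.
have cN' : compact (rtranslate M z) by exact: compact_rtranslate.
have := double_count cCz cN; rewrite NI fmeas_translate//; last exact: compact_meas.
have := double_count cC' cN'; rewrite -[in invset _]NI invsetK fmeas_translate//; last exact: compact_meas.
have : m (mulset (rtranslate C z) (translate z^-1%g M)) <= m V.
  apply: fmeas_le => //; [by apply: (compact_meas hG); exact: compact_mulset|exact: open_meas|].
  move=> _ [[a b] /= [Ca + <-]]; rewrite translateE/= invgK => Mb.
  by have [/(_ _ Ca)[_]] := MN _ Mb; rewrite mulgA mulgVK.
have : m (mulset C' (rtranslate M z)) <= m V'.
  apply: fmeas_le => //; [by apply: (compact_meas hG); exact: compact_mulset|exact: open_meas|].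
  move=> _ [[a b] /= [Ca Mb] <-].
  by have [_ /(_ _ Ca)[_]] := MN _ Mb; rewrite /rtranslate/= invgK -mulgA mulgVK.
have M0 : 0 < m M by apply: nbhs_pos M1.
have M0' : 0 < m (rtranslate M z) by apply: (@nbhs_pos _ _ hG _ haarP _ z) => //; exact: nbhs_rtranslate.
have c'0 := fmeas_ge0 haar C'; have c0 := fmeas_ge0 haar (rtranslate C z).
have v0 := fmeas_ge0 haar V; have v'0 := fmeas_ge0 haar V'.
move: mV mV' M0 M0' c'0 c0 v0 v'0.
move: (m V) (m V') (m M) (m (rtranslate M z)) (m C') (m (rtranslate C z)) => v v' a b c' c mV mV' a0 b0 c'0 c0 v0 v'0 H1 H2 H3 H4.
have H5 : c' * b <= v' * a by apply: le_trans H3 _; rewrite ler_wpM2r// ltW.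
have H6 : c * a <= v * b by apply: le_trans H4 _; rewrite ler_wpM2r// ltW.
apply: (@le_trans _ _ (v * v')); last by apply: ler_pM => //; lra.
have ab0 : 0 < a * b by exact: mulr_gt0.
rewrite -(ler_pM2r ab0).
have -> : c * c' * (a * b) = (c * a) * (c' * b) by lra.
have -> : v * v' * (a * b) = (v * b) * (v' * a) by lra.
by apply: ler_pM => //; rewrite mulr_ge0// ltW.
Qed.

Lemma modular_exists : exists D : G -> R, forall y, 0 < D y /\
  forall C, compact C -> m (rtranslate C y) = D y * m C.
Proof.
have [K cK [K1 _ _]] := compact_nbhs hG lcG (filterT : nbhs (1%g : G) setT).
have K0 : 0 < m K by apply: nbhs_pos K1.
exists (fun y => m (rtranslate K y) / m K) => y; split.
  apply: divr_gt0 => //; apply: (@nbhs_pos _ _ hG _ haarP _ y).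
    exact: compact_rtranslate.
  exact: nbhs_rtranslate.
move=> C cC; apply: (mulIf (lt0r_neq0 K0)).
rewrite mulrAC divfK ?lt0r_neq0//; apply/eqP.
by rewrite eq_le; apply/andP; split; rewrite [leRHS]mulrC; exact: rtranslate_cross_le.
Qed.

Definition modular : G -> R := sval (cid modular_exists).

Lemma modular_gt0 y : 0 < modular y.
Proof. by rewrite /modular; case: cid => D /= /(_ y)[]. Qed.

Lemma modular_compact C y : compact C -> m (rtranslate C y) = modular y * m C.
Proof. by rewrite /modular; case: cid => D /= /(_ y)[_]; exact. Qed.

Lemma modularM x y : modular (x * y)%g = modular x * modular y.
Proof.
have [K cK [K1 _ _]] := compact_nbhs hG lcG (filterT : nbhs (1%g : G) setT).
have K0 : 0 < m K by apply: nbhs_pos K1.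
apply: (mulIf (lt0r_neq0 K0)); rewrite -modular_compact// rtranslateM.
rewrite modular_compact; last exact: compact_rtranslate.
by rewrite modular_compact// mulrA [modular y * _]mulrC.
Qed.

Lemma modular1 : modular 1%g = 1.
Proof.
have := modularM 1%g 1%g; rewrite mul1g => /eqP.
by rewrite -[X in X == _]mulr1 (inj_eq (mulfI (lt0r_neq0 (modular_gt0 _)))) => /eqP <-.
Qed.

Lemma modularV x : modular x^-1%g = (modular x)^-1.
Proof.
apply: (mulIf (lt0r_neq0 (modular_gt0 x))).
by rewrite -modularM mulVg modular1 mulVf// lt0r_neq0// modular_gt0.
Qed.

Lemma modular_open_le V y : open V ->
  (haar (rtranslate V y) <= (modular y)%:E * haar V)%E.
Proof.
move=> oV; rewrite (haar_inner haarP); last exact: open_rtranslate.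
apply: ge_ereal_sup => _ [K [cK KV] <-].
rewrite -(fmeasE (compact_fin haarP cK)) -(rtranslateVK K y) modular_compact; last exact: compact_rtranslate.
rewrite EFinM lee_pmul2l// ?lte_fin ?modular_gt0//.
have cK' : compact (rtranslate K y^-1%g) by exact: compact_rtranslate.
rewrite (fmeasE (compact_fin haarP cK')); apply: le_measure; rewrite ?inE.
- exact: (compact_meas hG).
- exact: open_meas.
- by rewrite -(rtranslateK V y); exact: rtranslateS.
Qed.

Lemma modular_le (E : set (borel G)) y : measurable E ->
  (haar (rtranslate E y) <= (modular y)%:E * haar E)%E.
Proof.
move=> mE; have [Eoo|] := ltP (haar E) +oo%E; last first.
  by rewrite leye_eq => /eqP ->; rewrite gt0_muley ?lte_fin ?modular_gt0// leey.
apply/lee_addgt0Pr => e e0; have e'0 := divr_gt0 e0 (modular_gt0 y).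
have [V [oV EV Voo mV]] := outer_approx haarP mE Eoo e'0.
apply: (@le_trans _ _ (haar (rtranslate V y))).
  apply: le_measure; rewrite ?inE; [exact: meas_rtranslate| |exact: rtranslateS].
  by apply: open_meas; exact: open_rtranslate.
apply: le_trans (modular_open_le y oV) _.
rewrite -(fmeasE Voo) -(fmeasE Eoo) -!EFinM -EFinD lee_fin.
by rewrite -ler_pdivlMl ?modular_gt0// mulrDr mulKf ?lt0r_neq0 ?modular_gt0// mulrC.
Qed.

Lemma rtranslate_fin (E : set (borel G)) y : measurable E -> (haar E < +oo)%E ->
  (haar (rtranslate E y) < +oo)%E.
Proof.
move=> mE Eoo; apply: le_lt_trans (modular_le y mE) _.
by rewrite -(fmeasE Eoo) -EFinM ltry.
Qed.

Lemma fmeas_rtranslate (E : set (borel G)) y : measurable E -> (haar E < +oo)%E ->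
  m (rtranslate E y) = modular y * m E.
Proof.
move=> mE Eoo; have mEy := meas_rtranslate y mE; have Eyoo := rtranslate_fin y mE Eoo.
apply/eqP; rewrite eq_le; apply/andP; split.
  by rewrite -lee_fin EFinM !fmeasE//; exact: modular_le.
rewrite -ler_pdivlMl ?modular_gt0// -modularV -lee_fin EFinM !fmeasE//.
by rewrite -{1}(rtranslateK E y); exact: modular_le.
Qed.

Lemma haar_rtranslate (E : set (borel G)) y : measurable E ->
  haar (rtranslate E y) = ((modular y)%:E * haar E)%E.
Proof.
move=> mE; have [Eoo|] := ltP (haar E) +oo%E.
  by rewrite -(fmeasE Eoo) -EFinM -fmeas_rtranslate// fmeasE//; exact: rtranslate_fin.
rewrite leye_eq => /eqP Eoo; rewrite Eoo gt0_muley ?lte_fin ?modular_gt0//.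
apply/eqP; rewrite -leye_eq leNgt; apply/negP => Eyoo.
by have := rtranslate_fin y^-1%g (meas_rtranslate y mE) Eyoo; rewrite rtranslateK Eoo.
Qed.

(** The density of inversion is the modular function, close to [1] near the identity.
    Double counting shows it directly: for small [N] the set [mulset C N] is hardly
    larger than [C]. *)
Lemma inversion_near1 e : 0 < e -> exists W, [/\ open W, W 1%g, invset W = W,
  (haar W < +oo)%E & forall S : set (borel G), measurable S -> S `<=` W ->
    m S <= (1 + e) * m (invset S)].
Proof.
move=> e0.
(* W keeps C inside V, whose measure is at most 1 + e times that of C *)
have [C cC [C1 _ _]] := compact_nbhs hG lcG (filterT : nbhs (1%g : G) setT).
have C0 : 0 < m C by apply: nbhs_pos C1.
have [V [oV CV Voo mV]] := outer_approx haarP (compact_meas hG cC)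
  (compact_fin haarP cC) (mulr_gt0 e0 C0).
have [W oW [W1 WI WN]] := nbhs1_sym (filterI C1 (compact_nbhs_mul cC oV CV)).
have mW := open_meas oW.
have Woo : (haar W < +oo)%E.
  apply: sub_fin (compact_fin haarP cC) => //; first exact: compact_meas.
  by move=> w /WN[].
exists W; split => //.
have bound N : compact N -> N `<=` W -> m N <= (1 + e) * m (invset N).
  move=> cN NW; rewrite -(ler_pM2l C0); apply: le_trans (double_count cC cN) _.
  rewrite mulrA ler_wpM2r ?fmeas_ge0//; apply: (@le_trans _ _ (m V)); last lra.
  apply: fmeas_le => //; [by apply: (compact_meas hG); exact: compact_mulset|exact: open_meas|].
  by move=> _ [[a b] /= [Ca /NW /WN[_ /(_ _ Ca)[_ Vab]]] <-].
(* the bound passes to open sets by inner and to Borel sets by outer regularity *)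
have boundo V' : open V' -> V' `<=` W -> m V' <= (1 + e) * m (invset V').
  move=> oV' V'W; have mV' := open_meas oV'.
  have V'oo : (haar V' < +oo)%E by exact: sub_fin V'W Woo.
  have IV'oo : (haar (invset V') < +oo)%E.
    by apply: sub_fin Woo => //; [exact: meas_invset|rewrite -WI; exact: invsetS].
  rewrite -lee_fin fmeasE// (haar_inner haarP oV').
  apply: ge_ereal_sup => _ [K [cK KV'] <-].
  rewrite -(fmeasE (compact_fin haarP cK)) lee_fin.
  apply: (le_trans (bound K cK (subset_trans KV' V'W))).
  rewrite ler_pM2l; last lra; apply: fmeas_le => //.
  - by apply: compact_meas => //; exact: compact_invset.
  - exact: meas_invset.
  - exact: invsetS.
move=> S mS SW; have mIS := meas_invset mS.
have ISoo : (haar (invset S) < +oo)%E.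
  by apply: sub_fin Woo => //; rewrite -WI; exact: invsetS.
apply/ler_addgt0Pr => t t0; have e1 : 0 < 1 + e by lra.
have [V' [oV' SV' V'oo mV']] := outer_approx haarP mIS ISoo (divr_gt0 t0 e1).
have oO : open (invset V' `&` W) by apply: openI => //; exact: open_invset.
apply: (@le_trans _ _ (m (invset V' `&` W))).
  apply: fmeas_le => //; first exact: open_meas.
    by apply: sub_fin Woo => //; exact: open_meas.
  by move=> z Sz; split; [apply: SV'; rewrite /invset/= invgK|exact: SW].
apply: le_trans (boundo _ oO _) _ => //.
rewrite -ler_pdivlMl// mulrDr mulKf ?lt0r_neq0// mulrC; apply: le_trans mV'.
apply: fmeas_le => //; [by apply: meas_invset; exact: open_meas|exact: open_meas|].
by move=> z; rewrite /invset/= invgK => -[].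
Qed.

End Modular.

(** * Translations of densities *)

Section ChangeOfVariables.
Context d {T : measurableType d} {R : realType}.
Variable mu : {measure set T -> \bar R}.
Variables (phi : T -> T) (c : R).
Hypothesis mphi : measurable_fun setT phi.
Hypothesis c0 : 0 < c.
Hypothesis phiP : forall E, measurable E -> mu (phi @^-1` E) = (c%:E * mu E)%E.

Let ge0_integral_scaling (g : T -> R) : measurable_fun setT g -> (forall x, 0 <= g x) ->
  (\int[mu]_x (g (phi x))%:E = c%:E * \int[mu]_x (g x)%:E)%E.
Proof.
move=> mg g0; have mg' : measurable_fun setT (EFin \o g) by exact/measurable_EFinP.
have g0' x : setT x -> (0 <= (EFin \o g) x)%E by rewrite lee_fin.
have <- := @ge0_integral_mscale _ T R mu setT measurableT (NngNum (ltW c0)) (EFin \o g) mg' g0'.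
have := @ge0_integral_pushforward _ _ T T R phi mphi mu setT (EFin \o g) measurableT mg'.
rewrite preimage_setT => <-; last by move=> x _; rewrite lee_fin.
by apply: eq_measure_integral => A mA _; rewrite /= /pushforward/= phiP.
Qed.

Lemma integ_comp (f : T -> R) : integ mu f -> integ mu (f \o phi).
Proof.
move=> If; have mf := integ_measurable If; apply/integrableP; split.
  by apply/measurable_EFinP; exact: measurableT_comp.
rewrite (ge0_integral_scaling (g := fun x => `|f x|))//; last exact: measurableT_comp.
by move/integrableP : If => [_ If]; rewrite lte_mul_pinfty// lee_fin ltW.
Qed.

Lemma rint_comp (f : T -> R) : integ mu f -> rint mu (f \o phi) = c * rint mu f.
Proof.
have pos (g : T -> R) : integ mu g -> (forall x, 0 <= g x) -> rint mu (g \o phi) = c * rint mu g.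
  move=> Ig g0; rewrite /rint /Rintegral ge0_integral_scaling//; last exact: integ_measurable Ig.
  rewrite fineM//; exact: (integrable_fin_num measurableT Ig).
move=> If; have mf := integ_measurable If.
pose p x := Num.max (f x) 0; pose n x := Num.max (- f x) 0.
have fpn x : f x = p x - n x.
  by rewrite /p /n; have [|] := leP (f x) 0; have [|] := leP (- f x) 0; lra.
have Ip : integ mu p.
  apply: (integ_le _ (integ_abs If)); first exact: measurable_maxr.
  move=> x; rewrite /p; have [|] := leP (f x) 0; first by rewrite normr0.
  by [].
have In : integ mu n.
  apply: (integ_le _ (integ_abs If)).
    by apply: measurable_maxr => //; exact: measurable_funN.
  move=> x; rewrite /n; have [|] := leP (- f x) 0; first by rewrite normr0.
  by rewrite normrN.
rewrite (@rint_ext _ _ _ _ _ (fun x => (p \o phi) x - (n \o phi) x)); last by move=> x /=; exact: fpn.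
rewrite rintB; [|exact: integ_comp|exact: integ_comp].
rewrite !pos//; [|by move=> x; rewrite le_max lexx orbT|by move=> x; rewrite le_max lexx orbT].
by rewrite -mulrBr -rintB//; congr (_ * _); exact: rint_ext.
Qed.

End ChangeOfVariables.

Section Densities.
Context {R : realType} {G : topologicalGroupType}.
Hypothesis hG : hausdorff_space G.
Hypothesis lcG : locally_compact [set: G].
Variable haar : {measure set (borel G) -> \bar R}.
Hypothesis haarP : left_haar_measure haar.
Implicit Types (x y z : G) (A B C K N U V W : set G) (f : borel G -> R).

Local Notation m := (fmeas haar).
Local Notation modular := (modular hG lcG haarP).
Local Notation mu_ := (mu_ haar).

Lemma integ_lshift x f : integ haar f -> integ haar (fun z => f (x^-1 * z)%g).
Proof.
apply: (@integ_comp _ _ _ haar (fun z : borel G => (x^-1 * z)%g) 1).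
- by apply: continuous_borel; exact: continuous_lmul.
- by [].
- by move=> E mE; rewrite mul1e -(haar_left_invariant haarP x mE) translateE.
Qed.

Lemma rint_lshift x f : integ haar f ->
  rint haar (fun z => f (x^-1 * z)%g) = rint haar f.
Proof.
move=> If; rewrite -[RHS]mul1r.
apply: (@rint_comp _ _ _ haar (fun z : borel G => (x^-1 * z)%g) 1) => //.
- by apply: continuous_borel; exact: continuous_lmul.
- by move=> E mE; rewrite mul1e -(haar_left_invariant haarP x mE) translateE.
Qed.

Lemma norm1_lshift x f : integ haar f ->
  norm1 haar (fun z => f (x^-1 * z)%g) = norm1 haar f.
Proof. by move=> If; rewrite /norm1 -(rint_lshift x (integ_abs If)). Qed.

Lemma integ_rshift y f : integ haar f -> integ haar (fun z => f (z * y^-1)%g).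
Proof.
apply: (@integ_comp _ _ _ haar (fun z : borel G => (z * y^-1)%g) (modular y)).
- by apply: continuous_borel; exact: continuous_rmul.
- exact: modular_gt0.
- by move=> E mE; rewrite -haar_rtranslate.
Qed.

Lemma rint_rshift y f : integ haar f ->
  rint haar (fun z => f (z * y^-1)%g) = modular y * rint haar f.
Proof.
apply: (@rint_comp _ _ _ haar (fun z : borel G => (z * y^-1)%g) (modular y)).
- by apply: continuous_borel; exact: continuous_rmul.
- exact: modular_gt0.
- by move=> E mE; rewrite -haar_rtranslate.
Qed.

Lemma norm1_rshift y f : integ haar f ->
  norm1 haar (fun z => (modular y)^-1 * f (z * y^-1)%g) = norm1 haar f.
Proof.
move=> If; rewrite norm1Z; last exact: integ_rshift.
rewrite /norm1 (rint_rshift y (integ_abs If)) gtr0_norm ?invr_gt0 ?modular_gt0//.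
by rewrite mulKf// lt0r_neq0// modular_gt0.
Qed.

Lemma mu_translate x A : compact A ->
  mu_ (translate x A) = (fun z => mu_ A (x^-1 * z)%g).
Proof.
move=> cA; apply/funext => z; rewrite /Defs.mu_ (haar_left_invariant haarP).
  by rewrite !indicE translateE.
exact: compact_meas.
Qed.

Lemma mu_rtranslate A y : compact A ->
  mu_ (rtranslate A y) = (fun z => (modular y)^-1 * mu_ A (z * y^-1)%g).
Proof.
move=> cA; apply/funext => z; rewrite /Defs.mu_ -/(m _) fmeas_rtranslate//; last 2 first.
- exact: compact_meas.
- exact: compact_fin.
by rewrite invfM mulrCA !indicE.
Qed.

Lemma mu_E A : mu_ A = (fun z => (m A)^-1 * \1_A z).
Proof. by apply/funext => z; rewrite mulrC. Qed.

Lemma integ_mu A : compact A -> integ haar (mu_ A).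
Proof.
move=> cA; rewrite mu_E.
by apply/integZ/integ_indic; [exact: compact_meas|exact: compact_fin].
Qed.

Lemma rint_mu A : compact A -> 0 < m A -> rint haar (mu_ A) = 1.
Proof.
move=> cA A0; rewrite mu_E; have mA := compact_meas hG cA.
rewrite rintZ; last by apply: integ_indic => //; exact: compact_fin.
by rewrite rint_indic// mulVf// lt0r_neq0.
Qed.

Lemma mu_ge0 A z : 0 <= mu_ A z.
Proof. by rewrite /Defs.mu_ divr_ge0//; exact: fmeas_ge0. Qed.

Lemma norm1_mu A : compact A -> 0 < m A -> norm1 haar (mu_ A) = 1.
Proof.
move=> cA A0; rewrite -[RHS](rint_mu cA A0); apply: rint_ext => z.
by rewrite ger0_norm// mu_ge0.
Qed.

Lemma rtranslate_pos A y : compact A -> 0 < m A -> 0 < m (rtranslate A y).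
Proof.
move=> cA A0; rewrite fmeas_rtranslate ?mulr_gt0 ?modular_gt0//.
  exact: compact_meas.
exact: compact_fin.
Qed.

Lemma translate_pos x A : compact A -> 0 < m A -> 0 < m (translate x A).
Proof.
by move=> cA A0; rewrite fmeas_translate//; exact: compact_meas.
Qed.

(** The error terms of the continuity statements live in the thin shell [V `\` A]. *)
Lemma shell_int A V e : compact A -> 0 < m A -> open V -> A `<=` V ->
  (haar V < +oo)%E -> m V <= m A + e * m A ->
  integ haar (fun z => (m A)^-1 * \1_(V `\` A) z) /\
  rint haar (fun z => (m A)^-1 * \1_(V `\` A) z) <= e.
Proof.
move=> cA A0 oV AV Voo mV; have mA := compact_meas hG cA; have mV' := open_meas oV.
have mVA : measurable (V `\` A : set (borel G)) by exact: measurableD.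
have VAoo : (haar (V `\` A) < +oo)%E by apply: sub_fin Voo => // ? [].
have i1 : integ haar (\1_(V `\` A) : borel G -> R) by exact: integ_indic.
split; first exact: integZ.
rewrite rintZ// rint_indic// ler_pdivrMl//.
suff : m V = m A + m (V `\` A) by lra.
have Aoo := compact_fin haarP cA; apply: EFin_inj; rewrite EFinD !fmeasE//.
rewrite -[in LHS](setDUK AV) measureU//; last by rewrite setDIK.
Qed.

Lemma left_continuity A (e : R) : compact A -> 0 < m A -> 0 < e ->
  \forall w \near nbhs (1%g : G), norm1 haar (fun z => mu_ (translate w A) z - mu_ A z) <= e.
Proof.
move=> cA A0 e0; have e2 : 0 < e / 2 by lra.
have [V [oV AV Voo mV]] := outer_approx haarP (compact_meas hG cA)
  (compact_fin haarP cA) (mulr_gt0 e2 A0).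
have [Ih hle] := shell_int cA A0 oV AV Voo mV.
apply: filterS (compact_nbhs_mul cA oV AV) => w /= wV.
have -> : e = 2 * (e / 2) by lra.
have cwA : compact (translate w A) by exact: compact_translate.
apply: (@le_trans _ _ (2 * rint haar (fun z => (m A)^-1 * \1_(V `\` A) z))); last first.
  by rewrite ler_pM2l.
apply: norm1_close => //; [exact: integ_mu|exact: integ_mu| | |].
- by rewrite !rint_mu//; exact: translate_pos.
- by move=> z; rewrite mulr_ge0// invr_ge0 fmeas_ge0.
move=> z; rewrite /Defs.mu_ -!/(m _) (fmeas_translate haarP)//; last exact: compact_meas.
rewrite -mulrBl mulrC ler_pM2l ?invr_gt0// !indicE in_setD.
have [zA|zA] := boolP (z \in A); rewrite ?andbF ?andbT.
  by case: (_ \in _) => /=; lra.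
rewrite subr0 ler_nat; have [|//] := boolP (z \in translate w A).
by rewrite inE => -[a Aa <-]; rewrite mem_set//; case: (wV a Aa).
Qed.

(** Both [w] and its inverse keep [A] inside [V], which bounds the modular function
    at [w] from both sides by numbers close to [1]. *)
Lemma right_continuity1 A (e : R) : compact A -> 0 < m A -> 0 < e ->
  \forall w \near nbhs (1%g : G), norm1 haar (fun z => mu_ (rtranslate A w) z - mu_ A z) <= e.
Proof.
move=> cA A0 e0.
have [t [t0 t1 te]] : exists t, [/\ 0 < t, t <= 1 & 6 * t <= e].
  exists (Num.min 1 (e / 6)); split; first by rewrite lt_min ltr01; lra.
    by rewrite ge_min lexx.
  by rewrite -ler_pdivlMl// mulrC ge_min lexx orbT.
have [V [oV AV Voo mV]] := outer_approx haarP (compact_meas hG cA)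
  (compact_fin haarP cA) (mulr_gt0 t0 A0).
have [Ih hle] := shell_int cA A0 oV AV Voo mV.
have [W oW [W1 WI WV]] := nbhs1_sym (compact_nbhs_mul cA oV AV).
apply: filterS (open_nbhs1 oW W1) => w Ww /=.
have cAw : compact (rtranslate A w) by exact: compact_rtranslate.
have sub v : W v -> rtranslate A v `<=` V.
  by move=> Wv; rewrite rtranslateE => _ [a Aa <-]; have [] := WV v Wv a Aa.
have mod v : W v -> modular v <= 1 + t.
  move=> Wv; rewrite -(ler_pM2r A0) -modular_compact// mulrDl mul1r; apply: le_trans mV.
  apply: fmeas_le => //; [|exact: open_meas|exact: sub].
  by apply: (compact_meas hG); exact: compact_rtranslate.
have modV : (modular w)^-1 <= 1 + t.
  by rewrite -modularV; apply: mod; rewrite -WI /invset/= invgK.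
pose h z := t * mu_ A z + 2 * ((m A)^-1 * \1_(V `\` A) z).
have IhA : integ haar h by apply: integD; [exact/integZ/integ_mu|exact: integZ].
have hI : rint haar h <= 3 * t.
  rewrite /h rintD; [|exact/integZ/integ_mu|exact: integZ].
  by rewrite (rintZ t (integ_mu cA)) (rintZ 2 Ih) rint_mu//; lra.
apply: (@le_trans _ _ (2 * rint haar h)); last lra.
have mw0 := modular_gt0 hG lcG haarP w.
apply: norm1_close => //; [exact: integ_mu|exact: integ_mu| | |].
- by rewrite !rint_mu//; exact: rtranslate_pos.
- move=> z; rewrite addr_ge0// ?mulr_ge0 ?invr_ge0 ?fmeas_ge0 ?mu_ge0//; exact: ltW.
move=> z; rewrite /h /Defs.mu_ -!/(m _) modular_compact// invfM.
set p := \1_(rtranslate A w) z; set q := \1_A z; set s := \1_(V `\` A) z.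
suff H : (modular w)^-1 * p - q <= t * q + 2 * s.
  rewrite -subr_ge0 (_ : _ - _ = (m A)^-1 * (t * q + 2 * s - ((modular w)^-1 * p - q))); last by ring.
  by rewrite mulr_ge0 ?subr_ge0// invr_ge0 ltW.
rewrite /p /q /s !indicE in_setD.
have [zA|zA] := boolP (z \in A); rewrite ?andbF ?andbT.
  by case: (_ \in _) => /=; lra.
have [|_] := boolP (z \in rtranslate A w); last by rewrite /= mulr0 subr0 mulr0 add0r mulr_ge0.
rewrite inE => Az; rewrite mem_set/=; last exact: sub Az.
by lra.
Qed.

Lemma right_continuity A y0 (e : R) : compact A -> 0 < m A -> 0 < e ->
  \forall y \near nbhs y0,
    norm1 haar (fun z => mu_ (rtranslate A y) z - mu_ (rtranslate A y0) z) <= e.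
Proof.
move=> cA A0 e0; have H := right_continuity1 cA A0 e0.
have := @continuous_rmul G (y0^-1)%g y0; rewrite /continuous_at mulgV => /(_ _ H).
move=> H2; apply: filterS (H2 : nbhs y0 _) => y /=; set w := (y * y0^-1)%g.
have -> : rtranslate A y = rtranslate (rtranslate A w) y0 by rewrite -rtranslateM mulgVK.
have cAw : compact (rtranslate A w) by exact: compact_rtranslate.
rewrite -(norm1_rshift y0 (integB (integ_mu cAw) (integ_mu cA))).
by apply: le_trans; rewrite le_eqVlt; apply/orP; left; apply/eqP/rint_ext => z;
  rewrite !(mu_rtranslate y0)// mulrBr.
Qed.

End Densities.

(** * Approximation by right translates of small sets *)

(** A finitely supported probability on [T]; points may be repeated. *)
Definition convex_weights (R : realType) (T : Type) (s : seq (R * T)) : Prop :=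
  all (fun p => 0 <= p.1) s /\ \sum_(p <- s) p.1 = 1.

Section RightApproximation.
Context {R : realType} {G : topologicalGroupType}.
Hypothesis hG : hausdorff_space G.
Hypothesis lcG : locally_compact [set: G].
Variable haar : {measure set (borel G) -> \bar R}.
Hypothesis haarP : left_haar_measure haar.
Implicit Types (x y z : G) (A B C K N U V W : set G) (f : borel G -> R).

Local Notation m := (fmeas haar).
Local Notation modular := (modular hG lcG haarP).
Local Notation mu_ := (mu_ haar).

Lemma small_quantum (e : R) k : 0 < e -> exists t : R, [/\ 0 < t, t <= 1 & k.+1%:R * t <= e].
Proof.
move=> e0; exists (Num.min 1 (e / k.+1%:R)); split.
- by rewrite lt_min ltr01 divr_gt0.
- by rewrite ge_min lexx.
- by rewrite mulrC -ler_pdivlMr// ge_min lexx orbT.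
Qed.

(** The density of [A] is almost the average over [x] in [A] of the densities of
    the [U x]. Subdivide [A] into pieces [P i] close to sample points [x i]. At [z] the
    combination is, up to the factor [m A * m U], the sum of the
    [m (P i) / modular (x i)], that is about [m (invset (P i))], over the [i] such
    that [x i] lies in [U^-1 z]. These inverses fill a subset of a set hardly larger
    than [z^-1 U], so the combination hardly exceeds [1 / m A]; and it has
    total mass [1], like [mu_ A]. *)
Lemma right_approx A (e : R) : compact A -> 0 < m A -> 0 < e ->
  exists2 O, nbhs (1%g : G) O & forall U, compact U -> 0 < m U -> U `<=` O ->
  exists2 s : seq (R * G), convex_weights s &
    norm1 haar (fun z => \sum_(p <- s) p.1 * mu_ (rtranslate U p.2) z - mu_ A z) <= e.
Proof.
(* 14 is twice 3 + 4, the coefficients of the error function h below *)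
move=> cA A0 e0; have [t [t0 t1 te]] := small_quantum 13 e0.
have mA := compact_meas hG cA.
have [V [oV AV Voo mV]] := outer_approx haarP mA (compact_fin haarP cA) (mulr_gt0 t0 A0).
have [Ih hle] := shell_int hG haarP cA A0 oV AV Voo mV.
exists [set w | forall a, A a -> V (w * a)%g /\ V (a * w)%g]; first exact: compact_nbhs_mul.
move=> U cU U0 UO; have mU := compact_meas hG cU.
have [W1 [oW1 W11 W1I W1oo W1P]] := inversion_near1 hG lcG haarP t0.
have [V2 [oV2 UV2 V2oo mV2]] := outer_approx haarP mU (compact_fin haarP cU) (mulr_gt0 t0 U0).
have [W oW [W1' WI WN]] := nbhs1_sym (filterI (open_nbhs1 oW1 W11) (compact_nbhs_mul cU oV2 UV2)).
have [|n [x [P [xA mP PB tP AE]]]] := @compact_pieces _ hG A (fun x => rtranslate W x) cA.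
  move=> x Ax; split; first exact: open_rtranslate.
  by rewrite /rtranslate/= mulgV.
have Poo i : (haar (P i) < +oo)%E.
  by apply: sub_fin (compact_fin haarP cA) => // z /PB[].
pose s := [seq (m (P i) / m A, x i) | i <- enum 'I_n].
have sumE (F : R * G -> R) : \sum_(p <- s) F p = \sum_(i < n) F (m (P i) / m A, x i).
  by rewrite big_map big_enum.
exists s.
  split; last first.
    rewrite sumE -mulr_suml -(sum_all_pieces (compact_fin haarP cA) mA mP tP AE).
    by rewrite divff// lt0r_neq0.
  by rewrite all_map; apply/allP => i _ /=; rewrite divr_ge0 ?fmeas_ge0.
pose F z := \sum_(i < n) m (P i) / m A * mu_ (rtranslate U (x i)) z.
have cUx i : compact (rtranslate U (x i)) by exact: compact_rtranslate.
have IF : integ haar F by apply: integ_sum => i _; exact/integZ/integ_mu.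
have PI i : m (P i) <= (1 + t) * modular (x i) * m (invset (P i)).
  have mS := meas_rtranslate (x i)^-1%g (mP i).
  have SW : rtranslate (P i) (x i)^-1%g `<=` W1.
    by move=> z; rewrite /rtranslate/= invgK => /PB[_]; rewrite /rtranslate/= mulgK => /WN[].
  rewrite -{1}(rtranslateVK (P i) (x i)) fmeas_rtranslate//; last exact: rtranslate_fin.
  rewrite [(1 + t) * _]mulrC -mulrA ler_pM2l ?modular_gt0//; apply: le_trans (W1P _ mS SW) _.
  rewrite -(fmeas_translate haarP (x i) (meas_invset (mP i))) le_eqVlt; apply/orP; left; apply/eqP.
  congr (_ * m _); rewrite translateE; apply/seteqP; split => z;
    by rewrite /rtranslate/invset/= ?invgM ?invgK.
have UxV i : rtranslate U (x i) `<=` V.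
  by rewrite rtranslateE => _ [u Uu <-]; have [] := UO _ Uu (x i) (xA i).
have FV z : V z -> F z <= (1 + t) ^+ 2 * (m A)^-1.
  move=> Vz; pose D := [pred i : 'I_n | z \in rtranslate U (x i)].
  have : \sum_(i < n | D i) m (invset (P i)) <= m V2.
    rewrite -(fmeas_translate haarP (z^-1)%g (open_meas oV2)); apply: sum_pieces => //.
    - by move=> i; exact: meas_invset.
    - by move=> i j _ _ [w [Piw Pjw]]; apply: tP => //; exists w^-1%g.
    - by apply: meas_translate; exact: open_meas.
    - by rewrite (haar_left_invariant haarP)//; exact: open_meas.
    move=> i; rewrite /D/= inE => Uz p; rewrite /invset/= => /PB[_] Wp.
    rewrite translateE/= invgK.
    have Wxp : W (x i * p)%g by rewrite -WI /invset/= invgM.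
    by have [_ /(_ _ Uz)[_]] := WN _ Wxp; rewrite mulgA mulgVK.
  move=> sumD; apply: (@le_trans _ _ ((1 + t) / (m A * m U) * \sum_(i < n | D i) m (invset (P i)))).
    rewrite mulr_sumr [leRHS]big_mkcond/=; apply: ler_sum => i _.
    rewrite /Defs.mu_ -/(m _) modular_compact// indicE /D/=; case: ifP => /= _; last by rewrite mul0r mulr0.
    have D0 := modular_gt0 hG lcG haarP (x i).
    rewrite -subr_ge0 (_ : _ - _ = (m A * m U * modular (x i))^-1 *
      ((1 + t) * modular (x i) * m (invset (P i)) - m (P i))); last first.
      by field; rewrite !lt0r_neq0.
    by rewrite mulr_ge0 ?subr_ge0// invr_ge0 ltW// !mulr_gt0.
  rewrite -subr_ge0 (_ : _ - _ = (1 + t) / (m A * m U) *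
      ((1 + t) * m U - \sum_(i < n | D i) m (invset (P i)))); last first.
    by field; rewrite !lt0r_neq0.
  by rewrite mulr_ge0 ?subr_ge0//; [rewrite divr_ge0 ?mulr_ge0 ?fmeas_ge0//; lra|lra].
have F0 z : ~ V z -> F z = 0.
  move=> nV; rewrite /F big1// => i _; rewrite /Defs.mu_ indicE memNset ?mul0r ?mulr0//.
  by move=> /UxV.
(* 3 t and 4 bound (1 + t) ^ 2 - 1 and (1 + t) ^ 2 *)
pose h z := 3 * t * mu_ A z + 4 * ((m A)^-1 * \1_(V `\` A) z).
have IhA : integ haar h by apply: integD; [exact/integZ/integ_mu|exact: integZ].
have hI : rint haar h <= 7 * t.
  rewrite /h rintD; [|exact/integZ/integ_mu|exact: integZ].
  by rewrite (rintZ _ (integ_mu hG haarP cA)) (rintZ _ Ih) rint_mu//; lra.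
apply: (@le_trans _ _ (2 * rint haar h)); last lra.
have -> : (fun z => \sum_(p <- s) p.1 * mu_ (rtranslate U p.2) z - mu_ A z) =
    (fun z => F z - mu_ A z).
  by apply/funext => z; rewrite sumE.
have IA := integ_mu hG haarP cA.
apply: norm1_close => //.
- rewrite rint_mu// rint_sum; last by move=> i _; exact/integZ/integ_mu.
  have Rx i : rint haar (fun z => m (P i) / m A * mu_ (rtranslate U (x i)) z) = m (P i) / m A.
    rewrite rintZ; last exact: integ_mu.
    by rewrite rint_mu ?mulr1//; exact: rtranslate_pos.
  under eq_bigr => i _ do rewrite Rx.
  rewrite -mulr_suml -(sum_all_pieces (compact_fin haarP cA) mA mP tP AE).
  by rewrite divff// lt0r_neq0.
- move=> z; rewrite addr_ge0// !mulr_ge0 ?invr_ge0 ?fmeas_ge0 ?mu_ge0//; exact: ltW.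
move=> z; rewrite /h /Defs.mu_ -!/(m _) !indicE in_setD.
have iA0 : 0 < (m A)^-1 by rewrite invr_gt0.
have [zA|zA] := boolP (z \in A); rewrite ?andbF ?andbT /=.
  have := FV z (AV z (set_mem zA)); move: ((m A)^-1) iA0 => a a0.
  move=> /le_trans H; rewrite lerBlDr; apply: H.
  rewrite -subr_ge0 (_ : _ - _ = a * (t * (1 - t))); last by ring.
  by rewrite !mulr_ge0 ?subr_ge0// ltW.
rewrite mul0r subr0 mulr0 add0r; have [zV|zV] := boolP (z \in V).
  apply: le_trans (FV z (set_mem zV)) _; rewrite mulr1 ler_pM2r//; nra.
by rewrite F0 ?mulr0// => Vz; rewrite mem_set in zV.
Qed.

End RightApproximation.

(** * Means on bounded functions *)

Section BoundedBorel.
Context {R : realType} {G : topologicalGroupType}.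
Variable haar : {measure set (borel G) -> \bar R}.
Implicit Types (f g : borel G -> R).

Definition bounded_borel f : Prop :=
  measurable_fun setT f /\ exists M, forall x, `|f x| <= M.

Lemma bounded_borel_Linf f : bounded_borel f -> f \in Linf_pred haar.
Proof.
case=> mf [M fM]; rewrite inE/=; split; last by exists M; exact: locally_aeT.
by move=> F mF _; exact: measurable_funTS.
Qed.

Lemma continuous_meas (f : G -> R) : continuous f -> measurable_fun setT (f : borel G -> R).
Proof.
move=> /continuousP cf.
apply: (@measurability _ _ (borel G) _ setT f _ (RGenOpens.measurableE R)).
move=> _ [_ [a [b ->] <-]]; rewrite setTI; apply: open_meas; apply: cf.
exact: interval_open.
Qed.

Lemma locally_ae_mono (P Q : set (borel G)) : P `<=` Q -> locally_ae haar P -> locally_ae haar Q.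
Proof. by move=> PQ aeP; apply: (locally_aeI _ aeP aeP) => x [/PQ]. Qed.

Lemma to_LinfD f g : f \in Linf_pred haar -> g \in Linf_pred haar ->
  to_Linf haar (fun x => f x + g x) = to_Linf haar f + to_Linf haar g.
Proof.
move=> fL gL; have fgL : (fun x => f x + g x) \in Linf_pred haar.
  exact: (rpredD fL gL).
have E : Linf_fun (to_Linf haar (fun x => f x + g x)) =
    (Linf_fun (to_Linf haar f) : borel G -> R) + Linf_fun (to_Linf haar g).
  by rewrite !to_LinfE.
by apply: val_inj; exact: E.
Qed.

Lemma to_LinfZ c f : f \in Linf_pred haar ->
  to_Linf haar (fun x => c * f x) = c *: to_Linf haar f.
Proof.
move=> fL; have cfL : (fun x => c * f x) \in Linf_pred haar.
  by rewrite (_ : (fun x => c * f x) = c *: f)//; exact: rpredZ.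
have E : Linf_fun (to_Linf haar (fun x => c * f x)) =
    c *: (Linf_fun (to_Linf haar f) : borel G -> R).
  by rewrite !to_LinfE.
by apply: val_inj; exact: E.
Qed.

End BoundedBorel.

Section Means.
Context {R : realType} {G : topologicalGroupType}.
Variable haar : {measure set (borel G) -> \bar R}.
Variable mu : Linf haar -> R.
Hypothesis meanmu : mean haar mu.
Implicit Types (f g : borel G -> R).

(** Functions that represent no element of L_oo get the mean of [0]. *)
Definition mval f : R := mu (to_Linf haar f).

Let mu_scalar : scalar mu. Proof. by case: meanmu. Qed.

Let mu_pos (phi : Linf haar) : locally_ae haar [set x | 0 <= phi x] -> 0 <= mu phi.
Proof. by case: meanmu => _ _; exact. Qed.

Lemma meanD u v : mu (u + v) = mu u + mu v.
Proof. by rewrite -[u]scale1r mu_scalar mul1r scale1r. Qed.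

Lemma mean0 : mu 0 = 0.
Proof. by apply: (addrI (mu 0)); rewrite -meanD !addr0. Qed.

Lemma meanZ c u : mu (c *: u) = c * mu u.
Proof. by rewrite -[c *: u]addr0 mu_scalar mean0 addr0. Qed.

Lemma cst_Linf (c : R) : (fun=> c) \in Linf_pred haar.
Proof. by apply: bounded_borel_Linf; split; [exact: measurable_cst|exists `|c|]. Qed.

Lemma mval_ge0 f : f \in Linf_pred haar -> (forall x, 0 <= f x) -> 0 <= mval f.
Proof.
by move=> fL f0; apply: mu_pos; apply: locally_aeT => x /=; rewrite to_LinfE.
Qed.

Lemma mvalD f g : f \in Linf_pred haar -> g \in Linf_pred haar ->
  mval (fun x => f x + g x) = mval f + mval g.
Proof. by move=> fL gL; rewrite /mval to_LinfD// meanD. Qed.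

Lemma mvalZ c f : f \in Linf_pred haar -> mval (fun x => c * f x) = c * mval f.
Proof. by move=> fL; rewrite /mval to_LinfZ// meanZ. Qed.

Lemma LinfD f g : f \in Linf_pred haar -> g \in Linf_pred haar ->
  (fun x => f x + g x) \in Linf_pred haar.
Proof. exact: rpredD. Qed.

Lemma LinfZ c f : f \in Linf_pred haar -> (fun x => c * f x) \in Linf_pred haar.
Proof.
by move=> fL; rewrite (_ : (fun x => c * f x) = c *: f)//; exact: rpredZ.
Qed.

Lemma LinfN f : f \in Linf_pred haar -> (fun x => - f x) \in Linf_pred haar.
Proof. by move=> fL; rewrite (_ : (fun=> _) = (fun x => -1 * f x)) ?LinfZ//; apply/funext => x; rewrite mulN1r. Qed.

Lemma mvalB f g : f \in Linf_pred haar -> g \in Linf_pred haar ->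
  mval (fun x => f x - g x) = mval f - mval g.
Proof.
move=> fL gL; rewrite mvalD ?LinfN//; congr (_ + _).
by rewrite -mulN1r -mvalZ//; congr mval; apply/funext => x; rewrite mulN1r.
Qed.

Lemma mval_le f g : f \in Linf_pred haar -> g \in Linf_pred haar ->
  (forall x, f x <= g x) -> mval f <= mval g.
Proof.
move=> fL gL fg; rewrite -subr_ge0 -mvalB//; apply: mval_ge0; last by move=> x; rewrite subr_ge0.
by apply: LinfD => //; exact: LinfN.
Qed.

(** The norm of a positive functional is its value at the constant [1]. *)
Lemma mval1 : mval (fun=> 1) = 1.
Proof.
have one_pos : 0 <= mval (fun=> 1) by apply: mval_ge0; [exact: cst_Linf|move=> x; exact: ler01].
case: meanmu => _ supmu _; apply/eqP; rewrite eq_le; apply/andP; split.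
  rewrite -lee_fin -supmu; apply: ereal_sup_ubound.
  exists (to_Linf haar (fun=> 1)); last by rewrite ger0_norm.
  apply: ge_inf; first by exists 0 => M [].
  by split => //; apply: locally_aeT => x /=; rewrite to_LinfE ?cst_Linf// normr1.
rewrite -lee_fin -[X in (X <= _)%E]supmu; apply: ge_ereal_sup => _ [phi phi1 <-].
rewrite lee_fin; apply/ler_addgt0Pr => e e0.
pose d := e / (mval (fun=> 1) + 1); have s0 : 0 < mval (fun=> 1) + 1 by lra.
have d0 : 0 < d by exact: divr_gt0.
have [M [M0 phiM] M1] : exists2 M, 0 <= M /\ locally_ae haar [set x | `|phi x| <= M] & M <= 1 + d.
  set S := [set M | 0 <= M /\ locally_ae haar [set x | `|phi x| <= M]].
  have infS : has_inf S.
    split; last by exists 0 => M [].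
    have := Linf_funP phi; rewrite inE/= => -[_ [M phiM]].
    exists `|M|; split => //; apply: locally_ae_mono phiM => x /= /le_trans; apply; exact: ler_norm.
  have [M SM ltM] := inf_adherent d0 infS; exists M => //.
  by apply/ltW/(lt_le_trans ltM); rewrite lerD2r.
have bnd (phi' : Linf haar) : locally_ae haar [set x | phi' x <= M] -> mu phi' <= M * mval (fun=> 1).
  move=> phiM'; rewrite -subr_ge0 -meanZ -mulN1r -meanZ -meanD.
  apply: mu_pos; apply: locally_ae_mono phiM' => x /=.
  rewrite [X in _ -> 0 <= X](_ : _ = M * to_Linf haar (fun=> 1) x + -1 * phi' x)//.
  by rewrite to_LinfE ?cst_Linf//; lra.
have le1 : M * mval (fun=> 1) <= mval (fun=> 1) + e.
  apply: (@le_trans _ _ ((1 + d) * mval (fun=> 1))); first by rewrite ler_wpM2r.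
  rewrite mulrDl mul1r lerD2l /d mulrAC ler_pdivrMr// ler_pM2l//; lra.
apply: le_trans le1; rewrite ler_norml; apply/andP; split.
  rewrite lerNl -mulN1r -meanZ; apply: bnd; apply: locally_ae_mono phiM => x /=.
  rewrite [X in _ -> X <= _](_ : _ = -1 * phi x)//.
  by rewrite ler_norml => /andP[? _]; lra.
by apply: bnd; apply: locally_ae_mono phiM => x /=; rewrite ler_norml => /andP[].
Qed.

Lemma mval_cst c : mval (fun=> c) = c.
Proof.
rewrite -[RHS]mulr1 -mval1 -mvalZ ?cst_Linf//; congr mval.
by apply/funext => x; rewrite mulr1.
Qed.

Lemma mval_dist f g e : f \in Linf_pred haar -> g \in Linf_pred haar ->
  (forall x, `|f x - g x| <= e) -> `|mval f - mval g| <= e.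
Proof.
move=> fL gL fge; have fgL : (fun x => f x - g x) \in Linf_pred haar by apply: LinfD => //; exact: LinfN.
rewrite -mvalB// ler_norml -(mval_cst e) -mulN1r -mvalZ ?cst_Linf//.
apply/andP; split; apply: mval_le => //; rewrite ?LinfZ ?cst_Linf// => x.
  by have := fge x; rewrite ler_norml mulN1r => /andP[].
by have := fge x; rewrite ler_norml => /andP[].
Qed.

Lemma Linf_sum (I : Type) (s : seq I) (F : I -> borel G -> R) :
  (forall i, F i \in Linf_pred haar) -> (fun x => \sum_(i <- s) F i x) \in Linf_pred haar.
Proof.
move=> FL; elim: s => [|i s ih].
  by rewrite (_ : (fun=> _) = fun=> 0) ?cst_Linf//; apply/funext => x; rewrite big_nil.
rewrite (_ : (fun=> _) = (fun x => F i x + \sum_(i <- s) F i x)) ?LinfD//.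
by apply/funext => x; rewrite big_cons.
Qed.

Lemma mval_sum (I : Type) (s : seq I) (F : I -> borel G -> R) :
  (forall i, F i \in Linf_pred haar) ->
  mval (fun x => \sum_(i <- s) F i x) = \sum_(i <- s) mval (F i).
Proof.
move=> FL; elim: s => [|i s ih].
  rewrite big_nil (_ : (fun=> _) = fun=> 0) ?mval_cst//.
  by apply/funext => x; rewrite big_nil.
rewrite (_ : (fun=> _) = (fun x => F i x + \sum_(i <- s) F i x)); last first.
  by apply/funext => x; rewrite big_cons.
by rewrite mvalD ?Linf_sum// ih big_cons.
Qed.

End Means.

(** * Averages over right translates *)

Section Averages.
Context {R : realType} {G : topologicalGroupType}.
Hypothesis hG : hausdorff_space G.
Hypothesis lcG : locally_compact [set: G].
Variable haar : {measure set (borel G) -> \bar R}.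
Hypothesis haarP : left_haar_measure haar.
Implicit Types (x y z : G) (A B C K N U V W : set G) (E : set (borel G)) (f g : borel G -> R).

Local Notation m := (fmeas haar).
Local Notation modular := (modular hG lcG haarP).
Local Notation mu_ := (mu_ haar).

Lemma M1_mu A : compact A -> 0 < m A -> M1 haar (mu_ A).
Proof.
move=> cA A0; have IA := integ_mu hG haarP cA; split.
- exact/Lfun1_integrable.
- rewrite Lnorm1; have := norm1_mu hG haarP cA A0; rewrite /norm1 /rint /Rintegral => <-.
  rewrite fineK//; apply: (integrable_fin_num measurableT).
  exact: integ_abs IA.
- by apply: aeW => x; exact: mu_ge0.
Qed.

Lemma mu_indicE B E z : mu_ B z * \1_E z = (m B)^-1 * \1_(B `&` E) z.
Proof.
rewrite /Defs.mu_ -/(m _) !indicE in_setI mulrAC -mulnb natrM mulrC.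
by rewrite mulrC.
Qed.

Definition pairing f E : R := rint haar (fun z => f z * \1_E z).

Lemma integ_mu_indic B E : compact B -> measurable (B `&` E : set (borel G)) ->
  integ haar (fun z => mu_ B z * \1_E z).
Proof.
move=> cB mBE; rewrite (_ : (fun=> _) = fun z => (m B)^-1 * \1_(B `&` E) z); last first.
  by apply/funext => z; exact: mu_indicE.
apply/integZ/integ_indic => //; apply: sub_fin (compact_fin haarP cB) => //.
exact: compact_meas.
Qed.

Lemma pairing_mu B E : compact B -> measurable (B `&` E : set (borel G)) ->
  pairing (mu_ B) E = m (B `&` E) / m B.
Proof.
move=> cB mBE; rewrite /pairing (_ : (fun=> _) = fun z => (m B)^-1 * \1_(B `&` E) z); last first.
  by apply/funext => z; exact: mu_indicE.
rewrite rintZ; last first.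
  apply: integ_indic => //; apply: sub_fin (compact_fin haarP cB) => //.
  exact: compact_meas.
by rewrite rint_indic// mulrC.
Qed.

Lemma pairing_bound B E : compact B -> 0 < m B -> measurable (B `&` E : set (borel G)) ->
  0 <= pairing (mu_ B) E <= 1.
Proof.
move=> cB B0 mBE; rewrite pairing_mu// divr_ge0 ?fmeas_ge0//= ler_pdivrMr// mul1r.
apply: fmeas_le => //; [exact: compact_meas|exact: compact_fin].
Qed.

Lemma pairing_sum (I : Type) (s : seq I) (c : I -> R) (B : I -> set G) E :
  (forall i, compact (B i)) -> (forall i, measurable (B i `&` E : set (borel G))) ->
  integ haar (fun z => (\sum_(i <- s) c i * mu_ (B i) z) * \1_E z) /\
  pairing (fun z => \sum_(i <- s) c i * mu_ (B i) z) E = \sum_(i <- s) c i * pairing (mu_ (B i)) E.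
Proof.
move=> cB mBE.
have eqf : (fun z => (\sum_(i <- s) c i * mu_ (B i) z) * \1_E z) =
    (fun z => \sum_(i <- s) c i * (mu_ (B i) z * \1_E z)).
  by apply/funext => z; rewrite mulr_suml; apply: eq_bigr => i _; rewrite mulrA.
have ii i : integ haar (fun z => mu_ (B i) z * \1_E z) by exact: integ_mu_indic.
split; first by rewrite eqf; apply: integ_sum => i _; exact: integZ.
rewrite /pairing eqf rint_sum; last by move=> i _; exact: integZ.
by apply: eq_bigr => i _; rewrite rintZ.
Qed.

Lemma pairing_dist f g E : integ haar f -> integ haar g ->
  integ haar (fun z => f z * \1_E z) -> integ haar (fun z => g z * \1_E z) ->
  `|pairing f E - pairing g E| <= norm1 haar (fun z => f z - g z).
Proof.
move=> If Ig IfE IgE; rewrite /pairing -rintB//.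
apply: le_trans (le_norm1 (integB IfE IgE)) _.
apply: norm1_mono; [exact: integB|exact/integ_abs/integB|] => z.
rewrite -mulrBl normrM ler_piMr// indicE.
by case: (_ \in _); rewrite ?normr1 ?normr0.
Qed.

Lemma loc_meas_compact E B : locally_measurable haar E -> compact B ->
  measurable (B `&` E : set (borel G)).
Proof.
move=> lE cB; rewrite setIC; apply: lE; first exact: compact_meas.
exact: compact_fin.
Qed.

(** The proportion of the translate [A y] that lies in [E]. *)
Definition translate_avg A E y : R := pairing (mu_ (rtranslate A y)) E.

Lemma continuous_from_close (F : G -> R) (D : G -> G -> R) :
  (forall y0 e, 0 < e -> \forall y \near nbhs y0, D y y0 <= e) ->
  (forall y y0, `|F y - F y0| <= D y y0) -> continuous F.
Proof.
move=> HD FD y0; apply/cvgrPdist_le => e e0.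
by apply: filterS (HD y0 e e0) => y /=; rewrite distrC; exact: le_trans.
Qed.

Lemma translate_avg_continuous A E : compact A -> 0 < m A -> locally_measurable haar E ->
  continuous (translate_avg A E : G -> R).
Proof.
move=> cA A0 lE.
apply: (@continuous_from_close _ (fun y y0 => norm1 haar (fun z => mu_ (rtranslate A y) z - mu_ (rtranslate A y0) z))).
  by move=> y0 e e0; exact: right_continuity.
have cAy y : compact (rtranslate A y) by exact: compact_rtranslate.
move=> y y0; apply: pairing_dist; [exact: integ_mu|exact: integ_mu| |];
  by apply: integ_mu_indic => //; exact: loc_meas_compact.
Qed.

Lemma translate_avg_bound A E y : compact A -> 0 < m A -> locally_measurable haar E -> 0 <= translate_avg A E y <= 1.
Proof.
move=> cA A0 lE; have cAy : compact (rtranslate A y) by exact: compact_rtranslate.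
by apply: pairing_bound => //; [exact: rtranslate_pos|exact: loc_meas_compact].
Qed.

Lemma translate_avg_bounded A E : compact A -> 0 < m A -> locally_measurable haar E ->
  bounded_borel (translate_avg A E : borel G -> R).
Proof.
move=> cA A0 lE; split; first by apply: continuous_meas; exact: translate_avg_continuous.
by exists 1 => y; have /andP[p0 p1] := translate_avg_bound y cA A0 lE; rewrite ger0_norm.
Qed.

Lemma loc_meas_inv E A y : locally_measurable haar E -> compact A ->
  measurable (A `&` [set x | E (x^-1 * y)%g] : set (borel G)).
Proof.
move=> lE cA; have cAy : compact (rtranslate (invset A) y).
  by apply: compact_rtranslate; exact: compact_invset.
have := meas_invset (meas_rtranslate y^-1%g (loc_meas_compact lE cAy)).
congr measurable; apply/seteqP; split => z;
  by rewrite /rtranslate/invset/= !invgK mulgK invgK.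
Qed.

(** Moving [y] into the density turns the convolution into the pairing of
    [translate y^-1 U] with a fixed set, and left translation is continuous in norm. *)
Lemma convolution_bounded_borel U E : compact U -> 0 < m U -> locally_measurable haar E ->
  bounded_borel (fun y : borel G => rint haar (fun x => mu_ U x * \1_E (x^-1 * y)%g)).
Proof.
move=> cU U0 lE.
have convE y : rint haar (fun x => mu_ U x * \1_E (x^-1 * y)%g) =
    pairing (mu_ U) [set x | E (x^-1 * y)%g].
  by apply: rint_ext => x; rewrite !indicE.
have shiftE y : pairing (mu_ U) [set x | E (x^-1 * y)%g] =
    pairing (mu_ (translate y^-1%g U)) (invset E).
  rewrite /pairing -(rint_lshift haarP (y^-1)%g); last first.
    by apply: integ_mu_indic => //; exact: loc_meas_inv.
  apply: rint_ext => z; rewrite (mu_translate hG haarP)//; congr (_ * _).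
  by rewrite !indicE; congr (_ _)%:R; apply/idP/idP; rewrite !inE /invset/= ?invgK ?invgM ?invgK ?mulgVK.
have cyU y : compact (translate y U) by exact: compact_translate.
have mE B : compact B -> measurable (B `&` invset E : set (borel G)).
  move=> cB; have := loc_meas_inv (1%g) lE cB; congr measurable.
  by apply/seteqP; split => z; rewrite /invset/= mulg1.
split; last first.
  exists 1 => y; rewrite convE shiftE.
  have /andP[p0 p1] := pairing_bound (cyU y^-1%g) (translate_pos hG haarP _ cU U0) (mE _ (cyU y^-1%g)).
  by rewrite ger0_norm.
apply: continuous_meas.
apply: (@continuous_from_close _ (fun y y0 => norm1 haar (fun z => mu_ (translate y^-1%g U) z - mu_ (translate y0^-1%g U) z))).
  move=> y0 e e0.
  have H := left_continuity hG haarP (cyU y0^-1%g) (translate_pos hG haarP y0^-1%g cU U0) e0.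
  have cont : continuous (fun y : G => (y^-1 * y0)%g).
    by apply: continuous_mul2 => [|?]; [exact: invg_continuous|exact: cvg_cst].
  have := cont y0; rewrite /continuous_at mulVg => /(_ _ H) H2.
  by apply: filterS (H2 : nbhs y0 _) => y /=; rewrite -translateM mulgK.
move=> y y0; rewrite !convE !shiftE.
by apply: pairing_dist; [exact: integ_mu|exact: integ_mu| |]; apply: integ_mu_indic => //; exact: mE.
Qed.

End Averages.

(** * Left invariance and averages *)

Section InvariantMeans.
Context {R : realType} {G : topologicalGroupType}.
Hypothesis hG : hausdorff_space G.
Hypothesis lcG : locally_compact [set: G].
Variable haar : {measure set (borel G) -> \bar R}.
Hypothesis haarP : left_haar_measure haar.
Variable mu : Linf haar -> R.
Hypothesis tlim : TLIM haar mu.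
Implicit Types (x y z : G) (A B C K N U V W : set G) (E : set (borel G)) (f g : borel G -> R).

Local Notation m := (fmeas haar).
Local Notation modular := (modular hG lcG haarP).
Local Notation mu_ := (mu_ haar).
Local Notation mval := (mval mu).
Local Notation translate_avg := (translate_avg haar).

Let meanmu : mean haar mu. Proof. by case: tlim. Qed.

Lemma tlim_conv f U : f \in Linf_pred haar -> compact U -> 0 < m U ->
  mval f = mval (fun y : borel G => rint haar (fun x => mu_ U x * f (x^-1 * y)%g)).
Proof.
move=> fL cU U0; case: tlim => _ /(_ _ (to_Linf haar f) (M1_mu hG haarP cU U0)) E.
rewrite /mval E /convolution; congr (mu (to_Linf haar _)); apply/funext => y.
by apply: rint_ext => x; rewrite /ltranslate to_LinfE.
Qed.

Lemma bounded_translate f a : bounded_borel f ->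
  bounded_borel (fun z : borel G => f (a * z)%g).
Proof.
case=> mf [M fM]; split; last by exists M.
apply: (@measurableT_comp _ _ _ _ _ _ f) => //.
by apply: continuous_borel; exact: continuous_lmul.
Qed.

(** Translating [f] on the left amounts to translating on the right the density
    by which it is convolved, up to the modular function. *)
Lemma tlim_left_invariant f a : bounded_borel f ->
  mval (fun z : borel G => f (a * z)%g) = mval f.
Proof.
move=> bf; have [U cU [U1 _ _]] := compact_nbhs hG lcG (filterT : nbhs (1%g : G) setT).
have U0 : 0 < m U by apply: nbhs_pos U1.
have cV : compact (rtranslate U a^-1%g) by exact: compact_rtranslate.
have V0 : 0 < m (rtranslate U a^-1%g) by exact: (rtranslate_pos hG lcG haarP).
rewrite (tlim_conv _ cU U0); last by apply: bounded_borel_Linf; exact: bounded_translate.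
rewrite (@tlim_conv f _ (bounded_borel_Linf haar bf) cV V0).
congr mval; apply/funext => y.
set F := fun x : borel G => mu_ (rtranslate U a^-1%g) x * f (x^-1 * y)%g.
have IF : integ haar F.
  case: bf => mf [M fM]; apply: (@integM _ _ _ haar _ (fun x : borel G => f (x^-1 * y)%g) M) => //; last exact: integ_mu.
  apply: (@measurableT_comp _ _ _ _ _ _ f) => //.
  by apply: continuous_borel; apply: continuous_mul2 => [|?]; [exact: invg_continuous|exact: cvg_cst].
have ma := modular_gt0 hG lcG haarP a.
apply: (mulfI (lt0r_neq0 ma)); rewrite -(rint_rshift hG lcG haarP a IF) -rintZ.
  apply: rint_ext => x; rewrite /F (mu_rtranslate hG lcG haarP _ cU) invgK mulgVK modularV invrK.
  by rewrite invgM invgK mulgA mulrA.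
case: (bounded_translate a bf) => mf [M fM].
apply: (@integM _ _ _ haar _ (fun x : borel G => f (a * (x^-1 * y))%g) M) => //; last exact: integ_mu.
apply: (@measurableT_comp _ _ _ _ _ _ (fun z : borel G => f (a * z)%g)) => //.
by apply: continuous_borel; apply: continuous_mul2 => [|?]; [exact: invg_continuous|exact: cvg_cst].
Qed.

Lemma loc_meas_Linf E : locally_measurable haar E -> (\1_E : borel G -> R) \in Linf_pred haar.
Proof. by move=> lE; rewrite -(chiE lE); exact: Linf_funP. Qed.

(** At [y] the convolution of [\1_E] by [mu_ U] and the average over [U y] are
    [m S / m U] and [m (invset S) / m U] for the same set [S] near the identity, where
    inversion almost preserves the measure. *)
Lemma mval_translate_avg_small E (t : R) : locally_measurable haar E -> 0 < t ->
  exists2 O, nbhs (1%g : G) O & forall U, compact U -> 0 < m U -> invset U = U -> U `<=` O ->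
  `|mval \1_E - mval (translate_avg U E)| <= t.
Proof.
move=> lE t0; have [W [oW W1 WI Woo WP]] := inversion_near1 hG lcG haarP t0.
exists W; first exact: open_nbhs1.
move=> U cU U0 UI UW; rewrite (tlim_conv (loc_meas_Linf lE) cU U0).
have b1 := convolution_bounded_borel hG haarP cU U0 lE.
have b2 := translate_avg_bounded hG lcG haarP cU U0 lE.
apply: (mval_dist meanmu) => //; [exact: bounded_borel_Linf b1|exact: bounded_borel_Linf b2|] => y.
have mS := loc_meas_inv hG haarP y lE cU; set S := (X in measurable X) in mS.
have cUy : compact (rtranslate U y) by exact: compact_rtranslate.
have -> : rint haar (fun x => mu_ U x * \1_E (x^-1 * y)%g) = m S / m U.
  rewrite -[RHS](pairing_mu hG haarP cU mS); apply: rint_ext => x; rewrite !indicE.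
  by congr (_ * _%:R); congr nat_of_bool; apply/idP/idP; rewrite !inE.
have SI : rtranslate U y `&` E = rtranslate (invset S) y.
  rewrite -{1}UI; apply/seteqP; split => z; rewrite /S/rtranslate/invset/= ?invgK mulgVK => -[] //.
have mIS := meas_invset mS.
have Uoo := compact_fin haarP cU.
have SU : S `<=` U by move=> z [].
have ISU : invset S `<=` U by rewrite -UI; exact: invsetS.
have Soo : (haar S < +oo)%E by apply: sub_fin SU Uoo => //; exact: compact_meas.
have ISoo : (haar (invset S) < +oo)%E by apply: sub_fin ISU Uoo => //; exact: compact_meas.
have -> : translate_avg U E y = m (invset S) / m U.
  rewrite /translate_avg (pairing_mu hG haarP cUy (loc_meas_compact hG haarP lE cUy)).
  rewrite SI (fmeas_rtranslate hG lcG haarP)// (modular_compact hG lcG haarP)//.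
  by rewrite -mulf_div divff ?mul1r// lt0r_neq0// modular_gt0.
rewrite -mulrBl normrM [`|_^-1|]gtr0_norm ?invr_gt0// ler_pdivrMr//.
have H1 := WP _ mS (subset_trans SU UW).
have H2 := WP _ mIS (subset_trans ISU UW); rewrite invsetK in H2.
have L1 : m S <= m U by apply: fmeas_le => //; exact: compact_meas.
have L2 : m (invset S) <= m U by apply: fmeas_le => //; exact: compact_meas.
by rewrite ler_norml; apply/andP; split; nra.
Qed.

(** The density of [A] is almost a combination of densities of small sets [U x];
    left invariance removes the [x]. *)
Lemma mval_translate_avg A E : compact A -> 0 < m A -> locally_measurable haar E ->
  mval (translate_avg A E) = mval \1_E.
Proof.
move=> cA A0 lE; apply/eqP; rewrite -subr_eq0 -normr_eq0 -[_ == 0]andbT; apply/andP; split => //.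
rewrite eq_le normr_ge0 andbT; apply/ler_addgt0Pr => e e0; rewrite add0r.
have e2 : 0 < e / 2 by lra.
have [N1 N11 OP1] := mval_translate_avg_small lE e2.
have [N2 N21 OP2] := right_approx hG lcG haarP cA A0 e2.
have [U cU [U1 UI UO]] := compact_nbhs hG lcG (filterI N11 N21).
have U0 : 0 < m U by apply: nbhs_pos U1.
have H1 := OP1 U cU U0 UI (fun z Uz => proj1 (UO z Uz)).
have [s [s0 s1] sP] := OP2 U cU U0 (fun z Uz => proj2 (UO z Uz)).
have bU := translate_avg_bounded hG lcG haarP cU U0 lE.
have bA := translate_avg_bounded hG lcG haarP cA A0 lE.
have cB x : compact (rtranslate U x) by exact: compact_rtranslate.
have bx x := bounded_translate x bU.
have H2 : `|mval (translate_avg A E) - mval (fun y : borel G => \sum_(p <- s) p.1 * translate_avg U E (p.2 * y)%g)| <= e / 2.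
  apply: (mval_dist meanmu).
  - exact: bounded_borel_Linf.
  - by apply: Linf_sum => p; apply: LinfZ; by apply: bounded_borel_Linf; exact: bx.
  move=> y; have cAy : compact (rtranslate A y) by exact: compact_rtranslate.
  have [iS pS] := pairing_sum (B := fun p : R * G => rtranslate U (p.2 * y)%g) hG haarP s (fun p => p.1)
    (fun p => cB _) (fun p => loc_meas_compact hG haarP lE (cB _)).
  rewrite -pS distrC; apply: le_trans (pairing_dist _ _ _ _) _.
  - by apply: integ_sum => p _; exact/integZ/integ_mu.
  - exact: integ_mu.
  - exact: iS.
  - exact: (integ_mu_indic hG haarP cAy (loc_meas_compact hG haarP lE cAy)).
  apply: le_trans sP; rewrite -[leRHS](norm1_rshift hG lcG haarP y); last first.
    by apply: integB; [apply: integ_sum => p _; exact/integZ/integ_mu|exact: integ_mu].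
  rewrite le_eqVlt; apply/orP; left; apply/eqP/rint_ext => z.
  rewrite (mu_rtranslate hG lcG haarP _ cA) mulrBr mulr_sumr; congr (`|_ - _|).
  apply: eq_bigr => p _; rewrite rtranslateM (mu_rtranslate hG lcG haarP _ (cB _)).
  by rewrite mulrCA.
have H3 : mval (fun y : borel G => \sum_(p <- s) p.1 * translate_avg U E (p.2 * y)%g) = mval (translate_avg U E).
  rewrite (mval_sum meanmu); last by move=> p; apply: LinfZ; by apply: bounded_borel_Linf; exact: bx.
  under eq_bigr => p _.
    rewrite (mvalZ meanmu _ (bounded_borel_Linf haar (bx p.2))) tlim_left_invariant//.
    over.
  by rewrite -mulr_suml s1 mul1r.
rewrite H3 in H2; rewrite (le_trans (ler_distD (mval (translate_avg U E)) _ _))//.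
by rewrite [leRHS](splitr e) lerD// distrC.
Qed.

End InvariantMeans.

(** * Separation by a linear functional *)

Lemma sumr_ge0_seq (R : realType) (T : Type) (s : seq (R * T)) :
  all (fun c => 0 <= c.1) s -> 0 <= \sum_(c <- s) c.1.
Proof.
elim: s => [|c s ih] /=; first by rewrite big_nil.
by move=> /andP[c0 s0]; rewrite big_cons addr_ge0// ih.
Qed.

Lemma sum_weights0 (R : realType) (V : lmodType R) (T : Type) (F : T -> V) (s : seq (R * T)) :
  all (fun c => 0 <= c.1) s -> \sum_(c <- s) c.1 = 0 -> \sum_(c <- s) c.1 *: F c.2 = 0.
Proof.
elim: s => [|c s ih] /=; first by rewrite !big_nil.
move=> /andP[c0 s0]; have sge0 := sumr_ge0_seq s0; rewrite !big_cons => /eqP.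
by rewrite paddr_eq0// => /andP[/eqP -> /eqP /(ih s0) ->]; rewrite scale0r addr0.
Qed.

Section HahnBanach.
Context {R : realType} {V : lmodType R}.
Implicit Types (p q : V -> R) (u v : V).

Definition sublinear p : Prop :=
  (forall u v, p (u + v) <= p u + p v) /\ (forall t v, 0 <= t -> p (t *: v) = t * p v).

Lemma sublinear0 p : sublinear p -> p 0 = 0.
Proof. by case=> _ /(_ 0 0 (lexx 0)); rewrite scale0r mul0r. Qed.

Lemma sublinear_opp p v : sublinear p -> - p (- v) <= p v.
Proof.
move=> sp; rewrite -subr_ge0 opprK -(sublinear0 sp) -(subrr v).
by case: sp => + _; exact.
Qed.

(** For infima only inequalities are natural; homogeneity follows from the
    inequalities for [t] and for its inverse. *)
Lemma sublinear_le p : (forall u v, p (u + v) <= p u + p v) ->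
  (forall t v, 0 < t -> p (t *: v) <= t * p v) -> p 0 = 0 -> sublinear p.
Proof.
move=> pD pZ p0; split => // t v; rewrite le_eqVlt => /predU1P[<-|t0].
  by rewrite scale0r mul0r.
apply/eqP; rewrite eq_le pZ//= -ler_pdivlMl//.
have ti0 : 0 < t^-1 by rewrite invr_gt0.
by have := pZ t^-1 (t *: v) ti0; rewrite scalerA mulVf ?scale1r// lt0r_neq0.
Qed.

Section Shift.
Variables (I : Type) (p : V -> R) (S : I -> V) (d : I -> R).
Hypothesis sp : sublinear p.
Hypothesis dS : forall s : seq (R * I), all (fun c => 0 <= c.1) s ->
  \sum_(c <- s) c.1 * d c.2 <= p (\sum_(c <- s) c.1 *: S c.2).

Let vals v := [set x | exists2 s : seq (R * I), all (fun c => 0 <= c.1) s &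
  x = p (v + \sum_(c <- s) c.1 *: S c.2) - \sum_(c <- s) c.1 * d c.2].

Let vals_lb v : lbound (vals v) (- p (- v)).
Proof.
move=> _ [s s0 ->]; have := dS s0; set a := \sum_(_ <- _) _ *: _.
have : p a <= p (v + a) + p (- v) by case: sp => pD _; rewrite -[X in p X <= _](addrK v) [a + v]addrC pD.
by lra.
Qed.

Let vals0 v : vals v !=set0.
Proof. by exists (p (v + \sum_(c <- [::] : seq (R * I)) c.1 *: S c.2) - \sum_(c <- [::] : seq (R * I)) c.1 * d c.2); exists [::]. Qed.

Let vals_inf v : has_inf (vals v).
Proof. by split; [exact: vals0|exists (- p (- v)); exact: vals_lb]. Qed.

(** Take the infimum of [p (v + a) - b], for [a] a positive combination of the [S i]
    and [b] the same combination of the [d i]. *)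
Lemma sublinear_shift : exists q, [/\ sublinear q, forall v, q v <= p v &
  forall i, q (- S i) <= - d i].
Proof.
pose q v := inf (vals v).
have qle v s : all (fun c => 0 <= c.1) s ->
    q v <= p (v + \sum_(c <- s) c.1 *: S c.2) - \sum_(c <- s) c.1 * d c.2.
  by move=> s0; apply: ge_inf; [exact: (vals_inf v).2|exists s].
have qp v : q v <= p v by have := qle v [::] isT; rewrite !big_nil addr0 subr0.
have q0 : q 0 = 0.
  apply/eqP; rewrite eq_le -{1}(sublinear0 sp) qp/=.
  by apply: lb_le_inf => //; move=> x /vals_lb; rewrite oppr0 (sublinear0 sp) oppr0.
exists q; split => //; last first.
  move=> i; have := qle (- S i) [:: (1, i)]; rewrite !big_seq1 scale1r mul1r addNr (sublinear0 sp) add0r.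
  by apply; rewrite /= ler01.
apply: sublinear_le => // [u v|t v t0].
- apply/ler_addgt0Pr => e e0; have e2 : 0 < e / 2 by lra.
  have [_ [s s0 ->] us] := inf_adherent e2 (vals_inf u).
  have [_ [s' s'0 ->] vs] := inf_adherent e2 (vals_inf v).
  have := qle (u + v) (s ++ s'); rewrite all_cat s0 s'0 => /(_ isT) H.
  apply: (le_trans H); rewrite !big_cat/=.
  move: us vs; rewrite -/(q u) -/(q v).
  set a := \sum_(c <- s) _ *: _; set a' := \sum_(c <- s') _ *: _.
  have -> : u + v + (a + a') = (u + a) + (v + a') by rewrite addrACA.
  have := sp.1 (u + a) (v + a'); lra.
- apply/ler_addgt0Pr => e e0; have et : 0 < e / t by exact: divr_gt0.
  have [_ [s s0 ->] vs] := inf_adherent et (vals_inf v).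
  have := qle (t *: v) [seq (t * c.1, c.2) | c <- s]; rewrite !big_map/=.
  have -> : all (fun c : R * I => 0 <= c.1) [seq (t * c.1, c.2) | c <- s].
    by rewrite all_map; apply: sub_all s0 => c /= c0; rewrite mulr_ge0// ltW.
  move=> /(_ isT) H; apply: (le_trans H).
  under eq_bigr do rewrite -scalerA; rewrite -scaler_sumr -scalerDr (sp.2 _ _ (ltW t0)).
  under eq_bigr do rewrite -mulrA; rewrite -mulr_sumr -mulrBr -/(q v).
  by rewrite -ler_pdivlMl// mulrDr mulKf ?lt0r_neq0// [_ * e]mulrC ltW.
Qed.

End Shift.

(** Minimal sublinear functionals exist by Zorn's lemma, since chains have
    infima. Lowering a minimal [q] so that it is at most [- q y] at [- y] cannot change it,
    so [q] is odd, and an odd sublinear functional is linear. *)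
Lemma hahn_banach p : sublinear p ->
  exists2 L : V -> R, scalar L & forall v, L v <= p v.
Proof.
move=> sp; pose T := {q : V -> R | sublinear q /\ forall v, q v <= p v}.
pose rel (q q' : T) := `[< forall v, sval q' v <= sval q v >].
have relx a : rel a a by apply/asboolP.
have relt : forall a b c : T, rel a b -> rel b c -> rel a c.
  by move=> a b c /asboolP ab /asboolP bc; apply/asboolP => v; exact: le_trans (bc v) (ab v).
pose t0 : T := exist _ p (conj sp (fun v => lexx _)).
have chain A : total_on A (fun x y => rel x y) -> exists t, forall s, A s -> rel s t.
  move=> Atot.
  have [A0|/set0P[a0 Aa0]] := eqVneq A set0.
    by exists t0 => s; rewrite A0.
  pose vals v := [set sval a v | a in A].
  have vals_lb v : lbound (vals v) (- p (- v)).
    move=> _ [a Aa <-]; case: (svalP a) => sa ap.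
    by apply: le_trans (sublinear_opp v sa); rewrite lerN2.
  have vals_inf v : has_inf (vals v).
    by split; [exists (sval a0 v); exists a0|exists (- p (- v)); exact: vals_lb].
  pose q v := inf (vals v).
  have qle a v : A a -> q v <= sval a v.
    by move=> Aa; apply: ge_inf; [exact: (vals_inf v).2|exists a].
  have q0 : q 0 = 0.
    rewrite /q (_ : vals 0 = [set 0]) ?inf1//; apply/seteqP; split => [_ [a Aa <-]|_ ->].
      by rewrite /= (sublinear0 (svalP a).1).
    by exists a0 => //; rewrite (sublinear0 (svalP a0).1).
  have sq : sublinear q.
    apply: sublinear_le => // [u v|t v t_gt0].
      apply/ler_addgt0Pr => e e0; have e2 : 0 < e / 2 by lra.
      have [_ [a Aa <-] au] := inf_adherent e2 (vals_inf u).
      have [_ [b Ab <-] bv] := inf_adherent e2 (vals_inf v).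
      move: au bv; rewrite -/(q u) -/(q v) => au bv.
      have [/asboolP ab|/asboolP ba] := Atot a b Aa Ab.
        have := qle b (u + v) Ab; have := (svalP b).1.1 u v; have := ab u; lra.
      have := qle a (u + v) Aa; have := (svalP a).1.1 u v; have := ba v; lra.
    apply/ler_addgt0Pr => e e0; have et : 0 < e / t by exact: divr_gt0.
    have [_ [a Aa <-] av] := inf_adherent et (vals_inf v).
    apply: (le_trans (qle a _ Aa)); rewrite ((svalP a).1.2 _ _ (ltW t_gt0)).
    by rewrite -ler_pdivlMl// mulrDr mulKf ?lt0r_neq0// [_ * e]mulrC ltW.
  have qp v : q v <= p v by apply: le_trans (qle a0 v Aa0) _; exact: (svalP a0).2.
  by exists (exist _ q (conj sq qp)) => a Aa; apply/asboolP => v; exact: qle.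
have [[q [sq qp]] qmin] := ZL_preorder t0 relx relt chain.
have odd y : q (- y) = - q y.
  have [s s0|r [sr rq rS]] := @sublinear_shift unit q (fun=> y) (fun=> q y) sq.
    rewrite -mulr_suml -scaler_suml sq.2//.
    by apply: sumr_ge0_seq s0.
  have rp v : r v <= p v := le_trans (rq v) (qp v).
  have /asboolP qr := qmin (exist _ r (conj sr rp)) (introT (asboolP _) rq).
  apply/eqP; rewrite eq_le (le_trans (qr (- y)) (rS tt))/= lerNl.
  exact: sublinear_opp.
have qD u v : q (u + v) = q u + q v.
  apply/eqP; rewrite eq_le sq.1/=.
  by have := sq.1 (u + v) (- v); rewrite addrK odd; lra.
exists q => // a u v; rewrite qD; congr (_ + _).
have [a0|a0] := leP 0 a; first exact: sq.2.
by rewrite -[a]opprK scaleNr odd sq.2 ?mulNr// oppr_ge0 ltW.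
Qed.

(** Lower [p] until it is at most [- d] at every [- S i], then take a linear
    functional below it. *)
Lemma separation p (I : Type) (S : I -> V) (d : R) : sublinear p ->
  (forall s : seq (R * I), convex_weights s -> d <= p (\sum_(c <- s) c.1 *: S c.2)) ->
  exists L : V -> R, [/\ scalar L, forall v, L v <= p v & forall i, d <= L (S i)].
Proof.
move=> sp H; have [s s0|q [sq qp qS]] := @sublinear_shift I p S (fun=> d) sp.
  rewrite -mulr_suml; set t := \sum_(c <- s) c.1.
  have tge0 : 0 <= t by exact: sumr_ge0_seq s0.
  have [t0|t0] := eqVneq t 0.
    by rewrite t0 mul0r sum_weights0// sublinear0.
  have tgt0 : 0 < t by rewrite lt_neqAle eq_sym t0.
  have := H [seq (t^-1 * c.1, c.2) | c <- s]; rewrite !big_map/=.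
  under eq_bigr do rewrite -scalerA; rewrite -scaler_sumr sp.2 ?invr_ge0//.
  rewrite ler_pdivlMl//; apply; split.
    by rewrite all_map; apply: sub_all s0 => c /= c0; rewrite mulr_ge0// invr_ge0.
  by rewrite big_map/= -mulr_sumr mulVf.
have [L sL Lq] := hahn_banach sq; exists L; split => //.
  by move=> v; exact: le_trans (Lq v) (qp v).
move=> i; have LN : L (- S i) = - L (S i).
  have L0 : L 0 = 0 by have := sL 1 0 0; rewrite scaler0 addr0 mul1r; lra.
  by have := sL (-1) (S i) 0; rewrite !addr0 scaleN1r L0 mulN1r addr0.
by have := le_trans (Lq (- S i)) (qS i); rewrite LN lerN2.
Qed.

End HahnBanach.

(** * Reiter's condition *)

Section RightConvolution.
Context {R : realType} {G : topologicalGroupType}.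
Hypothesis hG : hausdorff_space G.
Hypothesis lcG : locally_compact [set: G].
Variable haar : {measure set (borel G) -> \bar R}.
Hypothesis haarP : left_haar_measure haar.
Implicit Types (x y z : G) (A B C K N U V W : set G) (f g : borel G -> R).

Local Notation m := (fmeas haar).
Local Notation modular := (modular hG lcG haarP).
Local Notation mu_ := (mu_ haar).

(** The convolution of [f] on the right by the finitely supported measure [s]. It
    commutes with left translations, and maps [mu_ B] to a combination of the
    densities of right translates of [B]. *)
Definition rconv (s : seq (R * G)) f : borel G -> R :=
  fun z => \sum_(p <- s) p.1 * ((modular p.2)^-1 * f (z * p.2^-1)%g).

Lemma integ_rconv s f : integ haar f -> integ haar (rconv s f).
Proof.
by move=> If; apply: integ_sum => p _; apply/integZ/integZ; exact: (integ_rshift hG lcG haarP).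
Qed.

Lemma rconv_cons c s f z :
  rconv (c :: s) f z = c.1 * ((modular c.2)^-1 * f (z * c.2^-1)%g) + rconv s f z.
Proof. by rewrite /rconv big_cons. Qed.

Lemma rconv_mu s B : compact B ->
  rconv s (mu_ B) = fun z => \sum_(p <- s) p.1 * mu_ (rtranslate B p.2) z.
Proof.
move=> cB; apply/funext => z; apply: eq_bigr => p _.
by rewrite (mu_rtranslate hG lcG haarP).
Qed.

Lemma rconvB s f g : rconv s (fun z => f z - g z) = fun z => rconv s f z - rconv s g z.
Proof.
by apply/funext => z; rewrite /rconv -sumrB; apply: eq_bigr => p _; rewrite -!mulrBr.
Qed.

Lemma rconv_sum (I : Type) (t : seq I) (c : I -> R) (F : I -> borel G -> R) s :
  rconv s (fun z => \sum_(i <- t) c i * F i z) = fun z => \sum_(i <- t) c i * rconv s (F i) z.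
Proof.
apply/funext => z; rewrite /rconv; under [RHS]eq_bigr do rewrite mulr_sumr.
rewrite exchange_big/=; apply: eq_bigr => p _; rewrite !mulr_sumr; apply: eq_bigr => i _.
by ring.
Qed.

Lemma rconv_le s f : convex_weights s -> integ haar f -> norm1 haar (rconv s f) <= norm1 haar f.
Proof.
move=> [s0 s1] If.
have Ip y : integ haar (fun z => (modular y)^-1 * f (z * y^-1)%g).
  by apply: integZ; exact: (integ_rshift hG lcG haarP).
apply: (@le_trans _ _ (\sum_(p <- s) norm1 haar (fun z => p.1 * ((modular p.2)^-1 * f (z * p.2^-1)%g)))).
  by apply: norm1_sum => p _; exact: integZ.
rewrite -[leRHS]mul1r -s1 mulr_suml; elim: s s0 {s1} => [|p s ih] /=.
  by rewrite !big_nil.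
move=> /andP[p0 s0]; rewrite !big_cons lerD ?ih// norm1Z// (norm1_rshift hG lcG haarP)//.
by rewrite ger0_norm.
Qed.

End RightConvolution.

Section RightReiter.
Context {R : realType} {G : topologicalGroupType}.
Hypothesis hG : hausdorff_space G.
Hypothesis lcG : locally_compact [set: G].
Variable haar : {measure set (borel G) -> \bar R}.
Hypothesis haarP : left_haar_measure haar.
Variable mu : Linf haar -> R.
Hypothesis tlim : TLIM haar mu.
Implicit Types (x y z : G) (A B C K N U V W : set G) (f g : borel G -> R).

Local Notation m := (fmeas haar).
Local Notation modular := (modular hG lcG haarP).
Local Notation mu_ := (mu_ haar).
Local Notation mval := (mval mu).

Let meanmu : mean haar mu. Proof. by case: tlim. Qed.

Local Notation L1 := (LfunType haar (lexx (1%E : \bar R))).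

Lemma integ_Lfun f : integ haar f -> f \in Lfun haar 1%E.
Proof. by move=> If; apply/Lfun1_integrable. Qed.

Definition mkL1 f (If : integ haar f) : L1 := Lfun_Sub (lexx 1%E) (integ_Lfun If).

Lemma integ_L1 (h : L1) : integ haar (h : borel G -> R).
Proof. by apply/Lfun1_integrable; exact: LfunP. Qed.

Lemma mkL1E f (If : integ haar f) z : mkL1 If z = f z.
Proof. by rewrite /mkL1 (Lfun_valP (lexx 1%E) (integ_Lfun If)). Qed.

Section Family.
Variable n : nat.
Implicit Types v : 'I_n -> L1.

Definition norm_sum v : R := \sum_(i < n) norm1 haar (v i : borel G -> R).

Lemma norm_sum_sublinear : sublinear norm_sum.
Proof.
split.
  move=> u v; rewrite /norm_sum -big_split/=; apply: ler_sum => i _.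
  exact: (norm1D (integ_L1 (u i)) (integ_L1 (v i))).
move=> t v t0; rewrite /norm_sum mulr_sumr; apply: eq_bigr => i _.
by rewrite -[X in X * _](ger0_norm t0) -(norm1Z t (integ_L1 (v i))).
Qed.

Definition single (i : 'I_n) (h : L1) : 'I_n -> L1 := fun j => if j == i then h else 0.

Lemma norm_single i h : norm_sum (single i h) = norm1 haar (h : borel G -> R).
Proof.
rewrite /norm_sum (bigD1 i)//= /single eqxx big1 ?addr0// => j /negPf ->.
rewrite -[RHS](@rint0 _ _ _ haar); apply: rint_ext => z.
by rewrite (_ : (0 : L1) z = 0) ?normr0.
Qed.

Lemma single_sum v : v = \sum_(i < n) single i (v i).
Proof.
apply/funext => j; rewrite fct_sumE (bigD1 j)//= /single eqxx big1 ?addr0//.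
by move=> i ij; rewrite eq_sym (negPf ij).
Qed.

End Family.

Lemma single_scale n (i : 'I_n) c (g h : L1) :
  single i (c *: g + h) = c *: single i g + single i h.
Proof.
apply/funext => j; rewrite /single /=.
transitivity (c *: (if j == i then g else 0) + (if j == i then h else 0)); last by [].
by case: ifP => //; rewrite scaler0 addr0.
Qed.

(** If no combination worked, some linear [L] on the n-tuples of integrable functions
    would be at least [e] on all the tuples [S y]. On right translates [U y] of the density
    in the coordinate [i], [L] is a bounded continuous function [phi i] of [y], and
    the inequality says that the sum of the [phi i (a i * y) - phi i y] is at least [e]
    everywhere. But its mean is zero. Right translates of one density thus spare
    any description of the dual of L_1. *)
Lemma right_reiter n (a : 'I_n -> G) U (e : R) : compact U -> 0 < m U -> 0 < e ->
  exists2 s : seq (R * G), convex_weights s & forall i,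
    norm1 haar (fun z => rconv hG lcG haarP s (mu_ (rtranslate U (a i))) z
                      - rconv hG lcG haarP s (mu_ U) z) <= e.
Proof.
move=> cU U0 e0; apply: contrapT => H.
have cUx x : compact (rtranslate U x) by exact: compact_rtranslate.
pose hU x : L1 := mkL1 (integ_mu hG haarP (cUx x)).
pose S y : 'I_n -> L1 := fun i => hU (a i * y)%g - hU y.
have far (s : seq (R * G)) : convex_weights s -> e <= norm_sum (\sum_(c <- s) c.1 *: S c.2).
  move=> cs; rewrite leNgt; apply/negP => le; apply: H; exists s => // i.
  apply: ltW; apply: le_lt_trans le; rewrite /norm_sum (bigD1 i)//=.
  rewrite -[leLHS]addr0 lerD ?sumr_ge0//; last by move=> j _; exact: norm1_ge0.
  rewrite le_eqVlt; apply/orP; left; apply/eqP/rint_ext => z; congr (`| _ |).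
  transitivity (rconv hG lcG haarP s (fun z => mu_ (rtranslate U (a i)) z - mu_ U z) z).
    by rewrite rconvB.
  have -> : (\sum_(c <- s) c.1 *: S c.2) i = \sum_(c <- s) c.1 *: (hU (a i * c.2)%g - hU c.2).
    by rewrite fct_sumE.
  elim: s {cs} => [|c s ih]; first by rewrite /rconv !big_nil.
  rewrite big_cons rconv_cons ih.
  set w := \sum_(_ <- _) _.
  rewrite [RHS](_ : _ = c.1 * (hU (a i * c.2)%g z - hU c.2 z) + w z)//.
  congr (_ * _ + _); rewrite !mkL1E rtranslateM mulrBr.
  by rewrite !(mu_rtranslate hG lcG haarP c.2).
have [L [Ls Lle Lge]] := separation (@norm_sum_sublinear n) far.
have LD u v : L (u + v) = L u + L v by rewrite -[u]scale1r Ls mul1r scale1r.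
have L0 : L 0 = 0 by have := LD 0 0; rewrite addr0; lra.
have LN u : L (- u) = - L u by apply: (addrI (L u)); rewrite -LD !subrr.
have Labs v : `|L v| <= norm_sum v.
  rewrite ler_norml Lle andbT lerNl -LN; apply: le_trans (Lle _) _.
  rewrite le_eqVlt; apply/orP; left; apply/eqP; apply: eq_bigr => i _.
  exact: (norm1N haar (v i : borel G -> R)).
pose phi i (y : G) := L (single i (hU y)).
have singleB i (u w : L1) : single i (u - w) = single i u - single i w :> ('I_n -> L1).
  by have := single_scale i (-1) w u; rewrite !scaleN1r addrC => ->; rewrite addrC.
have phi_cont i : continuous (phi i).
  apply: (@continuous_from_close _ _ _ (fun y y0 => norm1 haar (fun z => mu_ (rtranslate U y) z - mu_ (rtranslate U y0) z))).
    by move=> y0 t t0; exact: right_continuity.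
  move=> y y0; rewrite /phi -LN -LD -singleB; apply: le_trans (Labs _) _.
  rewrite norm_single le_eqVlt; apply/orP; left; apply/eqP/rint_ext => z.
  by rewrite [in LHS](_ : (hU y - hU y0) z = hU y z - hU y0 z)// !mkL1E.
have phi_bd i : bounded_borel (phi i : borel G -> R).
  split; first exact: continuous_meas.
  exists 1 => y; apply: le_trans (Labs _) _; rewrite norm_single.
  rewrite -[leRHS](norm1_mu hG haarP (cUx y) (rtranslate_pos hG lcG haarP y cU U0)).
  by rewrite le_eqVlt; apply/orP; left; apply/eqP/rint_ext => z; rewrite mkL1E.
have phi_tr i : bounded_borel (fun y : borel G => phi i (a i * y)%g) by exact: bounded_translate.
have diffL i : (fun y : borel G => phi i (a i * y)%g - phi i y) \in Linf_pred haar.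
  apply: LinfD; first exact: bounded_borel_Linf.
  by apply: LinfN; exact: bounded_borel_Linf.
have : e <= mval (fun y : borel G => \sum_(i < n) (phi i (a i * y)%g - phi i y)).
  rewrite -{1}(mval_cst meanmu e); apply: (mval_le meanmu).
  - exact: cst_Linf.
  - exact: Linf_sum.
  move=> y; apply: le_trans (Lge y) _; rewrite le_eqVlt; apply/orP; left; apply/eqP.
  rewrite {1}(single_sum (S y)).
  have Lsum (I : Type) (t : seq I) (F : I -> 'I_n -> L1) : L (\sum_(k <- t) F k) = \sum_(k <- t) L (F k).
    by elim: t => [|k t ih]; rewrite ?big_nil// !big_cons LD ih.
  by rewrite Lsum; apply: eq_bigr => i _; rewrite /S singleB LD LN.
rewrite (mval_sum meanmu)// big1 ?leNgt ?e0// => i _.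
rewrite (mvalB meanmu); [|exact: bounded_borel_Linf|exact: bounded_borel_Linf].
by rewrite (tlim_left_invariant hG lcG haarP tlim)// subrr.
Qed.

End RightReiter.

Section UniformReiter.
Context {R : realType} {G : topologicalGroupType}.
Hypothesis hG : hausdorff_space G.
Hypothesis lcG : locally_compact [set: G].
Variable haar : {measure set (borel G) -> \bar R}.
Hypothesis haarP : left_haar_measure haar.
Variable mu : Linf haar -> R.
Hypothesis tlim : TLIM haar mu.
Implicit Types (x y z : G) (A B C K N U V W : set G) (f g : borel G -> R).

Local Notation m := (fmeas haar).
Local Notation mu_ := (mu_ haar).
Local Notation rconv := (rconv hG lcG haarP).

Lemma uniform_nbhs (I : finType) (A : I -> set G) (e : R) : 0 < e ->
  (forall i, compact (A i)) -> (forall i, 0 < m (A i)) ->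
  exists2 U, compact U & 0 < m U /\ forall i, exists2 s : seq (R * G), convex_weights s &
    norm1 haar (fun z => \sum_(p <- s) p.1 * mu_ (rtranslate U p.2) z - mu_ (A i) z) <= e.
Proof.
move=> e0 cA A0.
have /choice[N NP] : forall i, exists N, nbhs (1%g : G) N /\ forall U, compact U -> 0 < m U -> U `<=` N ->
  exists2 s : seq (R * G), convex_weights s &
    norm1 haar (fun z => \sum_(p <- s) p.1 * mu_ (rtranslate U p.2) z - mu_ (A i) z) <= e.
  by move=> i; have [N N1 NP] := right_approx hG lcG haarP (cA i) (A0 i) e0; exists N.
have NN : nbhs (1%g : G) [set x | forall i, N i x].
  by apply: filter_forall => i; exact: (NP i).1.
have [U cU [U1 UI UN]] := compact_nbhs hG lcG NN.
have U0 : 0 < m U by apply: nbhs_pos U1.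
exists U => //; split => // i; apply: (NP i).2 => // z /UN; exact.
Qed.

(** By compactness of [L] and continuity of translation finitely many translates of
    [A] matter. Their densities are almost combinations of densities of sets [U a] with a
    common [U], and the weights of [right_reiter] make all those almost
    indistinguishable from that of [U]. *)
Lemma reiter (L : set G) (e : R) : compact L -> 0 < e ->
  exists A (s : seq (R * G)), [/\ compact A, 0 < m A, convex_weights s & forall x, L x ->
    norm1 haar (fun z => rconv s (mu_ (translate x A)) z - rconv s (mu_ A) z) <= e].
Proof.
move=> cL e0; pose t := e / 5; have t0 : 0 < t by rewrite /t; lra.
have [A cA [A1 _ _]] := compact_nbhs hG lcG (filterT : nbhs (1%g : G) setT).
have A0 : 0 < m A by apply: nbhs_pos A1.
have cxA x : compact (translate x A) by exact: compact_translate.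
have xA0 x : 0 < m (translate x A) by rewrite fmeas_translate//; exact: compact_meas.
pose near x := [set w | norm1 haar (fun z => mu_ (translate w (translate x A)) z - mu_ (translate x A) z) <= t].
have nearP x : nbhs (1%g : G) (near x) by exact: left_continuity.
have [|n [x [P [_ _ PB _ LE]]]] := @compact_pieces _ hG L (fun x => rtranslate (near x)° x) cL.
  move=> x Lx; split; first by apply: open_rtranslate; exact: open_interior.
  by rewrite /rtranslate/= mulgV; exact: nearP.
have net y : L y -> exists i, norm1 haar (fun z => mu_ (translate y A) z - mu_ (translate (x i) A) z) <= t.
  rewrite {1}LE => Ly; have [i Piy] : exists i, P i y.
    elim/big_ind : _ Ly => [|X Y HX HY [/HX|/HY]|i _] //.
    by move=> Piy; exists i.
  exists i; have [_ /interior_subset] := PB _ _ Piy.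
  by rewrite /near/= -translateM mulgVK.
(* None stands for the set A itself, to which its translates are compared *)
pose B (i : option 'I_n) := translate (if i is Some j then x j else 1%g) A.
have [U cU [U0 UP]] := @uniform_nbhs _ B t t0 (fun i => cxA _) (fun i => xA0 _).
have /choice[s sP] : forall i, exists s : seq (R * G), convex_weights s /\
    norm1 haar (fun z => \sum_(p <- s) p.1 * mu_ (rtranslate U p.2) z - mu_ (B i) z) <= t.
  by move=> i; have [s s1 s2] := UP i; exists s.
pose all_s := flatten [seq s i | i <- enum {: option 'I_n}].
have [r cr rP] := right_reiter hG lcG haarP tlim
  (fun j : 'I_(size all_s) => (nth (0, 1%g) all_s j).2) cU U0 t0.
have cUx y : compact (rtranslate U y) by exact: compact_rtranslate.
have ixA y := integ_mu hG haarP (cxA y).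
have iUy y := integ_mu hG haarP (cUx y).
have iU := integ_mu hG haarP cU.
have rint f : integ haar f -> integ haar (rconv r f) by exact: integ_rconv.
have atU i : norm1 haar (fun z => rconv r (mu_ (B i)) z - rconv r (mu_ U) z) <= t + t.
  have [cs sle] := sP i.
  pose c := fun z => \sum_(p <- s i) p.1 * mu_ (rtranslate U p.2) z.
  have ic : integ haar c by apply: integ_sum => p _; exact: integZ.
  apply: le_trans (norm1_tri (rint _ (ixA _)) (rint _ ic) (rint _ iU)) _; apply: lerD.
    rewrite -rconvB; apply: le_trans (rconv_le hG lcG haarP cr (integB (ixA _) ic)) _.
    by rewrite norm1C.
  have -> : (fun z => rconv r c z - rconv r (mu_ U) z) = (fun z => \sum_(p <- s i) p.1 *
      (rconv r (mu_ (rtranslate U p.2)) z - rconv r (mu_ U) z)).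
    apply/funext => z; rewrite /c (rconv_sum hG lcG haarP (s i) (fun p => p.1)).
    under [in RHS]eq_bigr do rewrite mulrBr; rewrite sumrB -mulr_suml cs.2 mul1r//.
  have iD p : integ haar (fun z => rconv r (mu_ (rtranslate U p)) z - rconv r (mu_ U) z).
    by apply: integB; exact: rint.
  apply: le_trans (norm1_sum _ (P := xpredT) _) _; first by move=> p _; exact: integZ.
  have small p : p \in s i -> norm1 haar (fun z => rconv r (mu_ (rtranslate U p.2)) z - rconv r (mu_ U) z) <= t.
    move=> ps; have pall : p \in all_s by apply/flattenP; exists (s i) => //; apply: map_f; rewrite mem_enum.
    have pi : (index p all_s < size all_s)%N by rewrite index_mem.
    by have := rP (Ordinal pi); rewrite /= nth_index.
  rewrite -[leRHS]mul1r -cs.2 mulr_suml big_seq [leRHS]big_seq; apply: ler_sum => p ps.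
  have p0 : 0 <= p.1 by have /allP := cs.1; apply.
  by rewrite norm1Z// ger0_norm// ler_wpM2l// small.
exists A, r; split => // y Ly; have [i yi] := net y Ly.
have -> : e = t + (t + t) + (t + t) by rewrite /t; lra.
have iA := integ_mu hG haarP cA.
apply: le_trans (norm1_tri (rint _ (ixA _)) (rint _ iU) (rint _ iA)) _; apply: lerD.
  apply: le_trans (norm1_tri (rint _ (ixA _)) (rint _ (ixA (x i))) (rint _ iU)) _; apply: lerD.
    by rewrite -rconvB; exact: le_trans (rconv_le hG lcG haarP cr (integB (ixA _) (ixA _))) yi.
  exact: (atU (Some i)).
by rewrite norm1C; have := atU None; rewrite /B translate1.
Qed.

End UniformReiter.

(** * Folner sets *)

Section Quantization.
Context {R : realType}.
Variable t : R.
Hypothesis t0 : 0 < t.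

(** [y] rounded down to a multiple of [t], but at most [M * t]; written as a sum over
    levels because the level sets of a function are what is wanted. *)
Definition quant M (y : R) : R := \sum_(i < M) t * (i.+1%:R * t <= y)%R%:R.

Lemma quantS M y : quant M.+1 y = quant M y + t * (M.+1%:R * t <= y)%R%:R.
Proof. by rewrite /quant big_ord_recr. Qed.

Lemma quant_full M y : M%:R * t <= y -> quant M y = M%:R * t.
Proof.
elim: M => [|M ih] My; first by rewrite /quant big_ord0 mul0r.
have ES : M.+1%:R * t = M%:R * t + t by rewrite -natr1 mulrDl mul1r.
rewrite quantS My mulr1 ih ?ES//.
by apply: le_trans My; rewrite ES lerDl ltW.
Qed.

Lemma quant_le M y : 0 <= y -> quant M y <= y.
Proof.
move=> y0; elim: M => [|M ih]; first by rewrite /quant big_ord0.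
have [My|My] := boolP (M.+1%:R * t <= y)%R; first by rewrite quant_full.
by rewrite quantS (negPf My) mulr0 addr0.
Qed.

Lemma quant_ge M y : y < M.+1%:R * t -> y - t <= quant M y.
Proof.
elim: M => [|M ih] yM; first by rewrite /quant big_ord0; move: yM; lra.
have [My|My] := boolP (M.+1%:R * t <= y)%R.
  by rewrite quant_full//; move: yM; rewrite -[M.+2%:R]natr1 mulrDl mul1r; lra.
by rewrite quantS (negPf My) mulr0 addr0 ih// ltNge.
Qed.

Lemma quant_dist M y y' : 0 <= y -> 0 <= y' -> y < M.+1%:R * t -> y' < M.+1%:R * t ->
  \sum_(i < M) t * `|(i.+1%:R * t <= y)%R%:R - (i.+1%:R * t <= y')%R%:R| <= `|y - y'| + t.
Proof.
wlog yy' : y y' / y' <= y.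
  move=> H y0 y'0 yM y'M; have [|/ltW] := leP y' y; first by move=> ?; exact: H.
  move=> h; rewrite distrC; apply: le_trans (H y' y h y'0 y0 y'M yM).
  by apply: ler_sum => i _; rewrite distrC.
move=> y0 y'0 yM y'M; have -> : \sum_(i < M) t * `|(i.+1%:R * t <= y)%R%:R - (i.+1%:R * t <= y')%R%:R|
    = quant M y - quant M y'.
  rewrite /quant -sumrB; apply: eq_bigr => i _; rewrite -mulrBr; congr (_ * _).
  rewrite ger0_norm// subr_ge0 ler_nat.
  by have [h|//] := boolP (_ <= y')%R; rewrite (le_trans h yy').
have := quant_le M y0; have := quant_ge y'M; rewrite ger0_norm; lra.
Qed.

End Quantization.

Section LevelSets.
Context {R : realType} {G : topologicalGroupType}.
Hypothesis hG : hausdorff_space G.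
Hypothesis lcG : locally_compact [set: G].
Variable haar : {measure set (borel G) -> \bar R}.
Hypothesis haarP : left_haar_measure haar.
Implicit Types (x y z : G) (A B C K N U V W : set G) (f g : borel G -> R).

Local Notation m := (fmeas haar).
Local Notation mu_ := (mu_ haar).
Local Notation rconv := (rconv hG lcG haarP).

Lemma fmeas_symdiff A B : compact A -> compact B ->
  m (symdiff A B) = norm1 haar (fun z => \1_A z - \1_B z).
Proof.
move=> cA cB; have mA := compact_meas hG cA; have mB := compact_meas hG cB.
have mS : measurable (symdiff A B : set (borel G)).
  by apply: measurableU; exact: measurableD.
rewrite -(rint_indic haar mS); apply: rint_ext => z.
rewrite !indicE /symdiff in_setU !in_setD.
by case: (z \in A); case: (z \in B); rewrite /= ?subrr ?normr0 ?subr0 ?normr1 ?sub0r ?normrN1.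
Qed.

(** Indicators of closed sets are upper semicontinuous, and so are their positive
    combinations. *)
Lemma level_compact A (s : seq (R * G)) (t : R) : compact A -> 0 < t ->
  all (fun p => 0 <= p.1) s -> compact [set z : G | t <= rconv s (mu_ A) z].
Proof.
move=> cA t0 s0; set f := rconv s (mu_ A).
have fE : f = fun z => \sum_(p <- s) p.1 * mu_ (rtranslate A p.2) z by exact: rconv_mu.
have cAp y : compact (rtranslate A y) by exact: compact_rtranslate.
(* f takes finitely many values, so upper semicontinuity needs no error term *)
have usc z : \forall w \near nbhs (z : G), f w <= f z.
  rewrite fE; elim: s s0 {f fE} => [|p s ih] /=.
    by move=> _; near=> w; rewrite !big_nil.
  move=> /andP[p0 /ih {}ih].
  have near_ind : \forall w \near nbhs (z : G), ((w \in rtranslate A p.2) <= (z \in rtranslate A p.2))%N.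
    have [zA|zA] := boolP (z \in rtranslate A p.2); first by near=> w; exact: leq_b1.
    have : nbhs z (~` rtranslate A p.2).
      by apply: open_nbhs_nbhs; split; [rewrite openC; exact: compact_closed|rewrite notin_setE in zA].
    by apply: filterS => w nw; rewrite memNset.
  near=> w; rewrite !big_cons lerD//; last by near: w.
  rewrite ler_wpM2l// /Defs.mu_ ler_wpM2r ?invr_ge0 ?fine_ge0// !indicE ler_nat.
  by near: w.
have -> : [set z : G | t <= f z] =
    (\big[setU/set0]_(p <- s) rtranslate A p.2) `&` [set z : G | t <= f z].
  apply/seteqP; split => z; last by case.
  move=> tz; split => //; move: tz; rewrite /= fE => tz; apply: contrapT => nz.
  suff : \sum_(p <- s) p.1 * mu_ (rtranslate A p.2) z = 0 by move: tz => /[swap] ->; rewrite leNgt t0.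
  rewrite big_seq big1// => p ps; rewrite /Defs.mu_ indicE memNset ?mul0r ?mulr0// => Az.
  by apply: nz; rewrite -bigcup_seq; exists p.
apply: compact_closedI; first by apply: bigsetU_compact => p _.
rewrite -(setCK [set z | _]) closedC openE => z /=.
move=> /negP; rewrite -ltNge => fz; rewrite /interior.
by apply: filterS (usc z) => w /= fw; apply/negP; rewrite -ltNge (le_lt_trans fw).
Unshelve. all: by end_near. Qed.

End LevelSets.

Section LevelFamily.
Context {R : realType} {G : topologicalGroupType}.
Hypothesis hG : hausdorff_space G.
Hypothesis lcG : locally_compact [set: G].
Variable haar : {measure set (borel G) -> \bar R}.
Hypothesis haarP : left_haar_measure haar.
Variable mu : Linf haar -> R.
Hypothesis tlim : TLIM haar mu.
Implicit Types (x y z : G) (A B C K N U V W : set G) (f g : borel G -> R).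

Local Notation m := (fmeas haar).
Local Notation mu_ := (mu_ haar).
Local Notation rconv := (rconv hG lcG haarP).

(** A density [f] is almost the integral of the indicators of its level sets, and as
    these are nested the measures by which a translation displaces them add up to the
    norm by which it displaces [f]. *)
Lemma level_family (L : set G) (e : R) : compact L -> 0 < e ->
  exists M (B : 'I_M -> set G) (c : 'I_M -> R),
    [/\ forall i, compact (B i), forall i, 0 <= c i,
        1 / 2 <= \sum_(i < M | 0 < m (B i)) c i &
        forall x, L x -> \sum_(i < M | 0 < m (B i))
          c i * norm1 haar (fun z => mu_ (translate x (B i)) z - mu_ (B i) z) <= e].
Proof.
move=> cL e0; have e2 : 0 < e / 2 by lra.
have [A [s [cA A0 cs sP]]] := reiter hG lcG haarP tlim cL e2.
have cAp y : compact (rtranslate A y) by exact: compact_rtranslate.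
set f := rconv s (mu_ A) in sP.
have fE : f = fun z => \sum_(p <- s) p.1 * mu_ (rtranslate A p.2) z by exact: rconv_mu.
pose K := \big[setU/set0]_(p <- s) rtranslate A p.2.
have cK : compact K by apply: bigsetU_compact => p _.
have mK := compact_meas hG cK; have Koo := compact_fin haarP cK.
have iK : integ haar (\1_K : borel G -> R) by exact: integ_indic.
have If : integ haar f by apply: integ_rconv => //; exact: integ_mu.
have fK z : ~ K z -> f z = 0.
  move=> nK; rewrite fE big_seq big1// => p ps; rewrite /Defs.mu_ indicE memNset ?mul0r ?mulr0//.
  by move=> Az; apply: nK; rewrite /K -bigcup_seq; exists p.
have sp p : p \in s -> 0 <= p.1 by case: cs => /allP s0 _ /s0.
have f0 z : 0 <= f z.
  by rewrite fE big_seq sumr_ge0// => p ps; rewrite mulr_ge0 ?sp// mu_ge0.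
pose C := \sum_(p <- s) p.1 * (m (rtranslate A p.2))^-1.
have fC z : f z <= C.
  rewrite fE /C big_seq [leRHS]big_seq; apply: ler_sum => p ps; rewrite ler_wpM2l ?sp//.
  rewrite /Defs.mu_ -/(m _) ler_piMl ?invr_ge0 ?fmeas_ge0// indicE.
have f1 : rint haar f = 1.
  rewrite fE rint_sum; last by move=> p _; exact/integZ/integ_mu.
  rewrite -[RHS]cs.2; apply: eq_bigr => p _; rewrite rintZ; last exact: integ_mu.
  by rewrite rint_mu ?mulr1//; exact: (rtranslate_pos hG lcG haarP).
pose k := m K; have k0 : 0 <= k by exact: fmeas_ge0.
have [t [t0 tk1 tke]] : exists t, [/\ 0 < t, t * k <= 1 / 2 & 2 * (t * k) <= e / 2].
  have [t [t0 t1 te]] := small_quantum 3 e0.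
  exists (t / (4 * (k + 1))); have k1 : 0 < 4 * (k + 1) by lra.
  have kk : k / (4 * (k + 1)) <= 1 / 4.
    by rewrite ler_pdivrMr//; lra.
  have kk0 : 0 <= k / (4 * (k + 1)) by rewrite divr_ge0// ltW.
  split; first exact: divr_gt0.
    by rewrite mulrAC -mulrA; nra.
  by rewrite mulrAC -[t * k / _]mulrA; nra.
have [M CM] : exists M : nat, C / t < M.+1%:R.
  exists (Num.bound (C / t)); have C0 : 0 <= C.
    by rewrite /C big_seq sumr_ge0// => p ps; rewrite mulr_ge0 ?sp// invr_ge0 fmeas_ge0.
  apply: lt_trans (archi_boundP _) _; first by rewrite divr_ge0// ltW.
  by rewrite ltr_nat.
have fM z : f z < M.+1%:R * t by rewrite -ltr_pdivrMr//; apply: le_lt_trans CM; rewrite ler_pM2r ?invr_gt0.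
pose B (i : 'I_M) : set G := [set z | i.+1%:R * t <= f z].
have cB i : compact (B i).
  by apply: level_compact => //; [rewrite mulr_gt0|exact: cs.1].
have mB i := compact_meas hG (cB i); have Boo i := compact_fin haarP (cB i).
have iB i : integ haar (\1_(B i) : borel G -> R) by exact: integ_indic.
have BE i z : \1_(B i) z = (i.+1%:R * t <= f z)%R%:R :> R.
  by rewrite indicE; congr (_ _)%:R; apply/idP/idP; rewrite inE.
have iq (i : 'I_M) : integ haar (fun z => t * (i.+1%:R * t <= f z)%R%:R).
  by apply: integ_ext (integZ t (iB i)) => z /=; rewrite BE.
exists M, B, (fun i => t * m (B i)); split => //.
- by move=> i; rewrite mulr_ge0 ?fmeas_ge0// ltW.
- have -> : \sum_(i < M | 0 < m (B i)) t * m (B i) = rint haar (fun z => quant t M (f z)).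
    rewrite rint_sum; last by move=> i _; exact: iq.
    rewrite big_mkcond/=; apply: eq_bigr => i _.
    have -> : rint haar (fun z => t * (i.+1%:R * t <= f z)%R%:R) = t * m (B i).
      by rewrite -(rint_indic haar (mB i)) -rintZ//; apply: rint_ext => z; rewrite BE.
    by case: ifPn => //; rewrite -leNgt => mB0; have -> : m (B i) = 0;
      [apply/eqP; rewrite eq_le mB0 fmeas_ge0|rewrite mulr0].
  apply: (@le_trans _ _ (rint haar (fun z => f z - t * \1_K z))).
    rewrite rintB//; last exact: integZ.
    by rewrite rintZ// rint_indic// f1 -/k; lra.
  apply: rint_le.
  + by apply: integB => //; exact: integZ.
  + by apply: integ_sum => i _; exact: iq.
  + move=> z; rewrite indicE; have [zK|zK] := boolP (z \in K); first by rewrite mulr1; exact: quant_ge.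
    by rewrite mulr0 subr0 fK ?quant_le//; [apply: sumr_ge0 => i _; rewrite mulr_ge0// ltW|rewrite notin_setE in zK].
move=> x Lx; have := sP x Lx.
have cxB i : compact (translate x (B i)) by exact: compact_translate.
have ixB i : integ haar (\1_(translate x (B i)) : borel G -> R).
  by apply: integ_indic; [exact: compact_meas|exact: compact_fin].
have cxK : compact (translate x K) by exact: compact_translate.
have mxK := compact_meas hG cxK.
have ixK : integ haar (\1_(translate x K) : borel G -> R).
  by apply: integ_indic => //; exact: compact_fin.
have -> : (fun z => rconv s (mu_ (translate x A)) z - f z) = (fun z => f (x^-1 * z)%g - f z).
  apply/funext => z; congr (_ - _); rewrite /f /rconv; apply: eq_bigr => p _.
  by rewrite (mu_translate hG haarP)// mulgA.
set d := fun z => f (x^-1 * z)%g - f z; move=> d_le.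
have Id : integ haar d by apply: integB => //; exact: (integ_lshift haarP).
have BxE i z : \1_(translate x (B i)) z = (i.+1%:R * t <= f (x^-1 * z)%g)%R%:R :> R.
  by rewrite -BE !indicE translateE.
pose h z := \sum_(i < M) t * `|\1_(translate x (B i)) z - \1_(B i) z|.
have ih i : integ haar (fun z => t * `|\1_(translate x (B i)) z - \1_(B i) z|).
  by apply/integZ/integ_abs; exact: integB.
apply: (@le_trans _ _ (rint haar h)).
  rewrite rint_sum// big_mkcond/=; apply: ler_sum => i _.
  case: ifPn => [B0|_]; last by apply: rint_ge0 => z; rewrite mulr_ge0// ltW.
  rewrite rintZ; last exact/integ_abs/integB.
  rewrite -mulrA ler_pM2l// -[X in X * _](gtr0_norm B0) -norm1Z; last exact: (integB (integ_mu hG haarP (cxB i)) (integ_mu hG haarP (cB i))).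
  rewrite le_eqVlt; apply/orP; left; apply/eqP/rint_ext => z; congr (`|_|).
  rewrite !mu_E fmeas_translate// mulrBr !mulrA divff ?mul1r//; exact: lt0r_neq0.
apply: (@le_trans _ _ (rint haar (fun z => `|d z| + t * (\1_K z + \1_(translate x K) z)))).
  have iKK : integ haar (fun z => \1_K z + \1_(translate x K) z : R) by exact: integD.
  apply: rint_le; [exact: integ_sum|by apply: integD; [exact: integ_abs|exact: integZ]|].
  move=> z; rewrite /h; under eq_bigr do rewrite BE BxE.
  have [kz|kz] := pselect (K z \/ translate x K z).
    apply: le_trans (quant_dist t0 _ _ _ _) _ => //; rewrite lerD2l ler_peMr//; first exact: ltW.
    rewrite !indicE; case: kz => kz; rewrite (mem_set kz); first by rewrite lerDl.
    by rewrite lerDr.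
  rewrite !fK; last 2 first.
  + by move=> kz'; apply: kz; left.
  + by move=> kz'; apply: kz; right; rewrite translateE.
  rewrite big1; last by move=> i _; rewrite subrr normr0 mulr0.
  by rewrite addr_ge0// mulr_ge0 ?(ltW t0)// addr_ge0.
rewrite rintD; [|exact: integ_abs|by apply: integZ; exact: integD].
rewrite rintZ; last exact: integD.
rewrite rintD// !rint_indic// fmeas_translate// -/k.
by move: d_le; rewrite /norm1; lra.
Qed.

End LevelFamily.

Section FolnerSets.
Context {R : realType} {G : topologicalGroupType}.
Hypothesis hG : hausdorff_space G.
Hypothesis lcG : locally_compact [set: G].
Variable haar : {measure set (borel G) -> \bar R}.
Hypothesis haarP : left_haar_measure haar.
Variable mu : Linf haar -> R.
Hypothesis tlim : TLIM haar mu.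
Implicit Types (x y z : G) (A B C K N U V W : set G) (f g : borel G -> R).

Local Notation m := (fmeas haar).
Local Notation mu_ := (mu_ haar).

Definition displacement B x : R := norm1 haar (fun z => mu_ (translate x B) z - mu_ B z).

Lemma displacement_ge0 B x : 0 <= displacement B x.
Proof. exact: norm1_ge0. Qed.

(** The translates by [x * y] and by [x] differ by the translate by [x] of the
    displacement by [y]. *)
Lemma displacement_mul B x y : compact B ->
  displacement B x <= displacement B y + displacement B (x * y)%g.
Proof.
move=> cB; have ci z : integ haar (mu_ (translate z B)).
  by apply: (integ_mu hG haarP); exact: compact_translate.
have iB := integ_mu hG haarP cB.
rewrite /displacement; apply: le_trans (norm1_tri (ci x) (ci (x * y)%g) iB) _.
rewrite lerD2r norm1C -(norm1_lshift haarP x (integB (ci y) iB)).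
rewrite le_eqVlt; apply/orP; left; apply/eqP/rint_ext => z.
by rewrite translateM !(mu_translate hG haarP x)//; exact: compact_translate.
Qed.

Lemma displacement_le2 B x : compact B -> 0 < m B -> displacement B x <= 2.
Proof.
move=> cB B0; have cxB : compact (translate x B) by exact: compact_translate.
have i1 := integ_mu hG haarP cxB; have i2 := integ_mu hG haarP cB.
apply: le_trans (norm1D i1 (integN i2)) _; rewrite norm1N !norm1_mu//.
exact: translate_pos.
Qed.

Lemma displacement_continuous B : compact B -> 0 < m B -> continuous (displacement B : G -> R).
Proof.
move=> cB B0.
have cxB x : compact (translate x B) by exact: compact_translate.
apply: (@continuous_from_close _ _ _ (fun y y0 => norm1 haar (fun z => mu_ (translate y B) z - mu_ (translate y0 B) z))).
  move=> y0 e e0.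
  have H := left_continuity hG haarP (cxB y0) (translate_pos hG haarP y0 cB B0) e0.
  have := @continuous_rmul G y0^-1%g y0; rewrite /continuous_at mulgV => /(_ _ H) H2.
  by apply: filterS (H2 : nbhs y0 _) => y /=; rewrite -translateM mulgVK.
move=> y y0; have i0 := integ_mu hG haarP cB.
have iy := integ_mu hG haarP (cxB y); have iy0 := integ_mu hG haarP (cxB y0).
rewrite /displacement ler_distl; apply/andP; split.
  by rewrite lerBlDr addrC [X in _ <= X + _]norm1C; exact: norm1_tri.
by rewrite addrC; exact: norm1_tri.
Qed.

Lemma mean_bound_exists M (c F : 'I_M -> R) (P : pred 'I_M) (b : R) : 0 < b ->
  (forall i, 0 <= c i) -> 1 / 2 <= \sum_(i < M | P i) c i ->
  \sum_(i < M | P i) c i * F i <= b -> exists2 i, P i & F i <= 4 * b.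
Proof.
move=> b0 c0 sc sF; apply: contrapT => H.
have : \sum_(i < M | P i) c i * (4 * b) <= \sum_(i < M | P i) c i * F i.
  apply: ler_sum => i Pi; rewrite ler_wpM2l// leNgt; apply/negP => /ltW lt.
  by apply: H; exists i.
rewrite -mulr_suml => /le_trans /(_ sF).
have : 1 / 2 * (4 * b) <= (\sum_(i < M | P i) c i) * (4 * b) by rewrite ler_wpM2r//; lra.
lra.
Qed.

(** Some level set [B] has a small average displacement over [L], the union of [N] and
    [K N]. By Markov's inequality the displacement is small on [L] outside of a set of
    measure less than half of that of [N]. So for [k] in [K] there is [u] in [N]
    such that [u] and [k * u] are both good, and then so is their quotient [k]. *)
Lemma folner K (e : R) : compact K -> 0 < e ->
  exists A, [/\ compact A, 0 < m A & forall x, K x -> displacement A x < e].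
Proof.
move=> cK e0.
have [N cN [N1 _ _]] := compact_nbhs hG lcG (filterT : nbhs (1%g : G) setT).
have N0 : 0 < m N by apply: nbhs_pos N1.
pose L := N `|` mulset K N.
have cL : compact L by apply: compactU => //; exact: compact_mulset.
have mL := compact_meas hG cL; have Loo := compact_fin haarP cL.
have mN := compact_meas hG cN; have Noo := compact_fin haarP cN.
have L0 : 0 < m L by apply: lt_le_trans N0 _; apply: fmeas_le => //; exact: subsetUl.
(* 32: a factor 4 is lost in choosing the level and 2 in the threshold e / 2,
   and the exceptional set must have measure at most m N / 4 *)
pose t := e * m N / (32 * m L).
have t0 : 0 < t by rewrite divr_gt0 ?mulr_gt0.
have [M [B [c [cB c0 sc sD]]]] := level_family hG lcG haarP tlim cL t0.
have iL : integ haar (\1_L : borel G -> R) by exact: integ_indic.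
have iD i : 0 < m (B i) -> integ haar (fun x : borel G => \1_L x * displacement (B i) x).
  move=> B0; apply: (integM (M := 2)) => //.
    by apply: continuous_meas; exact: displacement_continuous.
  by move=> x; rewrite ger0_norm ?displacement_ge0// displacement_le2.
have : \sum_(i < M | 0 < m (B i)) c i * rint haar (fun x : borel G => \1_L x * displacement (B i) x) <= t * m L.
  rewrite -(rint_indic haar mL) -rintZ//.
  have -> : \sum_(i < M | 0 < m (B i)) c i * rint haar (fun x : borel G => \1_L x * displacement (B i) x) =
      rint haar (fun x : borel G => \sum_(i < M | 0 < m (B i)) c i * (\1_L x * displacement (B i) x)).
    rewrite rint_sum; last by move=> i B0; apply: integZ; exact: iD.
    by apply: eq_bigr => i B0; rewrite rintZ//; exact: iD.
  apply: rint_le; [by apply: integ_sum => i B0; apply: integZ; exact: iD|exact: integZ|].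
  move=> x; rewrite indicE; have [xL|xL] := boolP (x \in L).
    rewrite mulr1; apply: le_trans (sD x (set_mem xL)); apply: ler_sum => i _.
    by rewrite mul1r.
  by rewrite big1 ?mulr0// => i _; rewrite mul0r mulr0.
move=> /(mean_bound_exists (mulr_gt0 t0 L0) c0 sc)[i B0 Di].
exists (B i); split => // k Kk.
pose bad := L `&` [set x : borel G | e / 2 <= displacement (B i) x].
have mD : measurable_fun setT (displacement (B i) : borel G -> R).
  by apply: continuous_meas; exact: displacement_continuous.
have mbad : measurable (bad : set (borel G)).
  apply: measurableI => //.
  have := mD measurableT `[e / 2, +oo[%classic (measurable_itv _).
  rewrite setTI; congr measurable; apply/seteqP; split => z; rewrite /= in_itv/= andbT//.
have badoo : (haar bad < +oo)%E by apply: sub_fin Loo => // z [].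
have badN : m bad < m N / 2.
  have : e / 2 * m bad <= 4 * (t * m L).
    apply: le_trans Di; rewrite -(rint_indic haar mbad) -rintZ; last exact: integ_indic.
    apply: rint_le; [by apply: integZ; exact: integ_indic|exact: iD|].
    move=> x; rewrite !indicE /bad in_setI; have [xL|_] := boolP (x \in L); last by rewrite mulr0 mul0r.
    rewrite mul1r; have [|_] := boolP (x \in _); last by rewrite mulr0 displacement_ge0.
    by rewrite inE mulr1.
  have -> : 4 * (t * m L) = e / 2 * (m N / 4).
    by rewrite /t; field; rewrite lt0r_neq0.
  rewrite ler_pM2l; [lra|by rewrite divr_gt0].
pose bad' := translate k^-1%g bad.
have mbad' : measurable (bad' : set (borel G)) by exact: meas_translate.
have bad'oo : (haar bad' < +oo)%E by rewrite (haar_left_invariant haarP).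
have [u Nu [nbad nbad']] : exists2 u, N u & ~ bad u /\ ~ bad' u.
  apply: contrapT => H; have : (haar N <= haar bad + haar bad')%E.
    apply: le_trans (measureU2 _ mbad mbad'); apply: le_measure; rewrite ?inE//.
      exact: measurableU.
    move=> u Nu; apply: contrapT => /not_orP nb; apply: H; exists u => //.
  rewrite -(fmeasE Noo) -(fmeasE badoo) -(fmeasE bad'oo) -EFinD lee_fin.
  by rewrite /bad' fmeas_translate//; move: badN; lra.
have Du : displacement (B i) u < e / 2.
  by rewrite ltNge; apply/negP => h; apply: nbad; split => //; left.
have Dku : displacement (B i) (k * u)%g < e / 2.
  rewrite ltNge; apply/negP => h; apply: nbad'; rewrite /bad' translateE/= invgK; split => //.
  by right; exact: mulset_in.
by apply: le_lt_trans (displacement_mul k u (cB i)) _; lra.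
Qed.

End FolnerSets.

(** * Groups that are not sigma-compact *)

Section NotSigmaCompact.
Context {R : realType} {G : topologicalGroupType}.
Hypothesis hG : hausdorff_space G.
Hypothesis lcG : locally_compact [set: G].
Variable haar : {measure set (borel G) -> \bar R}.
Hypothesis haarP : left_haar_measure haar.
Hypothesis kappaG : kappa_gt [set: G] [set: nat].
Variable mu : Linf haar -> R.
Hypothesis tlim : TLIM haar mu.
Implicit Types (x y z : G) (A B C K N U V W : set G) (f g : borel G -> R).

Local Notation m := (fmeas haar).
Local Notation mval := (mval mu).
Local Notation modular := (modular hG lcG haarP).

Let meanmu : mean haar mu. Proof. by case: tlim. Qed.

Lemma escape_sequence (D : nat -> set G) : (forall n, compact (D n)) -> exists x, forall n, ~ D n x.
Proof.
move=> cD; apply: contrapT => H; apply: (kappaG (C := range D)); last exact: card_image_le.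
split=> [_ [n _ <-]//|x _]; apply: contrapT => nx; apply: H; exists x => n Dx.
by apply: nx; exists (D n) => //; exists n.
Qed.

(** In this form: the translate of the union of the [C n] by [x] is disjoint from its
    translates by the elements of [l]. *)
Lemma escape_translates (C : nat -> set G) (l : seq G) : (forall n, compact (C n)) ->
  exists x, forall y n k a b, y \in l -> C n a -> C k b -> x != (y * a * b^-1)%g.
Proof.
move=> cC; pose D j := if unpickle j is Some (i, n, k) then
  translate (nth 1%g l i) (mulset (C n) (invset (C k))) else set0.
have cD j : compact (D j).
  rewrite /D; case: unpickle => [[[i n] k]|]; last exact: compact0.
  by apply: compact_translate; apply: compact_mulset => //; exact: compact_invset.
have [x xP] := escape_sequence cD; exists x => y n k a b yl Ca Cb.
apply/eqP => xE; apply: (xP (pickle (index y l, n, k))); rewrite /D pickleK nth_index//.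
exists (a * b^-1)%g; last by rewrite xE mulgA.
by apply: mulset_in => //; rewrite /invset/= invgK.
Qed.

(** The group contains arbitrarily many disjoint left translates of the
    sigma-compact set, all with the same mean, and the total mean is [1]. *)
Lemma sigma_compact_null (S : set (borel G)) (C : nat -> set G) : measurable S ->
  (forall n, compact (C n)) -> S `<=` \bigcup_n C n -> mval \1_S = 0.
Proof.
move=> mS cC SC.
have disj n : exists2 l : seq G, size l = n &
    forall z : borel G, \sum_(y <- l) (\1_S (y^-1 * z)%g : R) <= 1.
  elim: n => [|n [l ls lP]]; first by exists [::] => // z; rewrite big_nil ler01.
  have [x xP] := escape_translates l cC; exists (x :: l); first by rewrite /= ls.
  move=> z; rewrite big_cons; have [xz|xz] := boolP ((x^-1 * z)%g \in S); last first.
    by rewrite indicE (negPf xz) add0r.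
  rewrite big_seq big1 ?addr0 ?indicE ?xz// => y yl; rewrite indicE memNset// => yz.
  have [i _ Ci] := SC _ (set_mem xz); have [j _ Cj] := SC _ yz.
  by have /negP := xP y j i _ _ yl Cj Ci; apply; rewrite invgM invgK mulVKg mulVKg.
have bS : bounded_borel (\1_S : borel G -> R).
  split; first exact: measurable_indic.
  by exists 1 => x; rewrite indicE; case: (_ \in _); rewrite ?normr1 ?normr0.
have S0 : 0 <= mval \1_S by apply: (mval_ge0 meanmu); [exact: bounded_borel_Linf|move=> x].
set M := mval \1_S in S0 *.
have H n : n%:R * M <= 1.
  have [l ls lP] := disj n.
  have bt y : bounded_borel (fun z : borel G => \1_S (y^-1 * z)%g : R) by exact: bounded_translate.
  rewrite -[leRHS](mval_cst meanmu 1).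
  have -> : n%:R * M = mval (fun z : borel G => \sum_(y <- l) (\1_S (y^-1 * z)%g : R)).
    rewrite (mval_sum meanmu); last by move=> y; apply: bounded_borel_Linf; exact: bt.
    under eq_bigr do rewrite (tlim_left_invariant hG lcG haarP tlim _ bS).
    by rewrite big_const_seq count_predT ls iter_addr_0 mulr_natl.
  apply: (mval_le meanmu) => //; last exact: cst_Linf.
  by apply: Linf_sum => y; apply: bounded_borel_Linf; exact: bt.
apply/eqP; rewrite eq_le S0 andbT leNgt; apply/negP => Spos.
have := archi_boundP (ltW (divr_gt0 ltr01 Spos)).
by rewrite ltr_pdivrMr// ltNge H.
Qed.

Definition unbounded (S : set G) := forall C, compact C -> exists2 y, S y & ~ C y.

(** The slices with rational [a] are countably many and cover [S]. If each of them
    were inside a compact set, [S] would be inside a sigma-compact one, hence of mean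
    zero. *)
Lemma unbounded_slice (S : set (borel G)) (t : R) : measurable S -> 0 < t -> 0 < mval \1_S ->
  exists2 a, 0 < a & unbounded (S `&` [set y : G | a <= modular y <= (1 + t) * a]).
Proof.
move=> mS t0 Spos; apply: contrapT => H.
have /choice[C CP] : forall n : nat, exists C, compact C /\
    forall q : rat, unpickle n = Some q -> 0 < (ratr q : R) ->
      S `&` [set y : G | ratr q <= modular y <= (1 + t) * ratr q] `<=` C.
  move=> n; case E : (unpickle n) => [q|]; last by exists set0; split => //; exact: compact0.
  have [q0|q0] := ltP 0 (ratr q : R); last first.
    exists set0; split; first exact: compact0.
    by move=> q' [<-]; rewrite ltNge q0.
  have /existsNP[C /not_implyP[cC nC]] : ~ unbounded (S `&` [set y : G | ratr q <= modular y <= (1 + t) * ratr q]).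
    by move=> nb; apply: H; exists (ratr q).
  exists C; split => // q' [<-] _ y Sy; apply: contrapT => nCy; apply: nC; exists y => //.
have := sigma_compact_null mS (fun n => (CP n).1); rewrite (_ : _ `<=` _ = True).
  by move=> /(_ Logic.I) S0; rewrite S0 ltxx in Spos.
rewrite propeqE; split => // _ y Sy.
have D0 := modular_gt0 hG lcG haarP y.
have lt : modular y / (1 + t) < modular y by rewrite ltr_pdivrMr ?ltr_pMr//; lra.
have [q] := rat_in_itvoo lt; rewrite in_itv/= => /andP[q1 q2].
exists (pickle q) => //; apply: ((CP _).2 q) => //; first exact: pickleK.
  by apply: lt_trans q1; rewrite divr_gt0//; lra.
split => //=; rewrite (ltW q2)/= mulrC -ler_pdivrMr; [exact: ltW|lra].
Qed.

(** The translate [A y] meets [B] only for [y] in the compact set [A^-1 B], which an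
    unbounded set leaves. Disjointness is recorded by indicators, the form in
    which densities add up. *)
Lemma disjoint_selection (Q : eqType) A (T : Q -> set G) (qs : seq Q) : compact A ->
  (forall q, q \in qs -> unbounded (T q)) ->
  exists ys : seq (Q * G), [/\ [seq p.1 | p <- ys] = qs, forall p, p \in ys -> T p.1 p.2 &
    forall z, \sum_(p <- ys) (\1_(rtranslate A p.2) z : R) =
      \1_(\big[setU/set0]_(p <- ys) rtranslate A p.2) z].
Proof.
move=> cA; elim: qs => [|q qs ih] Tq.
  by exists [::]; split => // z; rewrite !big_nil indicE in_set0.
have [|ys [yq yT yP]] := ih; first by move=> q' q'qs; apply: Tq; rewrite inE q'qs orbT.
pose B := \big[setU/set0]_(p <- ys) rtranslate A p.2.
have cB : compact B by apply: bigsetU_compact => p _; exact: compact_rtranslate.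
have [y Ty yB] := Tq q (mem_head _ _) _ (compact_mulset (compact_invset cA) cB).
exists ((q, y) :: ys); split; first by rewrite /= yq.
  by move=> p; rewrite inE => /predU1P[->//|]; exact: yT.
move=> z; rewrite !big_cons/= yP -/B !indicE in_setU.
have [zA|_] := boolP (z \in rtranslate A y); last by rewrite add0r.
rewrite memNset ?addr0// => zB; apply: yB.
have -> : y = ((z * y^-1)^-1 * z)%g by rewrite invgM invgK mulgVK.
by apply: mulset_in => //; rewrite /invset/= invgK; rewrite inE in zA.
Qed.

End NotSigmaCompact.

(** * The mean of a compact set *)

Section AlmostEverywhere.
Context d {T : measurableType d} {R : realType}.
Variable mu : {measure set T -> \bar R}.
Implicit Types f g : T -> R.

Lemma ae_mono (P Q : set T) : (forall x, P x -> Q x) ->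
  {ae mu, forall x, P x} -> {ae mu, forall x, Q x}.
Proof. by move=> PQ; apply: filterS. Qed.

Lemma integ_ae_le f g : measurable_fun setT f -> integ mu g -> (forall x, 0 <= g x) ->
  {ae mu, forall x, `|f x| <= g x} -> integ mu f.
Proof.
move=> mf Ig g0 fg; apply/integrableP; split; first exact/measurable_EFinP.
have /integrableP[mg goo] := Ig; apply: le_lt_trans goo.
have mf' : measurable_fun setT (EFin \o f) by exact/measurable_EFinP.
apply: ae_ge0_le_integral => //.
- exact: measurableT_comp.
- exact: measurableT_comp.
- by apply: filterS fg => x fgx _ /=; rewrite lee_fin (ger0_norm (g0 x)).
Qed.

Lemma rint_ae_ge0 f : integ mu f -> {ae mu, forall x, 0 <= f x} -> 0 <= rint mu f.
Proof.
move=> If f0; have -> : rint mu f = norm1 mu f.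
  congr fine; apply: ae_eq_integral => //.
  - by have /integrableP[] := If.
  - by have /integrableP[] := integ_abs If.
  - by apply: filterS f0 => x fx _ /=; rewrite ger0_norm.
exact: norm1_ge0.
Qed.

Lemma rint_ae_le f g : integ mu f -> integ mu g ->
  {ae mu, forall x, f x <= g x} -> rint mu f <= rint mu g.
Proof.
move=> If Ig fg; rewrite -subr_ge0 -rintB//; apply: rint_ae_ge0; first exact: integB.
by apply: filterS fg => x; rewrite subr_ge0.
Qed.

End AlmostEverywhere.

Section UniformMean.
Context {R : realType} {G : topologicalGroupType}.
Hypothesis hG : hausdorff_space G.
Variable haar : {measure set (borel G) -> \bar R}.
Hypothesis haarP : left_haar_measure haar.
Implicit Types (x y z : G) (A B C K N U V W : set G).

Local Notation m := (fmeas haar).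
Local Notation mu_ := (mu_ haar).

Variable A : set G.
Hypothesis cA : compact A.
Hypothesis A0 : 0 < m A.

Let mA := compact_meas hG cA.
Let Aoo := compact_fin haarP cA.

Lemma mu_outside z : ~ A z -> mu_ A z = 0.
Proof. by move=> nA; rewrite /Defs.mu_ indicE memNset// mul0r. Qed.

Lemma locally_ae_mu (P : set (borel G)) : locally_ae haar P ->
  {ae haar, forall x, A x -> P x}.
Proof.
move=> /(_ A mA Aoo); apply: negligibleS => x /= nP; split.
  by apply: contrapT => nA; apply: nP.
by move=> Px; apply: nP.
Qed.

Lemma mu_Linf_measurable (phi : Linf haar) :
  measurable_fun setT (fun x : borel G => mu_ A x * phi x).
Proof.
have [mphi _] : locally_measurable_fun haar phi /\ locally_ess_bounded haar phi.
  by have := Linf_funP phi; rewrite inE.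
have -> : (fun x : borel G => mu_ A x * phi x) = (fun x => (m A)^-1 * (phi \_ A) x).
  apply/funext => x; rewrite mu_E patchE indicE.
  by case: ifP => _; rewrite ?mulr1// ?mulr0 ?mul0r.
apply: measurable_funM => //.
by apply/(measurable_restrictT _ mA); exact: mphi.
Qed.

Lemma mu_Linf_le (phi : Linf haar) M : locally_ae haar [set x | `|phi x| <= M] ->
  integ haar (fun x => mu_ A x * phi x) /\ `|rint haar (fun x => mu_ A x * phi x)| <= `|M|.
Proof.
move=> phiM; have IA := integ_mu hG haarP cA.
have ae1 : {ae haar, forall x : borel G, `|mu_ A x * phi x| <= `|M| * mu_ A x}.
  apply: ae_mono (locally_ae_mu phiM) => x /= H.
  have [Ax|nA] := pselect (A x); last by rewrite mu_outside// mul0r mulr0 normr0.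
  rewrite normrM (ger0_norm (mu_ge0 _ _ _)) mulrC ler_wpM2r ?mu_ge0//.
  exact: le_trans (H Ax) (ler_norm _).
have Iphi : integ haar (fun x => mu_ A x * phi x).
  apply: (integ_ae_le _ (integZ `|M| IA)) => //; first exact: mu_Linf_measurable.
  by move=> x; rewrite mulr_ge0 ?mu_ge0.
split => //; apply: le_trans (le_norm1 Iphi) _.
rewrite -[leRHS]mulr1 -(rint_mu hG haarP cA A0) -rintZ//.
by apply: rint_ae_le => //; [exact: integ_abs|exact: integZ].
Qed.

Lemma mu_Linf_integ (phi : Linf haar) : integ haar (fun x => mu_ A x * phi x).
Proof.
have [_ [M phiM]] : locally_measurable_fun haar phi /\ locally_ess_bounded haar phi.
  by have := Linf_funP phi; rewrite inE.
by have [] := mu_Linf_le phiM.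
Qed.

Lemma mean_mu : mean haar (L1_functional (mu_ A)).
Proof.
split.
- move=> a u v; rewrite /L1_functional -!/(rint haar _).
  rewrite -rintZ; last exact: mu_Linf_integ.
  rewrite -rintD; [|exact/integZ/mu_Linf_integ|exact: mu_Linf_integ].
  apply: rint_ext => x.
  rewrite [in LHS](_ : (a *: u + v) x = a * u x + v x)//.
  by rewrite mulrDr mulrCA.
- apply/eqP; rewrite eq_le; apply/andP; split.
    apply: ge_ereal_sup => _ [phi phi1 <-]; rewrite lee_fin.
    apply/ler_addgt0Pr => e e0.
    set S := [set M | 0 <= M /\ locally_ae haar [set x | `|phi x| <= M]].
    have infS : has_inf S.
      split; last by exists 0 => M [].
      have := Linf_funP phi; rewrite inE/= => -[_ [M phiM]].
      exists `|M|; split => //; apply: locally_ae_mono phiM => x /= /le_trans; apply; exact: ler_norm.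
    have [M [M0 SM] ltM] := inf_adherent e0 infS.
    apply: le_trans (mu_Linf_le SM).2 _; rewrite ger0_norm//.
    by apply/ltW/(lt_le_trans ltM); rewrite lerD2r.
  apply: ereal_sup_ubound; exists (to_Linf haar (fun=> 1)).
    apply: ge_inf; first by exists 0 => M [].
    by split => //; apply: locally_aeT => x /=; rewrite to_LinfE ?cst_Linf// normr1.
  congr (_%:E); rewrite /L1_functional -/(rint haar _) (@rint_ext _ _ _ _ _ (mu_ A)).
    by rewrite rint_mu// normr1.
  by move=> x; rewrite to_LinfE ?cst_Linf// mulr1.
- move=> phi phi0; apply: rint_ae_ge0; first exact: mu_Linf_integ.
  apply: ae_mono (locally_ae_mu phi0) => x /= H.
  have [Ax|nA] := pselect (A x); last by rewrite mu_outside// mul0r.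
  by rewrite mulr_ge0 ?mu_ge0 ?H.
Qed.

Lemma L1_functional_chi (E : set (borel G)) : locally_measurable haar E ->
  L1_functional (mu_ A) (chi haar E) = pairing haar (mu_ A) E.
Proof. by move=> lE; rewrite /L1_functional chiE. Qed.

End UniformMean.

(** * Amalgamation of disjoint translates *)

Section Slices.
Context {R : realType} {G : topologicalGroupType}.

Lemma sum_slices (t v : R) K : 0 < t -> 0 <= v -> v < K%:R * t ->
  \sum_(j <- iota 0 K) (j%:R * t <= v < j.+1%:R * t)%R%:R = 1 :> R.
Proof.
move=> t0 v0 vK; pose u j : R := - (j%:R * t <= v)%R%:R.
have -> : iota 0 K = index_iota 0 K by rewrite /index_iota subn0.
rewrite (eq_bigr (fun j => u j.+1 - u j)); last first.
  move=> j _; rewrite /u opprK; have le : j%:R * t <= j.+1%:R * t by rewrite ler_pM2r// ler_nat.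
  have [h|h] := leP (j.+1%:R * t) v.
    by rewrite (le_trans le h)/= addNr.
  by rewrite andbT oppr0 add0r.
by rewrite GRing.telescope_sumr// /u mul0r v0 (leNgt _ v) vK oppr0 add0r opprK.
Qed.

(** Slice the range of each function and intersect. A partition is encoded by its
    indicators adding up to [1], so that empty pieces may occur. *)
Lemma small_oscillation (I : eqType) (s : seq I) (F : I -> borel G -> R) (t : R) : 0 < t ->
  (forall i, i \in s -> measurable_fun setT (F i) /\ forall z, 0 <= F i z <= 1) ->
  exists L : seq (set (borel G)), [/\ forall S, S \in L -> measurable S,
    forall z, \sum_(X <- L) (\1_X z : R) = 1 &
    forall S, S \in L -> forall i, i \in s -> forall z z', S z -> S z' -> `|F i z - F i z'| <= t].
Proof.
move=> t0; elim: s => [|i s ih] Fs.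
  exists [:: setT]; split => //; last by move=> z; rewrite big_seq1 indicT.
  by move=> S; rewrite inE => /eqP ->; exact: measurableT.
have [|L [mL L1 Losc]] := ih; first by move=> j js; apply: Fs; rewrite inE js orbT.
have [mF F01] := Fs i (mem_head _ _).
have [K Kt] : exists K : nat, 1 < K%:R * t.
  exists (Num.bound (1 / t)); rewrite -ltr_pdivrMr//; apply: archi_boundP.
  by rewrite divr_ge0// ltW.
pose slice (j : nat) : set (borel G) := [set z | j%:R * t <= F i z < j.+1%:R * t].
have mslice j : measurable (slice j).
  have := mF measurableT `[j%:R * t, j.+1%:R * t[%classic (measurable_itv _).
  by rewrite setTI; congr measurable; apply/seteqP; split => z; rewrite /= in_itv.
exists [seq X `&` slice j | X <- L, j <- iota 0 K]; split.
- by move=> _ /allpairsP[[S j] [/= SL _ ->]]; apply: measurableI => //; exact: mL.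
- move=> z; rewrite big_allpairs_dep -[RHS](L1 z); apply: eq_bigr => S _.
  rewrite -[RHS]mulr1 -(@sum_slices t (F i z) K)//; last 2 first.
  + by case/andP: (F01 z).
  + by apply: le_lt_trans Kt; case/andP: (F01 z).
  rewrite mulr_sumr; apply: eq_bigr => j _; rewrite !indicE in_setI -mulnb natrM.
  by congr (_ * _%:R); congr nat_of_bool; apply/idP/idP; rewrite inE.
- move=> _ /allpairsP[[S j] [/= SL _ ->]] k; rewrite inE => /predU1P[->|ks] z z' [Sz /andP[z1 z2]] [Sz' /andP[z'1 z'2]].
    have : j.+1%:R * t = j%:R * t + t by rewrite -natr1 mulrDl mul1r.
    by rewrite ler_norml => jt; apply/andP; split; lra.
  exact: Losc SL _ ks _ _ Sz Sz'.
Qed.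

Lemma nat_above (x : R) : 0 <= x -> exists N : nat, x <= N%:R <= x + 1.
Proof.
move=> x0; have := Num.Theory.truncn_itv x0 => /andP[h1 h2].
exists (Num.truncn x).+1; rewrite (ltW h2)/= -natr1; lra.
Qed.

End Slices.

Section Amalgamation.
Context {R : realType} {G : topologicalGroupType}.
Hypothesis hG : hausdorff_space G.
Hypothesis lcG : locally_compact [set: G].
Variable haar : {measure set (borel G) -> \bar R}.
Hypothesis haarP : left_haar_measure haar.
Implicit Types (x y z : G) (A B C K N U V W : set G) (f g : borel G -> R).

Local Notation m := (fmeas haar).
Local Notation mu_ := (mu_ haar).
Local Notation modular := (modular hG lcG haarP).
Local Notation rconv := (rconv hG lcG haarP).

Lemma displacement_symdiff B x : compact B -> 0 < m B ->
  m (symdiff (translate x B) B) / m B = displacement haar B x.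
Proof.
move=> cB B0; have cxB : compact (translate x B) by exact: compact_translate.
have ii C : compact C -> integ haar (\1_C : borel G -> R).
  by move=> cC; apply: integ_indic; [exact: compact_meas|exact: compact_fin].
have iB0 : 0 < (m B)^-1 by rewrite invr_gt0.
rewrite (fmeas_symdiff hG haar)// mulrC -[X in X * _](gtr0_norm iB0) -norm1Z; last first.
  by apply: integB; exact: ii.
apply: rint_ext => z; rewrite !mu_E (fmeas_translate haarP) ?mulrBr//; exact: compact_meas.
Qed.

Section Union.
Variables (Q : eqType) (A : set G) (ys : seq (Q * G)).
Hypothesis cA : compact A.
Hypothesis A0 : 0 < m A.
Let B := \big[setU/set0]_(p <- ys) rtranslate A p.2.
Hypothesis disjB : forall z, \sum_(p <- ys) (\1_(rtranslate A p.2) z : R) = \1_B z.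
Let W := \sum_(p <- ys) modular p.2.
Hypothesis W0 : 0 < W.
Let s := [seq (modular p.2 / W, p.2) | p <- ys].

Lemma union_compact : compact B.
Proof. by apply: bigsetU_compact => p _; exact: compact_rtranslate. Qed.

Lemma union_fmeas : m B = W * m A.
Proof.
have cAy y : compact (rtranslate A y) by exact: compact_rtranslate.
have mB := compact_meas hG union_compact.
have iA y : integ haar (\1_(rtranslate A y) : borel G -> R).
  by apply: integ_indic; [exact: compact_meas|exact: compact_fin].
rewrite -(rint_indic haar mB).
have -> : (\1_B : borel G -> R) = fun z => \sum_(p <- ys) \1_(rtranslate A p.2) z.
  by apply/funext => z; rewrite disjB.
rewrite rint_sum// mulr_suml; apply: eq_bigr => p _.
by rewrite rint_indic ?modular_compact//; exact: compact_meas.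
Qed.

Lemma union_pos : 0 < m B.
Proof. by rewrite union_fmeas mulr_gt0. Qed.

Lemma union_weights : convex_weights s.
Proof.
split; last by rewrite big_map/= -mulr_suml divff// lt0r_neq0.
rewrite all_map; apply/allP => p _ /=.
by rewrite divr_ge0 ?(ltW W0)// ltW// modular_gt0.
Qed.

(** The translate [A y] takes the share [modular y / W] of the measure of the
    union. *)
Lemma union_mu : mu_ B = rconv s (mu_ A).
Proof.
apply/funext => z; rewrite mu_E union_fmeas -disjB mulr_sumr /rconv big_map/=.
apply: eq_bigr => p _; rewrite mu_E !indicE.
have -> : ((z * p.2^-1)%g \in A) = (z \in rtranslate A p.2) by apply/idP/idP; rewrite !inE.
have D0 := modular_gt0 hG lcG haarP p.2.
by field; rewrite !lt0r_neq0.
Qed.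

(** Right convolution commutes with left translations and does not increase the
    norm. *)
Lemma union_displacement x : displacement haar B x <= displacement haar A x.
Proof.
have cxA : compact (translate x A) by exact: compact_translate.
rewrite /displacement (mu_translate hG haarP x union_compact) union_mu.
have -> : (fun z => rconv s (mu_ A) (x^-1 * z)%g - rconv s (mu_ A) z) =
    rconv s (fun z => mu_ (translate x A) z - mu_ A z).
  rewrite rconvB; apply/funext => z; congr (_ - _); rewrite /rconv; apply: eq_bigr => p _.
  by rewrite (mu_translate hG haarP x cA) mulgA.
apply: rconv_le; first exact: union_weights.
by apply: integB; exact: (integ_mu hG haarP).
Qed.

Lemma union_pairing (E : set (borel G)) : locally_measurable haar E ->
  W * pairing haar (mu_ B) E = \sum_(p <- ys) modular p.2 * translate_avg haar A E p.2.
Proof.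
move=> lE; have cAy y : compact (rtranslate A y) by exact: compact_rtranslate.
rewrite union_mu (rconv_mu hG lcG haarP _ cA).
have [_ ->] := pairing_sum (B := fun p : R * G => rtranslate A p.2) hG haarP s (fun p => p.1)
  (fun p => cAy _) (fun p => loc_meas_compact hG haarP lE (cAy _)).
rewrite big_map/= mulr_sumr; apply: eq_bigr => p _.
by rewrite mulrA mulrCA divff ?mulr1// lt0r_neq0.
Qed.

End Union.

End Amalgamation.

(** * Approximation of an invariant mean *)

(** Replacing [D p] by [a p.1] and [f p] by [v p.1] costs [2 * t] times the sum of the
    [a p.1]; replacing [A q] by [c q * T0] costs [t * T0]; replacing the total weight
    by [T0] costs [3 * t * T0]. *)
Lemma weighted_average_close (R : realType) (Q : finType) (T : eqType) (ys : seq (Q * T))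
    (D f : Q * T -> R) (a c v A : Q -> R) (t T0 : R) :
  0 < t -> t <= 1 -> 0 < T0 ->
  (forall p, p \in ys -> [/\ a p.1 <= D p, D p <= (1 + t) * a p.1, 0 <= a p.1,
     `|f p - v p.1| <= t & 0 <= f p <= 1]) ->
  (forall q, 0 <= v q <= 1) ->
  (forall q, 0 <= c q) -> \sum_q c q = 1 ->
  (forall q, c q * T0 <= A q <= (1 + t) * (c q * T0)) ->
  (forall H : Q -> R, \sum_(p <- ys) a p.1 * H p.1 = \sum_q A q * H q) ->
  T0 <= \sum_(p <- ys) D p /\
  `|\sum_(p <- ys) D p * f p - (\sum_(p <- ys) D p) * \sum_q c q * v q|
     <= 8 * t * \sum_(p <- ys) D p.
Proof.
move=> t0 t1 T00 ysP v01 c0 c1 AP count.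
set W := \sum_(p <- ys) D p; set mu := \sum_q c q * v q.
have sumA : \sum_(p <- ys) a p.1 = \sum_q A q.
  have := count (fun=> 1); under eq_bigr do rewrite mulr1.
  by under [in RHS]eq_bigr do rewrite mulr1.
set S := \sum_(p <- ys) a p.1 in sumA.
have sumcT : \sum_q c q * T0 = T0 by rewrite -mulr_suml c1 mul1r.
have ST : T0 <= S by rewrite sumA -[leLHS]sumcT; apply: ler_sum => q _; case/andP: (AP q).
have ST' : S <= (1 + t) * T0.
  by rewrite sumA -[in leRHS]sumcT mulr_sumr; apply: ler_sum => q _; case/andP: (AP q).
have SW : S <= W.
  by rewrite /S /W big_seq [leRHS]big_seq; apply: ler_sum => p /ysP[].
have WS : W <= (1 + t) * S.
  by rewrite /S /W mulr_sumr big_seq [leRHS]big_seq; apply: ler_sum => p /ysP[].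
have mu0 : 0 <= mu by apply: sumr_ge0 => q _; rewrite mulr_ge0//; case/andP: (v01 q).
have mu1 : mu <= 1.
  rewrite -c1; apply: ler_sum => q _; rewrite ler_piMr//; case/andP: (v01 q) => //.
split; first exact: le_trans SW.
have H1 : `|\sum_(p <- ys) D p * f p - \sum_(p <- ys) a p.1 * v p.1| <= 2 * t * S.
  rewrite -sumrB; apply: le_trans (ler_norm_sum _ _ _) _.
  rewrite mulr_sumr big_seq [leRHS]big_seq; apply: ler_sum => p /ysP[aD Da a0 fv /andP[f0 f1]].
  have -> : D p * f p - a p.1 * v p.1 = (D p - a p.1) * f p + a p.1 * (f p - v p.1) by ring.
  apply: le_trans (ler_normD _ _) _; rewrite !normrM.
  rewrite (ger0_norm a0) (ger0_norm f0) (ger0_norm (_ : 0 <= D p - a p.1)) ?subr_ge0//.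
  have : (D p - a p.1) * f p <= t * a p.1.
    by apply: (@le_trans _ _ (D p - a p.1)); [rewrite ler_piMr// subr_ge0|lra].
  have : a p.1 * `|f p - v p.1| <= a p.1 * t by rewrite ler_wpM2l.
  lra.
have H2 : `|\sum_(p <- ys) a p.1 * v p.1 - T0 * mu| <= t * T0.
  rewrite (count v) /mu mulr_sumr -sumrB -[in leRHS]sumcT mulr_sumr.
  apply: le_trans (ler_norm_sum _ _ _) _; apply: ler_sum => q _.
  have /andP[A1 A2] := AP q; have /andP[v0 v1] := v01 q.
  have -> : A q * v q - T0 * (c q * v q) = (A q - c q * T0) * v q by ring.
  rewrite normrM (ger0_norm v0) ger0_norm ?subr_ge0//.
  by apply: (@le_trans _ _ (A q - c q * T0)); [rewrite ler_piMr// subr_ge0|lra].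
have WT : W - T0 <= 3 * t * T0.
  have : (1 + t) * S <= (1 + t) * ((1 + t) * T0) by rewrite ler_wpM2l//; lra.
  have : t * t * T0 <= t * T0 by rewrite ler_wpM2r ?ler_piMr// ltW.
  lra.
have H3 : `|T0 * mu - W * mu| <= 3 * t * T0.
  rewrite -mulrBl normrM distrC (ger0_norm mu0) ger0_norm; last lra.
  by apply: le_trans WT; rewrite ler_piMr//; lra.
have TW : t * T0 <= t * W by rewrite ler_wpM2l ?(ltW t0)//; lra.
have tS : t * S <= t * ((1 + t) * T0) by rewrite ler_wpM2l// ltW.
have ttT : t * (t * T0) <= t * T0 by rewrite ler_piMl// mulr_ge0 ?ltW.
move: H1 H2 H3; rewrite !ler_norml => /andP[? ?] /andP[? ?] /andP[? ?].
by apply/andP; split; lra.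
Qed.

Section FolnerApproximation.
Context {R : realType} {G : topologicalGroupType}.
Hypothesis hG : hausdorff_space G.
Hypothesis lcG : locally_compact [set: G].
Variable haar : {measure set (borel G) -> \bar R}.
Hypothesis haarP : left_haar_measure haar.
Hypothesis kappaG : kappa_gt [set: G] [set: nat].
Variable mu : Linf haar -> R.
Hypothesis tlim : TLIM haar mu.

Local Notation m := (fmeas haar).
Local Notation mu_ := (mu_ haar).
Local Notation mval := (mval mu).
Local Notation modular := (modular hG lcG haarP).

Let meanmu : mean haar mu. Proof. by case: tlim. Qed.

(** The set is a union of disjoint right translates of a Folner set, their numbers in
    the cells [S i] being proportional to the means [c i] of the cells, corrected by
    the typical value [a i] of the modular function at the points chosen there. *)
Lemma folner_approx (s : seq (set (borel G))) (K : set G) (e : R) : compact K -> 0 < e < 1 ->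
  (forall E, E \in s -> locally_measurable haar E) ->
  exists B, [/\ compact B, 0 < m B, forall x, K x -> displacement haar B x < e &
    forall E, E \in s -> `|mval \1_E - pairing haar (mu_ B) E| < e].
Proof.
(* 8 t comes from the rounding of weights and t from the oscillation on cells *)
move=> cK /andP[e0 e1] ls; pose t := e / 10.
have t0 : 0 < t by rewrite /t; lra.
have t1 : t <= 1 by rewrite /t; lra.
have [A [cA A0 AK]] := folner hG lcG haarP tlim cK e0.
have avgP E : E \in s -> measurable_fun setT (translate_avg haar A E : borel G -> R) /\
    forall z, 0 <= translate_avg haar A E z <= 1.
  move=> Es; split; last by move=> z; exact: (translate_avg_bound hG lcG haarP z cA A0 (ls E Es)).
  by have [] := translate_avg_bounded hG lcG haarP cA A0 (ls E Es).
have [L [mL L1 Losc]] := small_oscillation t0 avgP.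
pose n := size L; pose S (i : 'I_n) : set (borel G) := nth set0 L i.
have SL i : S i \in L by exact: mem_nth.
have sumL (V : nmodType) (F : set (borel G) -> V) : \sum_(X <- L) F X = \sum_i F (S i).
  by rewrite (big_nth set0) big_mkord.
have bS i : bounded_borel (\1_(S i) : borel G -> R).
  split; first by apply: measurable_indic; exact: mL.
  by exists 1 => x; rewrite indicE; case: (_ \in _); rewrite ?normr1 ?normr0.
have SLinf i : (\1_(S i) : borel G -> R) \in Linf_pred haar by exact: bounded_borel_Linf.
pose c i := mval \1_(S i).
have c0 i : 0 <= c i by apply: (mval_ge0 meanmu) => // x.
have c1 : \sum_i c i = 1.
  rewrite -(mval_cst meanmu 1) -(mval_sum meanmu)//; congr mval; apply/funext => z.
  by rewrite -(L1 z) sumL.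
have /choice[a aP] : forall i, exists a, 0 < a /\ (0 < c i ->
    unbounded (S i `&` [set y : G | a <= modular y <= (1 + t) * a])).
  move=> i; have [ci|ci] := ltP 0 (c i); last by exists 1.
  by have [a a0 aU] := unbounded_slice hG lcG haarP kappaG tlim (mL _ (SL i)) t0 ci; exists a.
(* T0 is the total weight aimed at, so large that one more translate changes
   the weight of a cell by a factor of at most 1 + t *)
pose T0 := \sum_(i | 0 < c i) a i / (t * c i) + 1.
have T00 : 0 < T0.
  rewrite ltr_wpDl// sumr_ge0// => i ci; rewrite divr_ge0 ?mulr_ge0//; first exact: ltW (aP i).1.
  exact: ltW.
have aT i : 0 < c i -> a i <= t * (c i * T0).
  move=> ci; rewrite mulrA mulrC -ler_pdivrMr ?mulr_gt0// /T0 (bigD1 i)//= -addrA lerDl.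
  rewrite addr_ge0// sumr_ge0// => j /andP[cj _]; rewrite divr_ge0 ?mulr_ge0//; first exact: ltW (aP j).1.
  exact: ltW.
have /choice[N NP] : forall i, exists N : nat, c i * T0 / a i <= N%:R <= c i * T0 / a i + 1.
  move=> i; apply: nat_above; rewrite divr_ge0 ?mulr_ge0//; first exact: ltW.
  exact: ltW (aP i).1.
pose N' i := if 0 < c i then N i else 0%N.
pose qs : seq 'I_n := flatten [seq nseq (N' i) i | i <- enum 'I_n].
pose slice i := S i `&` [set y : G | a i <= modular y <= (1 + t) * a i].
have qsU q : q \in qs -> unbounded (slice q).
  move=> /flattenP[_ /mapP[i _ ->]]; rewrite mem_nseq => /andP[Ni /eqP ->].
  have ci : 0 < c i by move: Ni; rewrite /N'; case: ifP.
  exact: ((aP i).2 ci).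
have [ys [ysq ysT ysD]] := @disjoint_selection R G _ A slice qs cA qsU.
(* the default value of xget only serves for empty cells, which have mean 0 *)
pose v E i := translate_avg haar A E (xget (1%g : G) (S i)).
have count (H : 'I_n -> R) : \sum_(p <- ys) a p.1 * H p.1 = \sum_i ((N' i)%:R * a i) * H i.
  rewrite -(big_map fst xpredT (fun q => a q * H q)) ysq big_flatten/= big_map big_enum/=.
  apply: eq_bigr => i _; rewrite big_nseq iter_addr_0 -mulrA mulr_natl//.
have NT i : c i * T0 <= (N' i)%:R * a i <= (1 + t) * (c i * T0).
  have ai := (aP i).1; rewrite /N'; case: ifPn => [ci|]; last first.
    rewrite -leNgt => ci; have -> : c i = 0 by apply/eqP; rewrite eq_le ci c0.
    by rewrite !mul0r mulr0 lexx.
  have /andP[N1 N2] := NP i; rewrite -ler_pdivrMr// N1/= -ler_pdivlMr//.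
  apply: le_trans N2 _; rewrite ler_pdivlMr// mulrDl divfK ?lt0r_neq0// mul1r mulrDl mul1r lerD2l.
  exact: aT.
set W := \sum_(p <- ys) modular p.2.
have ysa p : p \in ys -> [/\ a p.1 <= modular p.2, modular p.2 <= (1 + t) * a p.1 & 0 <= a p.1].
  by move=> /ysT[_ /= /andP[ap1 ap2]]; split => //; exact: ltW (aP _).1.
have TW : T0 <= W.
  pose f0 := fun _ : 'I_n * G => 0 : R; pose v0 := fun _ : 'I_n => 0 : R.
  have v01 q : 0 <= v0 q <= 1 by rewrite lexx ler01.
  have f0P p : p \in ys -> [/\ a p.1 <= modular p.2, modular p.2 <= (1 + t) * a p.1,
      0 <= a p.1, `|f0 p - v0 p.1| <= t & 0 <= f0 p <= 1].
    by move=> /ysa[? ? ?]; split => //; rewrite /f0 ?subr0 ?normr0 ?lexx ?ler01// ltW.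
  by have [] := @weighted_average_close R 'I_n G ys (fun p => modular p.2) f0 a c v0
    (fun i => (N' i)%:R * a i) t T0 t0 t1 T00 f0P v01 c0 c1 NT count.
have W0 : 0 < W by exact: lt_le_trans TW.
exists (\big[setU/set0]_(p <- ys) rtranslate A p.2); split.
- exact: union_compact.
- exact: (union_pos cA A0 ysD W0).
- move=> x Kx; apply: le_lt_trans (AK x Kx).
  exact: (union_displacement cA A0 ysD W0).
move=> E Es; set B := \big[_/_]_(_ <- _) _.
have lE := ls E Es.
pose nu := \sum_i c i * v E i.
have [_] : T0 <= W /\ `|\sum_(p <- ys) modular p.2 * translate_avg haar A E p.2 - W * nu| <= 8 * t * W.
  apply: (@weighted_average_close R 'I_n G ys (fun p => modular p.2) (fun p => translate_avg haar A E p.2) a c (v E)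
    (fun i => (N' i)%:R * a i) t T0 t0 t1 T00 _ _ c0 c1 NT count).
    move=> p py; have [? ? ?] := ysa p py; have [Sp _] := ysT p py; split => //.
      by apply: (Losc _ (SL p.1)) => //; exact: (xgetI 1%g Sp).
    exact: (avgP E Es).2.
  by move=> i; exact: (avgP E Es).2.
rewrite -(union_pairing cA A0 ysD W0 lE) -mulrBr normrM (gtr0_norm W0) -/B.
rewrite [8 * t * W]mulrC ler_pM2l// => close1.
have bavg := translate_avg_bounded hG lcG haarP cA A0 lE.
have close2 : `|mval (translate_avg haar A E) - nu| <= t.
  have -> : nu = mval (fun z => \sum_i v E i * \1_(S i) z).
    rewrite (mval_sum meanmu); last by move=> i; exact: LinfZ.
    by apply: eq_bigr => i _; rewrite (mvalZ meanmu)// mulrC.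
  apply: (mval_dist meanmu); [exact: bounded_borel_Linf|by apply: Linf_sum => i; exact: LinfZ|].
  move=> z; have S1 : \sum_i (\1_(S i) z : R) = 1 by rewrite -(L1 z) sumL.
  rewrite -[translate_avg haar A E z]mulr1 -S1 mulr_sumr -sumrB.
  apply: le_trans (ler_norm_sum _ _ _) _; rewrite -[leRHS]mulr1 -S1 mulr_sumr.
  apply: ler_sum => i _; rewrite -mulrBl normrM indicE.
  have [zS|_] := boolP (z \in S i); last by rewrite normr0 !mulr0.
  rewrite normr1 !mulr1; apply: (Losc _ (SL i)) => //; first exact: set_mem.
  exact: (xgetI 1%g (set_mem zS)).
rewrite -(mval_translate_avg hG lcG haarP tlim cA A0 lE).
apply: le_lt_trans (ler_distD nu _ _) _; rewrite [X in _ + X]distrC.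
by apply: le_lt_trans (lerD close2 close1) _; rewrite /t; lra.
Qed.

End FolnerApproximation.

Theorem theorem6p1 (R : realType) (G : topologicalGroupType)
    (hausdorffG : hausdorff_space G) (lcG : locally_compact [set: G])
    (haar : {measure set (borel G) -> \bar R})
    (haarP : left_haar_measure haar)
    (kappaG : kappa_gt [set: G] [set: nat]) :
  TLIM0 haar = TLIM haar.
Proof.
apply/seteqP; split => [mu []//|mu tlim]; split => // P K e [finP _ lP] cK e01.
have [s Ps] := (finite_seqP P).1 finP.
have ls E : E \in s -> locally_measurable haar E by move=> Es; apply: lP; rewrite Ps.
have [B [cB B0 BK BE]] := folner_approx hausdorffG lcG haarP kappaG tlim cK e01 ls.
exists B.
  split => //; first by rewrite -fmeas_gt0//; exact: compact_fin.
  by move=> x Kx; rewrite -!/(fmeas haar _) displacement_symdiff// BK.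
split; first exact: mean_mu.
move=> E PE; have Es : E \in s by move: PE; rewrite Ps.
by rewrite L1_functional_chi; [exact: BE|exact: ls].
Qed.
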